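(* Assume (Setting for stability): (S1) $\mathcal{I}$, $(\mathcal{I}_k)_{k\ge1}$, $(\Psi_t)_{t\in\mathcal{T}}$, $(\Psi_{t,k})_{t\in\mathcal{T},k\ge1}$ are lower semi-continuous on $\mathcal{P}_\phi(E)$, and for every $k\ge1$, $\mathcal{I}_k$ has compact level sets in $\mathcal{P}_\phi(E)$. (S2) $\mathcal{F}$, $(\mathcal{F}_k)_{k\ge1}$, $(\Psi_t)_{t\in\mathcal{T}}$, $(\Psi_{t,k})_{t\in\mathcal{T},k\ge1}$ are convex. (S3) For every $k\ge1$, any probability measure that has a bounded density w.r.t. $\nu_k$ belongs to $\mathcal{D}_{\mathcal{I}_k}$. (S4) $\nu_k\to\nu$ in $\mathcal{P}_\phi(E)$, and $\sup_{k\ge1}\langle\nu,e^{\alpha\phi}\rangle+\langle\nu_k,e^{\alpha\phi}\rangle$ is finite for every $\alpha>0$. (S5) For any $\mu\in\mathcal{P}_\phi(E)$, $\lim_{k\to+\infty}\sup_{t\in\mathcal{T}}\Psi_{t,k}(\mu)\le\sup_{t\in\mathcal{T}}\Psi_t(\mu)$. (S6) If $(\mu_l)_{l\ge1}$ converges to $\mu$ in $\mathcal{P}_\phi(E)$, then $\sup_{k\ge1}|\sup_{t\in\mathcal{T}}\Psi_{t,k}(\mu_l)-\sup_{t\in\mathcal{T}}\Psi_{t,k}(\mu)|\to0$ and $|\sup_{t\in\mathcal{T}}\Psi_t(\mu_l)-\sup_{t\in\mathcal{T}}\Psi_t(\mu)|\to0$. (S7) There exists $\tilde\mu\in\mathcal{D}_{\mathcal{I}}$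 such that $\sup_{t\in\mathcal{T}}\Psi_t(\tilde\mu)<0$. In this setting, for every $k\ge1$, the problem of minimising $\mathcal{I}_k$ over $\mathcal{D}_{\mathcal{I}_k}\cap\mathcal{A}_{\Psi,k}$ has a unique minimiser, denoted by $\overline\mu_k$; and there exist $(\tilde\mu_k)_{k\ge1}$ and $k_0\ge1$ such that $\tilde\mu_k\in\mathcal{D}_{\mathcal{I}_k}$, $(H(\tilde\mu_k|\nu_k))_{k\ge1}$ is bounded and $\sup_{k\ge k_0}\sup_{t\in\mathcal{T}}\Psi_{t,k}(\tilde\mu_k)<0$; fix such $(\tilde\mu_k)_{k\ge1}$ and $k_0$. Consider the conditions (Local regularity): (R1) For every large enough $k$, the triple $(\mathcal{I}_k,\mathcal{F}_k,(\Psi_{t,k})_{t\in\mathcal{T}})$ is regular at $\overline\mu_k$ (as defined in the context). (R2) For every $k\ge k_0$, every probability measure on $E$ that has a bounded density w.r.t. $\overline\mu_k$ or w.r.t. $\tilde\mu_k$ belongs to $\mathcal{D}_{\mathcal{I}_k}$. (R3) There exists $D^{\mathcal{F},\Psi}\in[0,\infty)$ such that, for all $x\in E$, $\sup_{k\ge1}\big\{|\frac{\delta\mathcal{F}_k}{\delta\mu}(\overline\mu_k,x)|+\sup_{t\in\mathcal{T}}|\frac{\delta\Psi_{t,k}}{\delta\mu}(\overline\mu_k,x)|\big\}\le D^{\mathcal{F},\Psi}[1+\phi(x)]$. (R4) For any subsequence $(\overline\mu_{l_k})_{k\ge1}$ that converges towards some $\overline\mu_\infty$ in $\mathcal{P}_\phi(E)$: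 $\overline\mu_\infty\in\mathcal{D}_{\mathcal{I}}$; the triple $(\mathcal{I},\mathcal{F},(\Psi_t)_{t\in\mathcal{T}})$ is regular at $\overline\mu_\infty$; for every $x\in E$, as $k\to+\infty$, $|\frac{\delta\mathcal{F}_{l_k}}{\delta\mu}(\overline\mu_{l_k},x)-\frac{\delta\mathcal{F}}{\delta\mu}(\overline\mu_\infty,x)|\to0$ and $\sup_{t\in\mathcal{T}}\big\{|\Psi_{t,l_k}(\overline\mu_{l_k})-\Psi_t(\overline\mu_\infty)|+|\frac{\delta\Psi_{t,l_k}}{\delta\mu}(\overline\mu_{l_k},x)-\frac{\delta\Psi_t}{\delta\mu}(\overline\mu_\infty,x)|\big\}\to0$; moreover, the families $(x\mapsto\frac{\delta\mathcal{F}_{l_k}}{\delta\mu}(\overline\mu_{l_k},x))_{k\ge1}$ and $(x\mapsto\frac{\delta\Psi_{t,l_k}}{\delta\mu}(\overline\mu_{l_k},x))_{t\in\mathcal{T},k\ge1}$ are equi-continuous on $E$. Then: 1. Under (S1)--(S7) and (R1)--(R3), for every large enough $k$ there is $\overline\lambda_k\in\mathcal{M}_+(\mathcal{T})$ such that $$\frac{d\overline\mu_k}{d\nu_k}(x)=\frac1{\overline Z_k}\exp\Big[-\frac{\delta\mathcal{F}_k}{\delta\mu}(\overline\mu_k,x)-\int_{\mathcal{T}}\frac{\delta\Psi_{t,k}}{\delta\mu}(\overline\mu_k,x)\,\overline\lambda_k(dt)\Big],\qquad \overline Z_k\in(0,\infty),$$ and $\Psi_{t,k}(\overline\mu_k)=0$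 for $\overline\lambda_k$-a.e. $t\in\mathcal{T}$. Moreover, the sequence $(\overline\lambda_k)_k$ is weakly precompact in $\mathcal{M}_+(\mathcal{T})$. 2. Under (S1)--(S7) and (R1)--(R4), $\mathcal{I}$ has a unique minimiser $\overline\mu$ in $\mathcal{D}_{\mathcal{I}}\cap\mathcal{A}_\Psi$, which is the limit of $(\overline\mu_k)_{k\ge1}$ in $\mathcal{P}_\phi(E)$. Moreover, for any limit point $\overline\lambda_\infty$ of $(\overline\lambda_k)_k$, one has $$\frac{d\overline\mu}{d\nu}(x)=\frac1{\overline Z}\exp\Big[-\frac{\delta\mathcal{F}}{\delta\mu}(\overline\mu,x)-\int_{\mathcal{T}}\frac{\delta\Psi_t}{\delta\mu}(\overline\mu,x)\,\overline\lambda_\infty(dt)\Big],\qquad \overline Z\in(0,\infty),$$ and $\Psi_t(\overline\mu)=0$ for $\overline\lambda_\infty$-a.e. $t\in\mathcal{T}$.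
   Context: $E$ is a complete separable metric space with its Borel $\sigma$-algebra, $\mathcal{P}(E)$ is the set of Borel probability measures on $E$, and $\langle\mu,f\rangle:=\int_E f\,d\mu$. Fix a continuous $\phi:E\to[0,\infty)$. The set $\mathcal{P}_\phi(E):=\{\mu\in\mathcal{P}(E):\langle\mu,\phi\rangle<\infty\}$ carries the topology in which $\mu_k\to\mu$ iff $\langle\mu_k,\phi\rangle\to\langle\mu,\phi\rangle$ and $\langle\mu_k,f\rangle\to\langle\mu,f\rangle$ for every bounded continuous $f:E\to\mathbb{R}$. The relative entropy is $H(\mu|\nu):=\int\log\frac{d\mu}{d\nu}\,d\mu$ if $\mu\ll\nu$, and $+\infty$ otherwise. $\nu$ and $(\nu_k)_{k\ge1}$ are in $\mathcal{P}_\phi(E)$; $\mathcal{F}$ and $(\mathcal{F}_k)_{k\ge1}$ are functions $\mathcal{P}_\phi(E)\to(-\infty,+\infty]$; $\mathcal{I}:=H(\cdot|\nu)+\mathcal{F}$ and $\mathcal{I}_k:=H(\cdot|\nu_k)+\mathcal{F}_k$ on $\mathcal{P}_\phi(E)$, with domains $\mathcal{D}_{\mathcal{I}}:=\{\mu\in\mathcal{P}_\phi(E):H(\mu|\nu)<\infty,\ \mathcal{F}(\mu)<\infty\}$ and $\mathcal{D}_{\mathcal{I}_k}:=\{\mu\in\mathcal{P}_\phi(E):H(\mu|\nu_k)<\infty,\ \mathcal{F}_k(\mu)<\infty\}$. $\mathcal{T}$ is a compact metric space; $\Psi_t,\Psi_{t,k}:\mathcal{P}_\phi(E)\to\mathbb{R}$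 for $t\in\mathcal{T}$, $k\ge1$; $\mathcal{A}_\Psi:=\{\mu\in\mathcal{P}_\phi(E):\forall t\in\mathcal{T},\ \Psi_t(\mu)\le0\}$ and $\mathcal{A}_{\Psi,k}:=\{\mu\in\mathcal{P}_\phi(E):\forall t\in\mathcal{T},\ \Psi_{t,k}(\mu)\le0\}$. $\mathcal{M}_+(\mathcal{T})$ is the cone of (finite) positive Radon measures on $\mathcal{T}$. Linear functional derivative: for a convex $\mathcal{C}\subset\mathcal{P}(E)$ and $\mu\in\mathcal{C}$, $F:\mathcal{C}\to\mathbb{R}$ is differentiable at $\mu$ w.r.t. the set of directions $\mathcal{C}$ if there is a measurable map $\frac{\delta F}{\delta\mu}(\mu):E\to\mathbb{R}$, $x\mapsto\frac{\delta F}{\delta\mu}(\mu,x)$, such that for every $\mu'\in\mathcal{C}$ it is $\mu'$-integrable and $\varepsilon^{-1}[F((1-\varepsilon)\mu+\varepsilon\mu')-F(\mu)]\to\langle\mu'-\mu,\frac{\delta F}{\delta\mu}(\mu)\rangle$ as $\varepsilon\to0^+$; it is normalised by $\langle\mu,\frac{\delta F}{\delta\mu}(\mu)\rangle=0$. Regularity: for $\mathcal{J}=H(\cdot|\rho)+\mathcal{G}$ on $\mathcal{P}_\phi(E)$ with domain $\mathcal{D}_{\mathcal{J}}=\{\mu\in\mathcal{P}_\phi(E):H(\mu|\rho)<\infty,\ \mathcal{G}(\mu)<\infty\}$ and functions $(\Theta_t)_{t\in\mathcal{T}}$ on $\mathcal{P}_\phi(E)$, the triple $(\mathcal{J},\mathcal{G},(\Theta_t)_{t\in\mathcal{T}})$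 is called regular at $\overline\mu$ if: $\mathcal{D}_{\mathcal{J}}$ is convex and $\mathcal{G}$ is differentiable at $\overline\mu$ w.r.t. the set of directions $\mathcal{D}_{\mathcal{J}}$; $t\mapsto\Theta_t(\overline\mu)$ is continuous; each $\Theta_t$ is differentiable at $\overline\mu$ w.r.t. the set of directions $\mathcal{P}_\phi(E)$, uniformly in $t$, i.e. for every $\mu\in\mathcal{P}_\phi(E)$, $\lim_{\varepsilon\to0}\sup_{t\in\mathcal{T}}\big|\varepsilon^{-1}[\Theta_t((1-\varepsilon)\overline\mu+\varepsilon\mu)-\Theta_t(\overline\mu)]-\langle\mu-\overline\mu,\frac{\delta\Theta_t}{\delta\mu}(\overline\mu)\rangle\big|=0$; for every $x\in E$, $t\mapsto\frac{\delta\Theta_t}{\delta\mu}(\overline\mu,x)$ is continuous; and there is $D\in[0,\infty)$ with $\sup_{t\in\mathcal{T}}|\frac{\delta\Theta_t}{\delta\mu}(\overline\mu,x)|\le D[1+\phi(x)]$ for all $x\in E$.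
   Formalization: The unique minimiser of I_k is asserted only for k with D_{I_k}∩A_{Ψ,k} nonempty, since (S1)–(S7) allow it to be empty for small k (e.g. Ψ_{t,1}=1); the sequel takes minimisers to exist for every k, and T is nonempty. *)

(* Defs.v *)
From HB Require Import structures.
From mathcomp Require Import all_boot all_order all_algebra.
From mathcomp Require Import all_classical all_reals all_analysis.
From mathcomp Require Import measurable_realfun giry.

Set Implicit Arguments.
Unset Strict Implicit.
Unset Printing Implicit Defensive.

Import Order.TTheory GRing.Theory Num.Theory.
Import numFieldNormedType.Exports.

Local Open Scope classical_set_scope.
Local Open Scope ring_scope.
Local Open Scope charge_scope.

(* The library's measurable types are pointed, hence metric spaces carrying
   measures are taken pointed (i.e., nonempty). *)
#[short(type="pmetricType")]
HB.structure Definition PMetric (R : numDomainType) :=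
  {M of Metric R M & isPointed M}.

#[short(type="completeMetricType")]
HB.structure Definition CompleteMetric (R : numDomainType) :=
  {M of PMetric R M & Uniform_isComplete M}.

Definition separable (X : topologicalType) :=
  exists2 D : set X, countable D & dense D.

Notation borel X := (g_sigma_algebraType (@open X)).

Record weight (R : realType) (E : pmetricType R) := MkWeight {
  wfun :> E -> R ;
  weight_continuous : continuous wfun ;
  weight_ge0 : forall x, 0 <= wfun x }.

(* A library measure is a function on all sets, unconstrained on non-measurable
   ones: two elements of [Pphi] or [Mplus] are the same measure when they agree
   on measurable sets (the library's [measure_eq]), which is weaker than
   Leibniz equality. Such elements have the same neighbourhoods in the
   topologies below. *)
Record Pphi (R : realType) (E : pmetricType R) (phi : weight E) := MkPphi {
  pmeas :> probability (borel E) R ;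
  pphi_moment : (\int[pmeas]_x (phi x)%:E < +oo)%E }.

(* Initial topology of the maps [mu |-> <mu, f>], for [f] = [phi] and for [f]
   bounded continuous. *)
Definition pphi_test (R : realType) (E : pmetricType R) (phi : weight E) :=
  {f : E -> R |
    f = phi \/ continuous f /\ exists M : R, forall x, `|f x| <= M}.

Definition pphi_eval (R : realType) (E : pmetricType R) (phi : weight E)
    (mu : Pphi phi) : {ptws pphi_test phi -> R} :=
  fun f => \int[mu]_x (sval f x).

HB.instance Definition _ (R : realType) (E : pmetricType R) (phi : weight E) :=
  gen_eqMixin (Pphi phi).
HB.instance Definition _ (R : realType) (E : pmetricType R) (phi : weight E) :=
  gen_choiceMixin (Pphi phi).
HB.instance Definition _ (R : realType) (E : pmetricType R) (phi : weight E) :=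
  Topological.copy (Pphi phi) (initial_topology (@pphi_eval R E phi)).

Lemma cvg_pphiP (R : realType) (E : pmetricType R) (phi : weight E)
  (mul : nat -> Pphi phi) (mu : Pphi phi) :
  mul @ \oo --> mu <->
  (\int[mul k]_x phi x @[k --> \oo] --> \int[mu]_x phi x) /\
  forall f : E -> R, continuous f -> (exists M : R, forall x, `|f x| <= M) ->
  \int[mul k]_x f x @[k --> \oo] --> \int[mu]_x f x.
Proof.
have H : mul @ \oo --> mu <-> forall g : pphi_test phi,
    pphi_eval (mul k) g @[k --> \oo] --> pphi_eval mu g.
  split=> [mm g|mm].
    have c1 : continuous
        (@pphi_eval R E phi : initial_topology (@pphi_eval R E phi) -> _).
      exact: initial_continuous.
    have := cvg_comp _ _ mm (c1 mu) => h.
    have /cvg_sup/(_ g) hg := h.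
    exact: (cvg_comp _ _ hg (@initial_continuous {ptws pphi_test phi -> R} R
      (fun f => f g) (pphi_eval mu))).
  have h : (fun k => pphi_eval (mul k)) @ \oo --> (pphi_eval mu).
    apply/cvg_sup.
    move=> g A [_ [[B oB <-] /= Bmu BA]].
    have : nbhs (pphi_eval mu g) B by apply: open_nbhs_nbhs; split.
    move=> /(mm g) hB; apply: (@filterS _ \oo _ _ _ _ hB) => k; exact: BA.
  move=> A [_ [[B oB <-] /= Bmu BA]].
  have : nbhs (pphi_eval mu) B by apply: open_nbhs_nbhs; split.
  move=> /h hB; apply: (@filterS _ \oo _ _ _ _ hB) => k; exact: BA.
rewrite H; split=> [mm|[mphi mb] [f [fE|[cf bf]]]].
- split; first exact: (mm (exist _ _ (or_introl erefl))).
  by move=> f cf bf; exact: (mm (exist _ f (or_intror (conj cf bf)))).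
- by subst f.
- exact: mb.
Qed.

(* Finite positive Radon measures, with the weak topology, i.e., the initial
   topology of the maps [lambda |-> <lambda, f>] for [f] continuous ([T] will
   be compact). *)
Record Mplus (R : realType) (T : pmetricType R) := MkMplus {
  mmeas :> {finite_measure set (borel T) -> \bar R} ;
  mplus_radon : forall A : set (borel T), measurable A ->
    mmeas A =
    ereal_sup [set mmeas K | K in [set K : set T | compact K /\ K `<=` A]] }.

Definition mplus_eval (R : realType) (T : pmetricType R)
    (lambda : Mplus T) : {ptws {f : T -> R | continuous f} -> R} :=
  fun f => \int[lambda]_t (sval f t).

HB.instance Definition _ (R : realType) (T : pmetricType R) :=
  gen_eqMixin (Mplus T).
HB.instance Definition _ (R : realType) (T : pmetricType R) :=
  gen_choiceMixin (Mplus T).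
HB.instance Definition _ (R : realType) (T : pmetricType R) :=
  Topological.copy (Mplus T) (initial_topology (@mplus_eval R T)).

Section mixture.
Context {R : realType} {E : pmetricType R} {phi : weight E}.
Implicit Types (e : R) (mu : Pphi phi).

(* The weight [e] of a mixture is clamped to [0, 1] in order to have a total
   function of a real [e]; mixtures are only used for [0 <= e <= 1]. *)
Definition clamp01 e := Num.min (Num.max e 0) 1.

Lemma clamp01_ge0 e : 0 <= clamp01 e.
Proof. by rewrite /clamp01 le_min le_max lexx orbT ler01. Qed.

Lemma onem_clamp01_ge0 e : 0 <= 1 - clamp01 e.
Proof. by rewrite subr_ge0 /clamp01 ge_min lexx orbT. Qed.

Lemma clamp01E e : 0 <= e <= 1 -> clamp01 e = e.
Proof. by case/andP=> e0 e1; rewrite /clamp01 (max_idPl e0) (min_idPl e1). Qed.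

Definition mix_measure e mu mu' : set (borel E) -> \bar R :=
  measure_add (mscale (NngNum (onem_clamp01_ge0 e)) mu)
              (mscale (NngNum (clamp01_ge0 e)) mu').

HB.instance Definition _ e mu mu' := Measure.on (mix_measure e mu mu').

Lemma mix_measureE e mu mu' A : mix_measure e mu mu' A =
  ((1 - clamp01 e)%:E * mu A + (clamp01 e)%:E * mu' A)%E.
Proof. by rewrite /mix_measure measure_addE. Qed.

Lemma mix_measure_setT e mu mu' : mix_measure e mu mu' setT = 1%E.
Proof. by rewrite mix_measureE !probability_setT !mule1 -EFinD subrK. Qed.

HB.instance Definition _ e mu mu' :=
  Measure_isProbability.Build _ _ _ (mix_measure e mu mu')
    (mix_measure_setT e mu mu').

Lemma continuous_borel_measurable (f : E -> R) :
  continuous f -> measurable_fun [set: borel E] f.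
Proof.
move=> /continuousP cf.
apply: (measurability _ (RGenOpens.measurableE R)).
move=> _ [_ [a [b ->] <-]].
by rewrite setTI; apply: sub_sigma_algebra; exact/cf/interval_open.
Qed.

Lemma mix_moment e mu mu' :
  (\int[mix_measure e mu mu']_x (phi x)%:E < +oo)%E.
Proof.
have phi0 (x : borel E) : [set: borel E] x -> (0 <= (phi x)%:E)%E.
  by move=> _; rewrite lee_fin weight_ge0.
have mphi : measurable_fun [set: borel E] (EFin \o (phi : borel E -> R)).
  apply/measurable_EFinP; apply: continuous_borel_measurable.
  exact: weight_continuous.
rewrite ge0_integral_measure_add// !ge0_integral_mscale//.
by apply: lte_add_pinfty; apply: lte_mul_pinfty;
  rewrite ?lee_fin ?onem_clamp01_ge0 ?clamp01_ge0 ?pphi_moment.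
Qed.

(* (1 - e) mu + e mu' *)
Definition mix e mu mu' : Pphi phi := MkPphi (mix_moment e mu mu').

End mixture.

Section relative_entropy.
Context {R : realType} {E : pmetricType R}.
Implicit Types mu nu : probability (borel E) R.

Definition density mu nu : borel E -> \bar R :=
  'd (charge_of_finite_measure mu) '/d nu.

Definition rel_entropy mu nu : \bar R :=
  if `[< mu `<< nu >] then (\int[mu]_x lne (density mu nu x))%E else +oo%E.

Definition has_bounded_density mu nu :=
  mu `<< nu /\
  exists M : R, {ae nu, forall x, (density mu nu x <= M%:E)%E}.

End relative_entropy.

Section functionals.
Context {R : realType} {E : pmetricType R} {phi : weight E} {T : pmetricType R}.
Implicit Types (mu nu rho : Pphi phi) (G : Pphi phi -> \bar R)
  (C : set (Pphi phi)) (Theta : T -> Pphi phi -> R).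
Local Open Scope ereal_scope.

Definition penalised rho G mu : \bar R := rel_entropy mu rho + G mu.

Definition penalised_dom rho G : set (Pphi phi) :=
  [set mu : Pphi phi | rel_entropy mu rho < +oo /\ G mu < +oo].

Definition admissible Theta : set (Pphi phi) :=
  [set mu : Pphi phi | forall t, (Theta t mu <= 0)%R].

Definition is_minimiser (J : Pphi phi -> \bar R) C mu :=
  C mu /\ forall mu', C mu' -> J mu <= J mu'.

Definition sup_over (X : Type) (g : X -> R) : \bar R :=
  ereal_sup (range (fun x => (g x)%:E)).

Definition convex_subset C :=
  forall mu mu' (e : R), C mu -> C mu' -> (0 <= e <= 1)%R -> C (mix e mu mu').

Definition convex_functional G :=
  forall mu mu' (e : R), (0 <= e <= 1)%R ->
    G (mix e mu mu') <= (1 - e)%:E * G mu + e%:E * G mu'.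

Local Open Scope ring_scope.

(* [dG] is a (normalised) linear functional derivative at [mu] of [G], w.r.t.
   the set of directions [C]. *)
Definition is_derivative_at C (G : Pphi phi -> R) mu (dG : E -> R) :=
  [/\ C mu,
      measurable_fun [set: borel E] dG,
      forall mu', C mu' -> (mu' : probability (borel E) R).-integrable
                            [set: borel E] (EFin \o (dG : borel E -> R)),
      forall mu', C mu' ->
        e^-1 * (G (mix e mu mu') - G mu) @[e --> 0^'+] -->
        \int[mu']_x dG x - \int[mu]_x dG x
    & \int[mu]_x dG x = 0].

(* [fine \o G] is the restriction of [G] to its domain of finiteness. *)
Record regular_at rho G Theta mu (dG : E -> R) (dTheta : T -> E -> R)
    : Prop := {
  regular_convex : convex_subset (penalised_dom rho G) ;
  regular_derivative :
    is_derivative_at (penalised_dom rho G) (fine \o G) mu dG ;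
  regular_constraint_continuous : continuous (fun t => Theta t mu) ;
  regular_constraint_derivative :
    forall t, is_derivative_at setT (Theta t) mu (dTheta t) ;
  regular_constraint_uniform : forall mu',
    sup_over (fun t => `|e^-1 * (Theta t (mix e mu mu') - Theta t mu)
                         - (\int[mu']_x dTheta t x - \int[mu]_x dTheta t x)|)
      @[e --> 0^'+] --> 0%E ;
  regular_derivative_continuous : forall x, continuous (fun t => dTheta t x) ;
  regular_derivative_bound : exists2 D : R, 0 <= D &
    forall x, (sup_over (fun t => `|dTheta t x|%R) <= (D * (1 + phi x))%:E)%E }.

(* [mu] has density [Z^-1 exp(- dG - \int dTheta_t lambda(dt))] w.r.t. [nu]
   and [lambda]-a.e. constraint is saturated at [mu]. *)
Definition gibbs_with_multiplier nu mu (dG : E -> R) (Theta : T -> R)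
    (dTheta : T -> E -> R) (lambda : Mplus T) :=
  (exists2 Z : R, 0 < Z &
    mu `<< nu /\
    {ae (nu : probability (borel E) R), forall x, density mu nu x =
      (Z^-1 * expR (- dG x - \int[lambda]_t dTheta t x))%:E}) /\
  {ae (lambda : {finite_measure set (borel T) -> \bar R}),
     forall t, Theta t = 0}.

End functionals.

(* Main.v *)
(* Linearised at the minimiser mubk k, the problem becomes the minimisation of
   H(.|nuk k) + <., dFk> under the affine constraints
   Psik t (mubk k) + <., dPsik t> <= 0, for which mut k is strictly feasible.
   Its value under a perturbation f in C(T) of the constraints is sublinear in
   f, so that Hahn-Banach and Riesz on the compact T provide the multiplier
   lambdak. With V = dFk + \int dPsik t lambdak(dt), the equality case of the
   variational inequality
     0 <= H(mu|nuk) + <mu, V> + ln Z,   Z = <nuk, exp(- V)>,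
   gives the Gibbs density. Derivatives are normalised, hence <mubk, V> = 0 and
   ln Z = - H(mubk|nuk) <= 0: the same inequality at mut then bounds the mass
   of lambdak by (H(mut|nuk) + <mut, dFk>) / delta, uniformly in k. It follows
   that the densities of the mubk are bounded by exp(c (1 + phi)), so that
   (mubk) is relatively compact; along a convergent subsequence the
   equicontinuous potentials converge and the Gibbs form passes to the limit.
   By convexity the Gibbs form is sufficient for minimality, and the minimiser
   is unique by strict convexity of the entropy, hence the convergence of the
   whole sequence. *)

(* Both compactness statements rest on Daniell's theorem, applied to a limit functional on bounded
   continuous functions. In [Pphi phi] the continuity of that functional along decreasing sequences
   comes from an asymptotic domination of the minimisers by one fixed measure W nu; on the compact T
   it is Dini's theorem. Subsequences are extracted by testing against countably many pieces of
   partitions of unity, small both in distance and in oscillation of phi, so that functions of order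
   1 + phi are reached as well as bounded ones. Potentials are only bounded by c (1 + phi), where c
   depends on the mass of the multiplier; exponential moments of all orders make exp(- V) integrable
   whatever c is. The strict feasibility of mut acts three times: it lets weakly feasible
   competitors be perturbed into strictly feasible ones, it makes the value function of the
   perturbed problem finite, and it bounds the mass of the multiplier. The entropy is handled as the
   integral of s ln s - s + 1 of the density: this integrand is nonnegative, so every integral makes
   sense in [0, +oo] before any finiteness is known. *)
From HB Require Import structures.
Require Import Defs.
From mathcomp Require Import all_boot all_order all_algebra finmap.
From mathcomp Require Import all_classical all_reals all_analysis.
From mathcomp Require Import giry measurable_realfun ring lra.

Set Implicit Arguments.
Unset Strict Implicit.
Unset Printing Implicit Defensive.

Import Order.TTheory GRing.Theory Num.Theory.
Import numFieldNormedType.Exports.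

Local Open Scope classical_set_scope.
Local Open Scope ring_scope.

(** * Integrals of real functions *)

Section real_integral.
Context d (X : measurableType d) (R : realType).
Variable mu : {measure set X -> \bar R}.
Local Notation intg f := (mu.-integrable [set: X] (EFin \o f)).

Lemma integrable_dominated (f g : X -> R) : measurable_fun setT f -> intg g ->
  (forall x, `|f x| <= g x) -> intg f.
Proof.
move=> mf ig fg; apply: (le_integrable measurableT _ _ ig) => //.
  exact/measurable_EFinP.
by move=> x _ /=; rewrite lee_fin (le_trans (fg x))// ler_norm.
Qed.

Lemma EFin_Rintegral (f : X -> R) : intg f ->
  (\int[mu]_x f x)%:E = (\int[mu]_x (f x)%:E)%E.
Proof. by move=> fi; rewrite /Rintegral fineK// integrable_fin_num. Qed.

Lemma Rintegral_cvg (f_ : nat -> X -> R) (f g : X -> R) :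
  (forall n, measurable_fun setT (f_ n)) -> intg g ->
  (forall n x, `|f_ n x| <= g x) -> (forall x, f_ ^~ x @ \oo --> f x) ->
  \int[mu]_x f_ n x @[n --> \oo] --> \int[mu]_x f x.
Proof.
move=> mf ig fg ff.
have mf' : measurable_fun setT f by exact: (measurable_fun_cvg mf).
have mE (h : X -> R) : measurable_fun setT h -> measurable_fun setT (EFin \o h).
  by move=> ?; exact/measurable_EFinP.
have lim x : (EFin \o f_ n) x @[n --> \oo] --> (EFin \o f) x.
  by apply: cvg_EFin; [exact: nearW|exact: ff].
have [i0 _ h] := @dominated_convergence _ X R mu setT measurableT
  (fun n => EFin \o f_ n) (EFin \o f) (EFin \o g)
  (fun n => mE _ (mf n)) (mE _ mf')
  (aeW _ (fun x _ => lim x))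
  ig (aeW _ (fun x n _ => fg n x)).
have -> : \int[mu]_x f x = fine (\int[mu]_x (EFin \o f) x)%E by [].
by apply: fine_cvg; rewrite fineK//; exact: integrable_fin_num.
Qed.

Lemma Rintegral_cvg0 (f_ : nat -> X -> R) (g : X -> R) :
  (forall n, measurable_fun setT (f_ n)) -> intg g ->
  (forall n x, `|f_ n x| <= g x) -> (forall x, f_ ^~ x @ \oo --> 0) ->
  \int[mu]_x f_ n x @[n --> \oo] --> 0.
Proof.
move=> mf ig fg ff; have := @Rintegral_cvg f_ (cst 0) g mf ig fg ff.
by rewrite /Rintegral/= integral0.
Qed.

Lemma Rintegral_norm_le (f g : X -> R) : measurable_fun setT f -> intg g ->
  (forall x, `|f x| <= g x) -> `|\int[mu]_x f x| <= \int[mu]_x g x.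
Proof.
move=> mf ig fg; have fi := integrable_dominated mf ig fg.
apply: le_trans (le_normr_Rintegral measurableT fi) _.
by apply: le_Rintegral => //; exact: integrable_norm.
Qed.
End real_integral.

Lemma Rintegral_probability_cst d (X : measurableType d) (R : realType)
  (P : probability X R) (r : R) : \int[P]_x r = r.
Proof.
rewrite Rintegral_cst// [X in fine X](_ : _ = 1%E) ?mulr1//.
exact: probability_setT.
Qed.

Lemma cvg_sum_ord (R : realType) N (u : nat -> nat -> R) (l : nat -> R) :
  (forall i, u i k @[k --> \oo] --> l i) ->
  \sum_(i < N) u i k @[k --> \oo] --> \sum_(i < N) l i.
Proof.
move=> ul; elim: N => [|N ih].
  rewrite big_ord0 (_ : (fun k => _) = (fun=> 0)); first exact: cvg_cst.
  by apply/funext => k; rewrite big_ord0.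
rewrite big_ord_recr/= (_ : (fun k => _) =
  (fun k => \sum_(i < N) u i k + u N k)); first exact: cvgD.
by apply/funext => k; rewrite big_ord_recr.
Qed.

Lemma integrable_sum_ord d (X : measurableType d) (R : realType)
    (mu : {measure set X -> \bar R}) n (f : nat -> X -> R) :
  (forall i, mu.-integrable [set: X] (EFin \o f i)) ->
  mu.-integrable [set: X] (EFin \o (fun x => \sum_(i < n) f i x)).
Proof.
move=> fi; have := integrable_sum measurableT (index_enum 'I_n) (P := xpredT)
  (h := fun (i : 'I_n) x => (f i x)%:E) (fun i _ => fi i).
by apply: eq_integrable => // x _; rewrite /= -sumEFin.
Qed.

Lemma Rintegral_sum_ord d (X : measurableType d) (R : realType)
    (mu : {measure set X -> \bar R}) n (f : nat -> X -> R) :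
  (forall i, mu.-integrable [set: X] (EFin \o f i)) ->
  \int[mu]_x (\sum_(i < n) f i x) = \sum_(i < n) \int[mu]_x f i x.
Proof.
move=> fi; elim: n => [|n ih].
  under eq_Rintegral do rewrite big_ord0.
  by rewrite big_ord0 /Rintegral integral0.
under eq_Rintegral do rewrite big_ord_recr/=.
by rewrite RintegralD// ?ih ?big_ord_recr//; exact: integrable_sum_ord.
Qed.

(** * Bounded continuous functions and distance to the complement of an open set *)

Section bounded_continuous.
Context {R : realType} {X : pmetricType R}.
Implicit Types f g : X -> R.

Definition Cb f := continuous f /\ exists M : R, forall x, `|f x| <= M.

Lemma Cb_cst (a : R) : Cb (fun=> a).
Proof.
split; first by move=> x; exact: cvg_cst.
by exists `|a|.
Qed.

Lemma CbD f g : Cb f -> Cb g -> Cb (fun x => f x + g x).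
Proof.
move=> [cf [M fM]] [cg [N gN]]; split; first by move=> x; apply: cvgD; [exact: cf|exact: cg].
by exists (M + N) => x; rewrite (le_trans (ler_normD _ _))// lerD.
Qed.

Lemma CbM f g : Cb f -> Cb g -> Cb (fun x => f x * g x).
Proof.
move=> [cf [M fM]] [cg [N gN]]; split; first by move=> x; apply: cvgM; [exact: cf|exact: cg].
by exists (M * N) => x; rewrite normrM ler_pM.
Qed.

Lemma CbZ (a : R) f : Cb f -> Cb (fun x => a * f x).
Proof. exact/CbM/Cb_cst. Qed.

Lemma CbB f g : Cb f -> Cb g -> Cb (fun x => f x - g x).
Proof.
move=> hf hg; have := CbD hf (CbZ (-1) hg).
by under eq_fun do rewrite mulN1r.
Qed.

Lemma Cb_norm f : Cb f -> Cb (fun x => `|f x|).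
Proof.
move=> [cf [M fM]]; split; first by move=> x; apply: cvg_norm; exact: cf.
by exists M => x; rewrite normr_id.
Qed.

Lemma Cb_max f g : Cb f -> Cb g -> Cb (fun x => Num.max (f x) (g x)).
Proof.
move=> hf hg.
have := CbZ 2^-1 (CbD (CbD hf hg) (Cb_norm (CbB hf hg))).
by congr Cb; apply/funext => x; rewrite maxr_absE mulrC.
Qed.

Lemma Cb_min f g : Cb f -> Cb g -> Cb (fun x => Num.min (f x) (g x)).
Proof.
move=> hf hg.
have := CbZ 2^-1 (CbB (CbD hf hg) (Cb_norm (CbB hf hg))).
by congr Cb; apply/funext => x; rewrite minr_absE mulrC.
Qed.

Lemma Cb_sum n (f : nat -> X -> R) :
  (forall i, Cb (f i)) -> Cb (fun x => \sum_(i < n) f i x).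
Proof.
move=> hf; elim: n => [|n ih].
  by under eq_fun do rewrite big_ord0; exact: Cb_cst.
by under eq_fun do rewrite big_ord_recr/=; exact: CbD.
Qed.

Lemma lipschitz1_continuous f :
  (forall x y : X, f x <= f y + mdist x y) -> continuous f.
Proof.
move=> h x; apply/cvgrPdist_lt => e e0.
near=> y; have : ball x e y by near: y; exact: nbhsx_ballx.
rewrite ballEmdist/= => xy.
by have := h x y; have := h y x; rewrite (metric_sym y x); move: xy => /=;
  rewrite ltr_norml; lra.
Unshelve. all: by end_near. Qed.

Lemma mdist_continuous (y : X) : continuous (fun x : X => mdist x y).
Proof.
apply: lipschitz1_continuous => x z.
by rewrite addrC; exact: metric_triangle.
Qed.

(** Distance to the complement of U, truncated at 1. The added element 1 also keeps the infimum over
    a nonempty set when U is the whole space. *)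
Definition depth (U : set X) x : R :=
  inf ([set 1] `|` [set mdist x y | y in ~` U]).

Let depth_set (U : set X) (x : X) : has_inf ([set 1] `|` [set mdist x y | y in ~` U]).
Proof.
split; first by exists 1; left.
by exists 0 => _ [->|[y _ <-]] //; exact: mdist_ge0.
Qed.

Lemma depth_ge0 U x : 0 <= depth U x.
Proof.
apply: lb_le_inf; first by exists 1; left.
by move=> _ [->|[y _ <-]] //; exact: mdist_ge0.
Qed.

Lemma depth_le1 U x : depth U x <= 1.
Proof. by apply: ge_inf; [exact: (depth_set U x).2|left]. Qed.

Lemma depth_continuous U : continuous (depth U).
Proof.
apply: lipschitz1_continuous => x y; rewrite -lerBlDr.
apply: lb_le_inf; first by exists 1; left.
move=> _ [->|[z Uz <-]].
  by rewrite lerBlDr (le_trans (depth_le1 _ _))// lerDl mdist_ge0.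
rewrite lerBlDr addrC; apply: le_trans (metric_triangle x y z).
by apply: ge_inf; [exact: (depth_set U x).2|right; exists z].
Qed.

Lemma Cb_depth U : Cb (depth U).
Proof.
split; first exact: depth_continuous.
by exists 1 => x; rewrite ger0_norm ?depth_ge0 ?depth_le1.
Qed.

Lemma depth_gt0 U x : open U -> U x -> 0 < depth U x.
Proof.
move=> oU Ux; have /nbhs_ballP[e /= e0 eU] : nbhs x U by exact: open_nbhs_nbhs.
apply: (@lt_le_trans _ _ (Num.min e 1)); first by rewrite lt_min e0 ltr01.
apply: lb_le_inf; first by exists 1; left.
move=> _ [->|[y Uy <-]]; first by rewrite ge_min lexx orbT.
rewrite ge_min leNgt; apply/orP; left; apply/negP => xy; apply: Uy.
by apply: eU; rewrite ballEmdist.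
Qed.

Lemma depth_eq0 (U : set X) x : ~ U x -> depth U x = 0.
Proof.
move=> Ux; apply/eqP; rewrite eq_le depth_ge0 andbT.
rewrite -(mdistxx x); apply: ge_inf; first exact: (depth_set U x).2.
by right; exists x.
Qed.

End bounded_continuous.

Section borel_integral.
Context {R : realType} {X : pmetricType R}.
Variable mu : {finite_measure set (borel X) -> \bar R}.
Implicit Types f g : X -> R.

Lemma Cb_measurable f : Cb f -> measurable_fun [set: borel X] f.
Proof. by move=> [cf _]; exact: continuous_borel_measurable. Qed.

Lemma Cb_integrable f : Cb f -> mu.-integrable [set: borel X] (EFin \o f).
Proof.
move=> hf; have [_ [M fM]] := hf.
apply: (@integrable_dominated _ (borel X) R mu f (cst M)) => //.
  exact: Cb_measurable.
exact: finite_measure_integrable_cst.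
Qed.

Lemma Rintegral_Cb_sum n (f : nat -> X -> R) : (forall i, Cb (f i)) ->
  \int[mu]_x (\sum_(i < n) f i x) = \sum_(i < n) \int[mu]_x f i x.
Proof. by move=> hf; apply: Rintegral_sum_ord => i; exact: Cb_integrable. Qed.

End borel_integral.

(** * Daniell's representation theorem *)

Section daniell.
Context {R : realType} {X : pmetricType R}.
Variable L : (X -> R) -> R.
Hypothesis L_linear : forall (a : R) f g, Cb f -> Cb g ->
  L (fun x => a * f x + g x) = a * L f + L g.
Hypothesis L_ge0 : forall f, Cb f -> (forall x, 0 <= f x) -> 0 <= L f.
Hypothesis L_continuous : forall f : nat -> X -> R, (forall n, Cb (f n)) ->
  (forall n x, 0 <= f n.+1 x <= f n x) -> (forall x, f ^~ x @ \oo --> 0) ->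
  L (f n) @[n --> \oo] --> 0.

Let L_D f g : Cb f -> Cb g -> L (fun x => f x + g x) = L f + L g.
Proof.
move=> hf hg; rewrite -[in RHS](mul1r (L f)) -L_linear//.
by congr L; apply/funext => x; rewrite mul1r.
Qed.

Let L_0 : L (fun=> 0) = 0.
Proof.
have := L_D (Cb_cst 0) (Cb_cst 0); under eq_fun do rewrite addr0.
by move/eqP; rewrite -subr_eq0 opprD addrA subrr sub0r oppr_eq0 => /eqP.
Qed.

Let L_Z (a : R) f : Cb f -> L (fun x => a * f x) = a * L f.
Proof.
move=> hf; have := L_linear a hf (Cb_cst 0); rewrite L_0 addr0 => <-.
by congr L; apply/funext => x; rewrite addr0.
Qed.

Let L_B f g : Cb f -> Cb g -> L (fun x => f x - g x) = L f - L g.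
Proof.
move=> hf hg; rewrite -mulN1r -L_Z// -L_D//; last exact: CbZ.
by congr L; apply/funext => x; rewrite mulN1r.
Qed.

Let L_sum n (f : nat -> X -> R) : (forall i, Cb (f i)) ->
  L (fun x => \sum_(i < n) f i x) = \sum_(i < n) L (f i).
Proof.
move=> hf; elim: n => [|n ih].
  by under eq_fun do rewrite big_ord0; rewrite big_ord0 L_0.
under eq_fun do rewrite big_ord_recr/=.
by rewrite L_D ?ih ?big_ord_recr//; exact: Cb_sum.
Qed.

Let le_L f g : Cb f -> Cb g -> (forall x, f x <= g x) -> L f <= L g.
Proof.
move=> hf hg fg; rewrite -subr_ge0 -L_B//; apply: L_ge0; first exact: CbB.
by move=> x; rewrite subr_ge0.
Qed.

(** A sequence stands for its increasing limit, which may be unbounded or discontinuous and thus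
    outside the domain of L. The strict inequality [1 < h n x] makes the covered region open; the
    outer regularity of the measure comes from there. *)
Definition daniell_cover (A : set X) (c : R) := exists h : nat -> X -> R,
  [/\ forall n, Cb (h n), forall x, {homo h ^~ x : m n / (m <= n)%N >-> m <= n},
      forall n x, 0 <= h n x, forall x, A x -> exists n, 1 < h n x
    & forall n, L (h n) <= c].

Definition daniell_outer (A : set X) : R := inf (daniell_cover A).
Local Notation om := daniell_outer.

(** The constant 2 covers every set, so the infimum defining [daniell_outer] is a genuine real
    infimum. *)
Let cover_cst A : daniell_cover A (L (fun=> 2)).
Proof.
exists (fun _ _ => 2); split => //.
- by move=> n; exact: Cb_cst.
- by move=> x m n _.
- by move=> x Ax; exists 0%N; rewrite ltr1n.
Qed.

Let cover_ge0 A c : daniell_cover A c -> 0 <= c.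
Proof. by move=> [h [hC _ h0 _ hc]]; exact: le_trans (L_ge0 (hC 0%N) (h0 0%N)) (hc _). Qed.

Let has_lb A : has_lbound (daniell_cover A).
Proof. by exists 0 => c /cover_ge0. Qed.

Let om_ge0 A : 0 <= om A.
Proof. by apply: lb_le_inf; [exists (L (fun=> 2)); exact: cover_cst|move=> c /cover_ge0]. Qed.

Let om_le A c : daniell_cover A c -> om A <= c.
Proof. by move=> Ac; exact: ge_inf. Qed.

Let om_cover A c : om A < c -> daniell_cover A c.
Proof.
move=> Ac; have [||c' [h [h1 h2 h3 h4 h5]]] := @inf_adherent _ (daniell_cover A) (c - om A).
- by rewrite subr_gt0.
- by split; [exists (L (fun=> 2)); exact: cover_cst|exact: has_lb].
rewrite addrC subrK => /ltW c'c; exists h; split => // n.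
exact: le_trans (h5 n) c'c.
Qed.

Let om_mono : {homo om : A B / A `<=` B >-> A <= B}.
Proof.
move=> A B AB; apply/ler_addgt0Pr => e e0; apply: om_le.
have [|h [h1 h2 h3 h4 h5]] := @om_cover B (om B + e); first by rewrite ltrDl.
by exists h; split => // x /AB; exact: h4.
Qed.

Let om_0 : om set0 = 0.
Proof.
apply/eqP; rewrite eq_le om_ge0 andbT; apply: om_le.
exists (fun _ _ => 0); split => //.
- by move=> n; exact: Cb_cst.
- by move=> x m n _.
- by move=> n; rewrite L_0.
Qed.

Let geo_le (e : R) n : 0 < e -> \sum_(m < n) e / 2 ^+ m.+1 <= e.
Proof.
move=> e0; suff -> : \sum_(m < n) e / 2 ^+ m.+1 = e - e / 2 ^+ n.
  by rewrite lerBlDr lerDl divr_ge0 ?exprn_ge0// ltW.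
elim: n => [|n ih]; first by rewrite big_ord0 expr0 divr1 subrr.
rewrite big_ord_recr/= ih exprS invfM.
by field; rewrite expf_neq0.
Qed.

(** The union is covered diagonally: stage n adds the n-th terms of the first n covers. This is a
    finite sum, hence in [Cb], and it increases with n because both the number of terms and each
    term do. *)
Let om_sigma_subadditive : sigma_subadditive (EFin \o om).
Proof.
move=> A; have [/eqP ->|] := boolP ((\sum_(i <oo) (EFin \o om) (A i))%E == +oo%E).
  by rewrite leey.
rewrite -ltey => soo.
have s0 : (0 <= \sum_(i <oo) (EFin \o om) (A i))%E.
  by apply: nneseries_ge0 => n _ _; rewrite lee_fin om_ge0.
have sfin : (\sum_(i <oo) (EFin \o om) (A i))%E \is a fin_num.
  by rewrite ge0_fin_numE.
rewrite -(fineK sfin); set s := fine _; rewrite lee_fin.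
apply/ler_addgt0Pr => e e0; apply: om_le.
have /choice[h hP] (m : nat) : exists h : nat -> X -> R,
  [/\ forall n, Cb (h n), forall x, {homo h ^~ x : m n / (m <= n)%N >-> m <= n},
      forall n x, 0 <= h n x, forall x, A m x -> exists n, 1 < h n x
    & forall n, L (h n) <= om (A m) + e / 2 ^+ m.+1].
  by apply: om_cover; rewrite ltrDl divr_gt0// exprn_gt0.
have hsum m n (nm : (n <= m)%N) x :
    \sum_(i < n) h i n x <= \sum_(i < m) h i m x.
  rewrite -!(big_mkord xpredT (fun i => h i _ x)).
  rewrite (@big_cat_nat _ _ _ n 0 m)//= -[leLHS]addr0; apply: lerD.
    by apply: ler_sum_nat => i _; case: (hP i) => _ + _ _ _; exact.
  by apply: sumr_ge0 => i _; case: (hP i).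
exists (fun n x => \sum_(i < n) h i n x); split.
- move=> n; apply: (@Cb_sum _ _ n (fun i => h i n)) => i.
  by case: (hP i).
- by move=> x n m nm; exact: hsum.
- by move=> n x; apply: sumr_ge0 => i _; case: (hP i).
- move=> x [m _ Amx]; have [h1 h2 h3 h4 h5] := hP m.
  have [k hk] := h4 x Amx.
  exists (maxn m.+1 k); apply: (lt_le_trans hk).
  have mM : (m < maxn m.+1 k)%N by rewrite leq_max leqnn.
  rewrite (bigD1 (Ordinal mM))//= -[leLHS]addr0; apply: lerD.
    by apply: h2; rewrite leq_max leqnn orbT.
  by apply: sumr_ge0 => i _; case: (hP i).
- move=> n; rewrite (@L_sum n (fun i => h i n)); last by move=> i; case: (hP i).
  apply: (@le_trans _ _ (\sum_(i < n) (om (A i) + e / 2 ^+ i.+1))).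
    by apply: ler_sum => i _; case: (hP i).
  rewrite big_split/= lerD ?geo_le//.
  rewrite -lee_fin (fineK sfin) -sumEFin.
  rewrite -(big_mkord xpredT (fun i => (om (A i))%:E)).
  by apply: nneseries_lim_ge => i _; rewrite lee_fin om_ge0.
Qed.

Lemma daniell_outer_le A f : Cb f -> (forall x, 0 <= f x) ->
  (forall x, A x -> 1 <= f x) -> om A <= L f.
Proof.
move=> hf f0 fA; apply/ler_addgt0Pr => e e0.
(* The factor 1 + d provides the strict inequality required of covers; its extra cost d * L f is at
   most e. *)
pose d := e / (1 + L f); have Lf := L_ge0 hf f0.
have d0 : 0 < d by rewrite divr_gt0//; apply: ltr_wpDr.
apply: (@le_trans _ _ (L (fun x => (1 + d) * f x))).
  apply: om_le; exists (fun _ x => (1 + d) * f x); split => //.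
  - by move=> _; exact: CbZ.
  - by move=> x m n _.
  - by move=> _ x; rewrite mulr_ge0// addr_ge0// ltW.
  - move=> x /fA fx; exists 0%N; apply: (@lt_le_trans _ _ (1 + d)).
      by rewrite ltrDl.
    by rewrite ler_peMr// addr_ge0// ltW.
rewrite L_Z// mulrDl mul1r lerD2l /d mulrAC ler_pdivrMr ?ltr_wpDr//.
by rewrite ler_pM2l// lerDr.
Qed.

(** Daniell continuity enters here: for a cover h of A, the excess max(f - h n, 0) decreases to 0
    pointwise, so L f exceeds L (h n) by a vanishing amount. *)
Lemma le_daniell_outer A f : Cb f -> (forall x, 0 <= f x <= 1) ->
  (forall x, ~ A x -> f x = 0) -> L f <= om A.
Proof.
move=> hf f01 fA; apply/ler_addgt0Pr => e e0.
have [|h [h1 h2 h3 h4 h5]] := @om_cover A (om A + e); first by rewrite ltrDl.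
set c := om A + e in h5 *.
pose g n x := Num.max (f x - h n x) 0.
have gC n : Cb (g n) by apply: Cb_max; [exact: CbB|exact: Cb_cst].
have g0 : L (g n) @[n --> \oo] --> 0.
  apply: L_continuous => //.
    move=> n x; rewrite /g le_max lexx orbT/=.
    by rewrite ge_max !le_max lexx !orbT andbT lerD2l lerN2 h2.
  move=> x; apply: cvg_near_cst.
  have [Ax|Ax] := pselect (A x).
    have [m hm] := h4 _ Ax; exists m => // n /= mn.
    rewrite /g; apply/max_idPr; rewrite subr_le0.
    have /andP[_ f1] := f01 x.
    by rewrite (le_trans f1)// (le_trans (ltW hm))// h2.
  apply: nearW => n.
  by rewrite /g fA// sub0r; apply/max_idPr; rewrite oppr_le0.
apply/ler_addgt0Pr => d d0.
have /cvgrPdist_lt/(_ _ d0)[N _ /(_ N (leqnn N))] := g0.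
rewrite sub0r normrN => /(le_lt_trans (ler_norm _))/ltW gN.
apply: (@le_trans _ _ (L (fun x => h N x + g N x))).
  apply: le_L => //; first exact: CbD.
  by move=> x; rewrite /g -lerBlDl le_max lexx.
by rewrite L_D//; exact: lerD.
Qed.


Let daniell_ext (A : set X) : \bar R := (om A)%:E.

Let daniell_ext0 : daniell_ext set0 = 0%E.
Proof. by rewrite /daniell_ext om_0. Qed.

Let daniell_ext_ge0 A : (0 <= daniell_ext A)%E.
Proof. by rewrite lee_fin om_ge0. Qed.

Let le_daniell_ext : {homo daniell_ext : A B / A `<=` B >-> (A <= B)%E}.
Proof. by move=> A B AB; rewrite lee_fin om_mono. Qed.

HB.instance Definition _ := isOuterMeasure.Build R X daniell_ext
  daniell_ext0 daniell_ext_ge0 le_daniell_ext om_sigma_subadditive.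

Let daniell_outer_measure : {outer_measure set X -> \bar R} := daniell_ext.

(* For U = {f > 0}, the functions u_j = min(1, j f) increase to the indicator
   of U; a cover h of A is split into h u_j, which covers A in U, and
   h (1 - u_J), which covers the rest of A, J being large. *)
Let open_caratheodory (U : set X) : open U ->
  daniell_outer_measure.-caratheodory U.
Proof.
move=> oU; apply: le_caratheodory_measurable => A.
rewrite /= /daniell_ext -EFinD lee_fin; apply/ler_addgt0Pr => e e0.
have e2 : 0 < e / 2 by rewrite divr_gt0.
have [|h [h1 h2 h3 h4 h5]] := @om_cover A (om A + e / 2); first by rewrite ltrDl.
set c := om A + e / 2 in h5 *.
pose u (j : nat) x := Num.min (j%:R * depth U x) 1.
have uC j : Cb (u j) by apply: Cb_min; [apply: CbZ; exact: Cb_depth|exact: Cb_cst].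
have u0 j x : 0 <= u j x by rewrite /u le_min ler01 andbT mulr_ge0 ?depth_ge0.
have u1 j x : u j x <= 1 by rewrite /u ge_min lexx orbT.
have umono x : {homo u ^~ x : m n / (m <= n)%N >-> m <= n}.
  move=> m n mn; rewrite /u le_min !ge_min lexx orbT andbT.
  by rewrite ler_wpM2r ?depth_ge0// ler_nat.
pose k n x := h n x * u n x.
have kC n : Cb (k n) by exact: CbM.
have kmono x : {homo k ^~ x : m n / (m <= n)%N >-> m <= n}.
  by move=> m n mn; apply: ler_pM; rewrite ?h3 ?u0 ?h2 ?umono.
have k0 n x : 0 <= k n x by rewrite mulr_ge0.
have kh n x : k n x <= h n x by rewrite ler_piMr.
have kS : has_sup (range (fun n => L (k n))).
  split; first by exists (L (k 0%N)); exists 0%N.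
  exists c => _ [n _ <-]; apply: le_trans (h5 n).
  by apply: le_L.
set a := sup (range (fun n => L (k n))).
have omU : om (A `&` U) <= a.
  apply: om_le; exists k; split => //.
  - move=> x [Ax Ux]; have [n hn] := h4 x Ax.
    have d0 := depth_gt0 oU Ux.
    exists (maxn n (Num.truncn (depth U x)^-1).+1).
    set m := maxn _ _.
    have -> : k m x = h m x.
      rewrite /k /u; suff -> : Num.min (m%:R * depth U x) 1 = 1 by rewrite mulr1.
      apply/min_idPr; rewrite -ler_pdivrMr// div1r.
      apply: (@le_trans _ _ (Num.truncn (depth U x)^-1).+1%:R).
        by rewrite ltW// truncnS_gt.
      by rewrite ler_nat leq_max leqnn orbT.
    by rewrite (lt_le_trans hn)// h2// leq_max leqnn.
  - by move=> n; apply: ub_le_sup; [exact: kS.2|exists n].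
have [_ [J _ <-] aJ] := sup_adherent e2 kS.
have omC : om (A `&` ~` U) <= c - a + e / 2.
  pose g n x := h n x * (1 - u J x).
  have gC n : Cb (g n) by apply: CbM => //; apply: CbB => //; exact: Cb_cst.
  have gmono x : {homo g ^~ x : m n / (m <= n)%N >-> m <= n}.
    by move=> m n mn; rewrite ler_wpM2r ?subr_ge0// h2.
  apply: om_le; exists g; split => //.
  - by move=> n x; rewrite mulr_ge0// subr_ge0.
  - move=> x [Ax Ux]; have [n hn] := h4 x Ax; exists n.
    by rewrite /g /u depth_eq0// mulr0 min_l// subr0 mulr1.
  (* At an index m beyond J, the product h m * u J dominates k J, whose value under L is within e /
     2 of the supremum a. *)
  - move=> n; apply: (@le_trans _ _ (L (g (maxn n J)))).
      by apply: le_L => // x; rewrite gmono// leq_max leqnn.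
    set m := maxn n J; have Jm : (J <= m)%N by rewrite leq_max leqnn orbT.
    apply: (@le_trans _ _ (L (fun x => h m x - k J x))).
      apply: le_L => //; first exact: CbB.
      move=> x; rewrite /g /k mulrBr mulr1 lerD2l lerN2.
      by rewrite ler_wpM2r// h2.
    rewrite L_B//; have := h5 m; move: aJ; rewrite -/a; lra.
by have := lerD omU omC; rewrite /c; lra.
Qed.

Let daniell_measure (A : set (borel X)) : \bar R := daniell_ext A.

Let borel_caratheodory (A : set (borel X)) : measurable A ->
  daniell_outer_measure.-cara.-measurable (A : set X).
Proof.
move=> mA; have : <<s @open X >> A by [].
apply; split => /=; last exact: open_caratheodory.
split; first exact: measurable0.
  by move=> B mB; rewrite setTD; exact: measurableC.
by move=> F mF; exact: bigcupT_measurable.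
Qed.

Let daniell_measure0 : daniell_measure set0 = 0%E.
Proof. exact: daniell_ext0. Qed.

Let daniell_measure_ge0 A : (0 <= daniell_measure A)%E.
Proof. exact: daniell_ext_ge0. Qed.

Let daniell_measure_sigma_additive : semi_sigma_additive daniell_measure.
Proof.
move=> A mA tA _.
apply: (@caratheodory_measure_sigma_additive R X daniell_outer_measure) => //.
  by move=> i; exact: borel_caratheodory.
by apply: bigcupT_measurable => i; exact: borel_caratheodory.
Qed.

HB.instance Definition _ := isMeasure.Build _ _ _ daniell_measure
  daniell_measure0 daniell_measure_ge0 daniell_measure_sigma_additive.

Let daniell_fin : fin_num_fun daniell_measure.
Proof. by []. Qed.

HB.instance Definition _ := Measure_isFinite.Build _ _ _ daniell_measure
  daniell_fin.


Let mu : {finite_measure set (borel X) -> \bar R} := daniell_measure.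

Let mass : fine (mu setT) = L (fun=> 1).
Proof.
rewrite /= /daniell_measure /daniell_ext /=; apply/eqP; rewrite eq_le; apply/andP; split.
  by apply: daniell_outer_le => //; exact: Cb_cst.
by apply: le_daniell_outer => //; [exact: Cb_cst|move=> x; rewrite lexx ler01|move=> x []].
Qed.

(** N f is cut into N slices [fi i] of height 1. A slice vanishes off A i = {N f > i} and equals 1
    on A (i + 1), so its integral is at most om (A i) while its value under L is at least om (A (i +
    1)). Shifting the index by one costs at most the total mass, which is negligible after division
    by N. *)
Let integral_le01 f : Cb f -> (forall x, 0 <= f x <= 1) ->
  \int[mu]_x f x <= L f.
Proof.
move=> hf f01; apply/ler_addgt0Pr => e e0.
pose N := (Num.truncn (fine (mu setT) / e)).+1.
have N0 : 0 < N%:R :> R by rewrite ltr0n.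
pose g (i : nat) x := Num.min (N%:R * f x) i%:R.
pose fi (i : nat) x := g i.+1 x - g i x.
have gC i : Cb (g i) by apply: Cb_min; [exact: CbZ|exact: Cb_cst].
have fiC i : Cb (fi i) by exact: CbB.
have sumE x : \sum_(i < N) fi i x = N%:R * f x.
  rewrite -(big_mkord xpredT (fun i => fi i x)) telescope_sumr//.
  have /andP[f0 f1] := f01 x.
  rewrite /g (min_idPr (_ : 0 <= _)) ?subr0 ?mulr_ge0//.
  by apply/min_idPl; rewrite ler_piMr.
have fi0 i x : 0 <= fi i x.
  by rewrite subr_ge0 /g le_min !ge_min lexx/= orbC ler_nat leqnSn.
have fi1 i x : fi i x <= 1.
  rewrite lerBlDr /g ge_min; have [h|h] := leP (N%:R * f x) i%:R.
    by rewrite lerDr ler01.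
  by rewrite nat1r lexx orbT.
have fiN i x : N%:R * f x <= i%:R -> fi i x = 0.
  move=> h; rewrite /fi /g (min_idPl h) (min_idPl _) ?subrr//.
  by rewrite (le_trans h)// ler_nat.
have fiS i x : i.+1%:R <= N%:R * f x -> fi i x = 1.
  move=> h; rewrite /fi /g (min_idPr h) (min_idPr _).
    by rewrite -natrB ?subSnn// leqnSn.
  by rewrite (le_trans _ h)// ler_nat.
pose A (i : nat) : set (borel X) := [set x | i%:R < N%:R * f x].
have mA i : measurable (A i).
  have mf := Cb_measurable (CbZ N%:R hf).
  have := mf measurableT `]i%:R, +oo[%classic (measurable_itv _).
  rewrite setTI; congr (measurable _).
  by apply/seteqP; split => x /=; rewrite in_itv/= andbT.
have fiA i : \int[mu]_x fi i x <= om (A i).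
  have -> : om (A i) = \int[mu]_x (\1_(A i) x).
    by rewrite /Rintegral integral_indic// setIT.
  apply: le_Rintegral => //; first exact: Cb_integrable.
    exact: integrable_indic.
  move=> x _; rewrite indicE; have [xA|xA] := boolP (x \in A i).
    exact: fi1.
  rewrite fiN// leNgt; apply/negP => h.
  by move/negP: xA; apply; rewrite inE.
have AL i : om (A i.+1) <= L (fi i).
  apply: daniell_outer_le => // x Ax; rewrite fiS//; exact: ltW.
have : N%:R * \int[mu]_x f x <= fine (mu setT) + N%:R * L f.
  rewrite -RintegralZl//; last exact: Cb_integrable.
  rewrite -L_Z//.
  have -> : (fun x => N%:R * f x) = (fun x => \sum_(i < N) fi i x).
    by apply/funext => x; rewrite sumE.
  rewrite Rintegral_Cb_sum// L_sum//.
  apply: (@le_trans _ _ (\sum_(i < N) om (A i))); first exact: ler_sum.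
  rewrite big_ord_recl; apply: lerD; first exact: om_mono.
  rewrite [leRHS]big_ord_recr/= -[leLHS]addr0; apply: lerD; last exact: L_ge0.
  by apply: ler_sum.
have meN : fine (mu setT) <= e * N%:R.
  by rewrite mulrC -ler_pdivrMr// ltW// truncnS_gt.
move: meN; set I := \int[mu]_x f x; move=> meN h.
rewrite -(ler_pM2l N0) mulrDr; lra.
Qed.

Theorem daniell_representation :
  exists mu : {finite_measure set (borel X) -> \bar R},
    (forall f, Cb f -> \int[mu]_x f x = L f) /\
    (forall (A : set (borel X)) (e : R), 0 < e ->
      exists2 U : set X, open U /\ A `<=` U & (mu U <= mu A + e%:E)%E).
Proof.
exists mu; split; last first.
  move=> A e e0; have [|h [h1 h2 h3 h4 h5]] := @om_cover A (om A + e).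
    by rewrite ltrDl.
  exists (\bigcup_n [set x | 1 < h n x]).
    split; last by move=> x /h4[n hn]; exists n.
    apply: bigcup_open => n _.
    have [/continuousP cf _] := h1 n.
    exact: (cf [set y | 1 < y] (@open_gt _ 1)).
  rewrite /= /daniell_measure /daniell_ext/= -EFinD lee_fin.
  by apply: om_le; exists h; split => // x [n _ hn]; exists n.
(* The reverse inequality is [integral_le01] at 1 - f, the total mass being L (fun=> 1). *)
have eq01 f : Cb f -> (forall x, 0 <= f x <= 1) -> \int[mu]_x f x = L f.
  move=> hf f01; apply/eqP; rewrite eq_le integral_le01//=.
  have := @integral_le01 (fun x => 1 - f x) (CbB (Cb_cst 1) hf).
  rewrite RintegralB//; [|exact/Cb_integrable/Cb_cst|exact: Cb_integrable].
  rewrite Rintegral_cst// mul1r mass L_B//; last exact: Cb_cst.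
  rewrite lerD2l lerN2; apply => x; have /andP[? ?] := f01 x.
  by apply/andP; split; lra.
move=> f hf; have [cf [M fM]] := hf.
have M0 : 0 <= M by exact: le_trans (fM point).
(* The affine map y |-> (y + M + 1) / K sends [- M, M] into [0, 1]. *)
pose K := 2 * (M + 1); have K0 : 0 < K by rewrite /K; lra.
pose g x := K^-1 * (f x + (M + 1)).
have gC : Cb g by apply: CbZ; apply: CbD => //; exact: Cb_cst.
have fE : f = (fun x => K * g x + (- (M + 1))).
  by apply/funext => x; rewrite /g mulrA divff ?gt_eqF// mul1r; lra.
have gE : \int[mu]_x g x = L g.
  apply: eq01 => // x; have := fM x; rewrite ler_norml => /andP[h1 h2].
  rewrite /g mulrC; apply/andP; split; last by rewrite ler_pdivrMr// /K; lra.
  by apply: divr_ge0; [lra|exact: ltW].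
rewrite [in LHS]fE [in RHS]fE RintegralD//; last 2 first.
  by apply: Cb_integrable; exact: CbZ.
  by apply: Cb_integrable; exact: Cb_cst.
rewrite RintegralZl//; last exact: Cb_integrable.
rewrite gE Rintegral_cst// mass L_linear//; last exact: Cb_cst.
congr (_ + _); rewrite -L_Z; last exact: Cb_cst.
by congr L; apply/funext => x; rewrite mulr1.
Qed.

End daniell.

(** * Measures are determined by integrals of continuous functions *)

Section measure_determination.
Context {R : realType} {X : pmetricType R}.

(** Open sets form a pi-system generating the Borel sets, and the indicator of an open set U is the
    limit of the functions min(n depth U, 1). *)
Lemma eq_measure_Cb (mu mu' : {finite_measure set (borel X) -> \bar R}) :
  (forall f : X -> R, Cb f -> (forall x, 0 <= f x) ->
    \int[mu]_x f x = \int[mu']_x f x) ->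
  forall A : set (borel X), measurable A -> mu A = mu' A.
Proof.
move=> mumu'.
apply: (@measure_unique _ R (borel X) (@open X) (fun=> setT)) => //.
- by move=> A B oA oB; exact: openI.
- by move=> _; exact: openT.
- by rewrite bigcup_const.
- move=> U oU.
  have mU : measurable (U : set (borel X)) by exact: sub_sigma_algebra.
  pose u (n : nat) x := Num.min (n%:R * depth U x) 1.
  have uC n : Cb (u n) by apply: Cb_min; [exact/CbZ/Cb_depth|exact: Cb_cst].
  have u0 n x : 0 <= u n x by rewrite /u le_min ler01 andbT mulr_ge0 ?depth_ge0.
  have uU x : u ^~ x @ \oo --> (\1_U x : R).
    apply: cvg_near_cst; rewrite indicE.
    have [/set_mem Ux|Ux] := boolP (x \in U); last first.
      apply: nearW => n; rewrite /u depth_eq0 ?mulr0 ?min_l//.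
      by move/negP: Ux; rewrite inE.
    exists (Num.truncn (depth U x)^-1).+1 => // n /= hn.
    apply/min_idPr; rewrite -ler_pdivrMr ?depth_gt0// div1r.
    apply: (@le_trans _ _ (Num.truncn (depth U x)^-1).+1%:R).
      by rewrite ltW// truncnS_gt.
    by rewrite ler_nat.
  have key (m : {finite_measure set (borel X) -> \bar R}) :
      \int[m]_x u n x @[n --> \oo] --> fine (m U).
    have -> : fine (m U) = \int[m]_x (\1_U x).
      by rewrite /Rintegral integral_indic// setIT.
    apply: (@Rintegral_cvg _ (borel X) R m u _ (cst 1)) => //.
    - by move=> n; exact: Cb_measurable.
    - exact: finite_measure_integrable_cst.
    - by move=> n x; rewrite ger0_norm// /u ge_min lexx orbT.
  have h : fine (mu U) = fine (mu' U).
    have := key mu; under eq_fun do rewrite mumu'//.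
    by move=> /cvg_unique; apply => //; exact: key.
  have fin (m : {finite_measure set (borel X) -> \bar R}) : (fine (m U))%:E = m U.
    by rewrite fineK//; exact: fin_num_measure.
  by have := congr1 EFin h; rewrite !fin.
- by move=> _; rewrite -ge0_fin_numE//; exact: fin_num_measure.
Qed.

End measure_determination.

(** * Extraction of subsequences *)

Section extraction.

Lemma increasing_choice (P : nat -> nat -> Prop) :
  (forall n m, exists2 k, (m <= k)%N & P n k) ->
  exists2 l : nat -> nat, {homo l : i j / (i < j)%N} & forall n, P n (l n).
Proof.
move=> h.
have /choice[f fP] (nm : nat * nat) : exists k, (nm.2 <= k)%N /\ P nm.1 k.
  by have [k ? ?] := h nm.1 nm.2; exists k.
pose fix l n := if n is n'.+1 then f (n, (l n').+1) else f (0%N, 0%N).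
exists l; last by case=> [|n]; [exact: (fP (0%N, 0%N)).2|exact: (fP (n.+1, _)).2].
apply: homo_ltn; first exact: ltn_trans.
by move=> i; exact: (fP (i.+1, (l i).+1)).1.
Qed.

Lemma increasing_ge (l : nat -> nat) : {homo l : i j / (i < j)%N} ->
  forall n, (n <= l n)%N.
Proof. by move=> hl; elim=> // n /leq_ltn_trans; apply; exact: hl. Qed.

Lemma increasing_cvg (l : nat -> nat) : {homo l : i j / (i < j)%N} ->
  l @ \oo --> \oo.
Proof.
move=> hl A [N _ NA]; exists N => // n /= Nn; apply: NA => /=.
exact: leq_trans Nn (increasing_ge hl n).
Qed.

Lemma cluster_sequence (T : topologicalType) (u : nat -> T) p (B : set T) :
  cluster (u @ \oo) p -> nbhs p B -> forall m, exists2 k, (m <= k)%N & B (u k).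
Proof.
move=> up pB m.
have [|_ [[k /= mk <-] Bk]] := up [set u k | k in [set k | (m <= k)%N]] B _ pB.
  by exists m => // k /= mk; exists k.
by exists k.
Qed.

(** Tychonoff's theorem gives a cluster point c of the sequence of rows in a product of segments.
    The n-th index is then chosen with only the first n coordinates close to those of c, a condition
    that is open in the product topology. *)
Lemma bounded_sequences_extraction (R : realType) (a : nat -> nat -> R)
    (M : nat -> R) : (forall k i, `|a k i| <= M i) ->
  exists2 l : nat -> nat, {homo l : i j / (i < j)%N} &
    forall i, cvgn (fun k => a (l k) i).
Proof.
move=> aM.
have := @tychonoff nat (fun=> R) (fun i => `[- M i, M i]%classic)
  (fun i => @segment_compact R _ _).
move=> /(_ (a @ \oo) _ _)[] //.
  by exists 0%N => // k _ i /=; rewrite in_itv/= -ler_norml.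
move=> c [_ ac].
pose PT : topologicalType := prod_topology (fun _ : nat => R).
have B n : nbhs (c : PT) [set f : PT | forall i : 'I_n, `|f i - c i| < n.+1%:R^-1].
  apply: (@filter_forall PT 'I_n (fun i f => `|f i - c i| < n.+1%:R^-1)
    (nbhs (c : PT)) _) => i.
  have n0 : 0 < n.+1%:R^-1 :> R by rewrite invr_gt0 ltr0n.
  have := @proj_continuous nat (fun _ => R) (val i) c
    (ball (c (val i)) n.+1%:R^-1) (nbhsx_ballx _ _ n0).
  apply: (@filterS PT (nbhs (c : PT)) (nbhs_filter _)) => f.
  by rewrite /ball/= distrC.
have [l hl lP] := increasing_choice (fun n => cluster_sequence ac (B n)).
exists l => // i; apply/cvg_ex; exists (c i); apply/cvgrPdist_lt => e e0.
near=> n.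
have ni : (i < n)%N by near: n; exact: nbhs_infty_gt.
rewrite distrC (lt_trans (lP n (Ordinal ni)))//.
by near: n; exact: near_infty_natSinv_lt (PosNum e0).
Unshelve. all: by end_near. Qed.

End extraction.

(** * Partitions of unity *)

Section dense_sequence.
Context {R : realType} {X : pmetricType R}.

Definition dense_sequence (x_ : nat -> X) :=
  forall x (e : R), 0 < e -> exists i, mdist x (x_ i) < e.

Lemma separable_dense_sequence : separable X -> exists x_, dense_sequence x_.
Proof.
move=> [D /pcard_leP[/= f] dD].
(* f is an injection of D into nat; codes that it misses receive the default [point]. *)
pose x_ k := xget point [set x | D x /\ f x = k].
exists x_ => x e e0.
have [y [Dy]] : D `&` ball x e !=set0.
  rewrite setIC; have [oB xB] := open_nbhs_ball x (PosNum e0).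
  have [y [yb Dy]] := dD _ (ex_intro _ x xB) oB.
  by exists y; split => //; exact: interior_subset yb.
rewrite ballEmdist/= => xy; exists (f y); suff -> : x_ (f y) = y by [].
have : [set x | D x /\ f x = f y] (x_ (f y)).
  by apply: (@xgetPex _ point [set x | D x /\ f x = f y]); exists y.
by move=> -[Dz fz]; apply: (@inj _ _ _ f) => //; exact/mem_set.
Qed.

Lemma compact_nat_cover (A : nat -> set X) : compact [set: X] ->
  (forall n, open (A n)) -> (forall x, exists n, A n x) ->
  exists N, forall x, exists2 n, (n < N)%N & A n x.
Proof.
rewrite compact_cover => cX oA AX.
have [//|D _ XD] := cX nat setT A (fun n _ => oA n).
  by move=> x _; have [n] := AX x; exists n.
exists (\max_(i <- enum_fset D) i).+1 => x.
have [n /= nD Anx] := XD x I; exists n => //.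
by rewrite ltnS; apply: leq_bigmax_seq.
Qed.

Lemma compact_separable : compact [set: X] -> separable X.
Proof.
move=> cX.
have /choice[s sP] (n : nat) : exists s : seq X,
    forall x, exists2 y, y \in s & mdist x y < n.+1%:R^-1.
  have n0 : 0 < n.+1%:R^-1 :> R by rewrite invr_gt0 ltr0n.
  move: (cX); rewrite compact_cover => /(_ X setT (fun x => (ball x n.+1%:R^-1)^°)).
  move=> [|x _|D _ XD].
  - by move=> x _; exact: open_interior.
  - by exists x => //; exact: (open_nbhs_ball x (PosNum n0)).2.
  - exists (enum_fset D) => x; have [y /= yD /interior_subset] := XD x I.
    by rewrite ballEmdist/= metric_sym; exists y.
exists (\bigcup_n [set` s n]).
  by apply: bigcup_countable => // n _; apply: finite_set_countable; exact: finite_seq.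
move=> O [x Ox] oO; have /nbhs_ballP[e /= e0 eO] : nbhs x O by exact: open_nbhs_nbhs.
have [n _ /(_ n (leqnn n)) ne] := near_infty_natSinv_lt (PosNum e0).
have [y yn xy] := sP n x; exists y; split; last by exists n.
by apply: eO; rewrite ballEmdist/=; exact: lt_trans xy ne.
Qed.

End dense_sequence.

Section partition_of_unity.
Context {R : realType} {X : pmetricType R}.
Variables (psi : X -> R) (x_ : nat -> X).
Hypothesis psi_continuous : continuous psi.

(* Controlling psi along with the distance makes psi oscillate little on each
   piece of the partition, so that integrals of functions of order 1 + psi
   against the pieces are controlled too. *)
Definition spread i x := mdist x (x_ i) + `|psi x - psi (x_ i)|.

(** A plateau function: it is 1 up to spread 1 / (n + 1) and 0 from spread 2 / (n + 1) on. *)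
Definition bump n i x := Num.min 1 (Num.max 0 (2 - n.+1%:R * spread i x)).

(** What bump i takes from the part left by the earlier bumps: partial sums telescope to 1 minus a
    product, hence reach 1 as soon as one bump equals 1. *)
Definition piece n i x := bump n i x * \prod_(j < i) (1 - bump n j x).

Lemma spread_continuous i : continuous (spread i).
Proof.
move=> x; apply: cvgD; first exact: mdist_continuous.
by apply: cvg_norm; apply: cvgB; [exact: psi_continuous|exact: cvg_cst].
Qed.

Lemma Cb_bump n i : Cb (bump n i).
Proof.
split; last first.
  exists 1 => x; rewrite ger0_norm /bump ?ge_min ?lexx//.
  by rewrite le_min ler01 le_max lexx.
move=> x; apply: (@continuous_min R X (fun=> 1)); first exact: cvg_cst.
apply: (@continuous_max R X (fun=> 0)); first exact: cvg_cst.
apply: cvgB; first exact: cvg_cst.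
by apply: cvgM; [exact: cvg_cst|exact: spread_continuous].
Qed.

Lemma bump_ge0 n i x : 0 <= bump n i x.
Proof. by rewrite /bump le_min ler01 le_max lexx. Qed.

Lemma bump_le1 n i x : bump n i x <= 1.
Proof. by rewrite /bump ge_min lexx. Qed.

Lemma bump_eq1 n i x : spread i x <= n.+1%:R^-1 -> bump n i x = 1.
Proof.
move=> h; apply/min_idPl; rewrite le_max; apply/orP; right.
have : n.+1%:R * spread i x <= 1 by rewrite mulrC -ler_pdivlMr// div1r.
lra.
Qed.

Lemma bump_near n i x : bump n i x != 0 -> spread i x < 2 * n.+1%:R^-1.
Proof.
move=> h; rewrite ltNge; apply/negP => h2; move/eqP: h; apply.
rewrite /bump max_l ?min_r//.
have : 2 <= n.+1%:R * spread i x by rewrite mulrC -ler_pdivrMr.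
lra.
Qed.

Lemma Cb_piece n i : Cb (piece n i).
Proof.
apply: CbM; first exact: Cb_bump.
elim: i => [|i ih]; first by under eq_fun do rewrite big_ord0; exact: Cb_cst.
under eq_fun do rewrite big_ord_recr/=.
by apply: CbM => //; apply: CbB; [exact: Cb_cst|exact: Cb_bump].
Qed.

Lemma piece_ge0 n i x : 0 <= piece n i x.
Proof.
rewrite mulr_ge0 ?bump_ge0// prodr_ge0// => j _.
by rewrite subr_ge0 bump_le1.
Qed.

Lemma piece_near n i x : piece n i x != 0 -> spread i x < 2 * n.+1%:R^-1.
Proof. by rewrite mulf_eq0 negb_or => /andP[/bump_near]. Qed.

Lemma sum_piece n N x :
  \sum_(i < N) piece n i x = 1 - \prod_(j < N) (1 - bump n j x).
Proof.
elim: N => [|N ih]; first by rewrite !big_ord0 subrr.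
by rewrite !big_ord_recr/= ih /piece; ring.
Qed.

Lemma sum_piece_ge0 n N x : 0 <= \sum_(i < N) piece n i x.
Proof. by apply: sumr_ge0 => i _; exact: piece_ge0. Qed.

Lemma sum_piece_le1 n N x : \sum_(i < N) piece n i x <= 1.
Proof.
rewrite sum_piece gerBl prodr_ge0// => j _.
by rewrite subr_ge0 bump_le1.
Qed.

Lemma sum_piece_eq1 n N x i : (i < N)%N -> spread i x <= n.+1%:R^-1 ->
  \sum_(i < N) piece n i x = 1.
Proof.
move=> iN hi; rewrite sum_piece (bigD1 (Ordinal iN))//= (bump_eq1 hi).
by rewrite subrr mul0r subr0.
Qed.

Hypothesis x_dense : dense_sequence x_.

Lemma spread_dense x (e : R) : 0 < e -> exists i, spread i x < e.
Proof.
move=> e0; have e2 : 0 < e / 2 by rewrite divr_gt0.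
have /nbhs_ballP[d /= d0 dP] : nbhs x [set y | `|psi x - psi y| < e / 2].
  by move/cvgrPdist_lt : (@psi_continuous x); exact.
have m0 : 0 < Num.min d (e / 2) by rewrite lt_min d0.
have [i] := @x_dense x _ m0; rewrite lt_min => /andP[xd xe]; exists i.
have := dP (x_ i); rewrite ballEmdist/= => /(_ xd) h.
by rewrite /spread (splitr e) ltrD.
Qed.

Lemma sum_piece_near n x :
  \forall N \near \oo, \sum_(i < N) piece n i x = 1.
Proof.
have [|i hi] := @spread_dense x n.+1%:R^-1; first by rewrite invr_gt0.
by exists i.+1 => // N /= iN; exact: sum_piece_eq1 iN (ltW hi).
Qed.

Definition approx n N (h : X -> R) x := \sum_(i < N) h (x_ i) * piece n i x.

Lemma Cb_approx n N h : Cb (approx n N h).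
Proof.
apply: (@Cb_sum _ _ N (fun i x => h (x_ i) * piece n i x)) => i.
by apply: CbZ; exact: Cb_piece.
Qed.

(** [approx] is compared with h times the partial sum of the pieces, since it only sees that
    fraction of h; the remaining fraction is controlled separately by [piece_rest_cvg]. *)
Lemma approx_close n N h x (e : R) : 0 <= e ->
  (forall y, mdist x y + `|psi x - psi y| < 2 * n.+1%:R^-1 -> `|h x - h y| <= e) ->
  `|h x * (\sum_(i < N) piece n i x) - approx n N h x| <= e.
Proof.
move=> e0 xe; rewrite mulr_sumr -sumrB.
apply: (@le_trans _ _ (\sum_(i < N) e * piece n i x)).
  apply: le_trans (ler_norm_sum _ _ _) _; apply: ler_sum => i _.
  rewrite -mulrBl normrM (ger0_norm (piece_ge0 _ _ _)).
  have [->|] := eqVneq (piece n i x) 0; first by rewrite !mulr0.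
  by move=> /piece_near/xe; apply: ler_wpM2r; exact: piece_ge0.
by rewrite -mulr_sumr ler_piMr// sum_piece_le1.
Qed.

Lemma continuous_spread (K : R) (h : X -> R) x (e : R) :
  0 < K -> continuous h -> 0 < e ->
  \forall n \near \oo, forall y, mdist x y + `|psi x - psi y| < K * n.+1%:R^-1 ->
    `|h x - h y| <= e.
Proof.
move=> K0 ch e0.
have /nbhs_ballP[d /= d0 dP] : nbhs x [set y | `|h x - h y| <= e].
  by move/cvgrPdist_le : (ch x); exact.
have dK : 0 < d / K by rewrite divr_gt0.
have := near_infty_natSinv_lt (PosNum dK); apply: filterS => n /= nd y xy.
apply: dP; rewrite ballEmdist/=; apply: (@le_lt_trans _ _ (K * n.+1%:R^-1)).
  by apply: le_trans (ltW xy); rewrite lerDl.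
by rewrite mulrC -ltr_pdivlMr.
Qed.

End partition_of_unity.

(** * Densities *)

Section density.
Context d (X : measurableType d) (R : realType).
Implicit Types (mu nu : {finite_measure set X -> \bar R}) (g h : X -> R).
Local Open Scope ereal_scope.
Local Open Scope charge_scope.

(** An everywhere defined, real and nonnegative version of the Radon-Nikodym derivative, so that
    inequalities on densities can be proved pointwise. *)
Definition has_density mu nu g :=
  [/\ measurable_fun setT g, forall x, (0 <= g x)%R &
      forall A, measurable A -> mu A = \int[nu]_(x in A) (g x)%:E].

Lemma dominates_has_density mu nu : mu `<< nu -> exists g, has_density mu nu g.
Proof.
move=> munu.
have [f [f0 ffin fi fE]] := @radon_nikodym_sigma_finite _ X R nu mu munu.
exists (fine \o f); split.
- by apply: measurableT_comp => //; exact: measurable_int fi.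
- by move=> x; rewrite fine_ge0.
- by move=> A mA; rewrite fE ?inE//; apply: eq_integral => x _; rewrite /= fineK.
Qed.

Lemma has_density_dominates mu nu g : has_density mu nu g -> mu `<< nu.
Proof.
move=> [mg g0 gE]; apply/null_content_dominatesP => A mA A0.
rewrite gE//; apply: null_set_integral => //.
  by apply/measurable_EFinP; exact: measurable_funTS.
Qed.

Lemma has_density_integrable mu nu g : has_density mu nu g ->
  nu.-integrable setT (EFin \o g).
Proof.
move=> [mg g0 gE]; apply/integrableP; split; first exact/measurable_EFinP.
under eq_integral do rewrite /= ger0_norm//.
by rewrite -gE// -ge0_fin_numE// fin_num_measure.
Qed.

Lemma has_density_RN mu nu g : has_density mu nu g ->
  {ae nu, forall x, ('d (charge_of_finite_measure mu) '/d nu) x = (g x)%:E}.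
Proof.
move=> dg; have munu := has_density_dominates dg; have [mg g0 gE] := dg.
have : ae_eq nu setT ('d (charge_of_finite_measure mu) '/d nu) (EFin \o g).
  apply: integral_ae_eq => //; first exact: Radon_Nikodym_integrable.
    exact/measurable_EFinP.
  move=> A _ mA; rewrite -Radon_Nikodym_integral//=; exact: gE.
by apply: filterS => x; apply.
Qed.

Lemma RN_has_density mu nu : mu `<< nu ->
  forall g, measurable_fun setT g -> (forall x, (0 <= g x)%R) ->
  {ae nu, forall x, ('d (charge_of_finite_measure mu) '/d nu) x = (g x)%:E} ->
  has_density mu nu g.
Proof.
move=> munu g mg g0 gE; split=> // A mA.
rewrite -[LHS]/(charge_of_finite_measure mu A) (@Radon_Nikodym_integral _ X R _ nu)//.
apply: ae_eq_integral => //; first exact: measurable_funTS.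
  by apply/measurable_EFinP; exact: measurable_funTS.
by apply: filterS gE => x /= gE _.
Qed.

Lemma ge0_integral_density mu nu g (h : X -> \bar R) : has_density mu nu g ->
  measurable_fun setT h -> (forall x, 0 <= h x) ->
  \int[mu]_x h x = \int[nu]_x (h x * (g x)%:E).
Proof.
move=> dg mh h0; have munu := has_density_dominates dg; have [mg g0 gE] := dg.
rewrite -(@Radon_Nikodym_SigmaFinite.change_of_variables _ X R mu nu munu)//.
have mf := measurable_int _ (Radon_Nikodym_SigmaFinite.f_integrable munu).
apply: ge0_ae_eq_integral => //.
- by apply: emeasurable_funM.
- by apply: emeasurable_funM => //; exact/measurable_EFinP.
- by move=> x _; rewrite mule_ge0// Radon_Nikodym_SigmaFinite.f_ge0.
- by move=> x _; rewrite mule_ge0 ?lee_fin.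
apply: ae_eqe_mul2l; have := ae_eq_Radon_Nikodym_SigmaFinite munu measurableT.
move=> /ae_eq_trans; apply.
by apply: filterS (has_density_RN dg) => x /= ->.
Qed.

(** No integrability is assumed: multiplication by g >= 0 commutes with positive and negative parts,
    and each part is a nonnegative integral. *)
Lemma integral_density mu nu g (h : X -> \bar R) : has_density mu nu g ->
  measurable_fun setT h -> \int[mu]_x h x = \int[nu]_x (h x * (g x)%:E).
Proof.
move=> dg mh; have [mg g0 gE] := dg.
have posM x (y : \bar R) : maxe (y * (g x)%:E) 0 = maxe y 0 * (g x)%:E.
  by rewrite [RHS]muleC maxe_pMr ?lee_fin// mule0 muleC.
rewrite integralE [RHS]integralE.
congr (_ - _); rewrite (ge0_integral_density dg)//; try exact: measurable_funepos;
  try exact: measurable_funeneg; apply: eq_integral => x _.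
  by rewrite !funeposE posM.
by rewrite !funenegE -mulNe posM.
Qed.

Lemma integrable_density mu nu g h : has_density mu nu g ->
  measurable_fun setT h ->
  mu.-integrable setT (EFin \o h) <-> nu.-integrable setT (EFin \o (fun x => h x * g x)%R).
Proof.
move=> dg mh; have [mg g0 gE] := dg.
have E : \int[mu]_x `|(h x)%:E| = \int[nu]_x `|(h x * g x)%:E|.
  rewrite (ge0_integral_density dg)//; last first.
    have mE : measurable_fun setT (EFin \o h) by exact/measurable_EFinP.
    by apply: (measurableT_comp _ mE).
  by apply: eq_integral => x _; rewrite EFinM abseM (@gee0_abs _ (g x)%:E) ?lee_fin.
split=> /integrableP[_ fin]; apply/integrableP; split; rewrite ?E//.
- by apply/measurable_EFinP; exact: measurable_funM.
- by rewrite -E.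
- exact/measurable_EFinP.
Qed.

Lemma Rintegral_density mu nu g h : has_density mu nu g ->
  measurable_fun setT h ->
  (\int[mu]_x h x = \int[nu]_x (h x * g x))%R.
Proof.
move=> dg mh; rewrite /Rintegral (integral_density dg)//.
exact/measurable_EFinP.
Qed.

End density.

Section density_measure.
Context d (X : measurableType d) (R : realType).
Variables (nu : {finite_measure set X -> \bar R}) (g : X -> R).
Hypotheses (g_measurable : measurable_fun setT g) (g_ge0 : forall x, 0 <= g x)
  (g_mass : (\int[nu]_x (g x)%:E = 1)%E).

(** The proofs are arguments so that the measure and probability structures can be attached to the
    resulting term. *)
Definition density_measure (_ : measurable_fun setT g) (_ : forall x, 0 <= g x)
    (_ : (\int[nu]_x (g x)%:E = 1)%E) (A : set X) : \bar R :=
  (\int[nu]_(x in A) (g x)%:E)%E.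

Local Notation m := (density_measure g_measurable g_ge0 g_mass).

Let m0 : m set0 = 0%E.
Proof. by rewrite /density_measure integral_set0. Qed.

Let m_ge0 A : (0 <= m A)%E.
Proof. by apply: integral_ge0 => x _; rewrite lee_fin. Qed.

Let m_sigma_additive : semi_sigma_additive m.
Proof.
move=> F mF tF mUF; rewrite /density_measure ge0_integral_bigcup//; last 2 first.
  by apply/measurable_EFinP; exact: measurable_funTS.
  by move=> x _; rewrite lee_fin.
apply: is_cvg_ereal_nneg_natsum_cond => n _ _.
exact: m_ge0.
Qed.

HB.instance Definition _ := isMeasure.Build _ _ _ m m0 m_ge0 m_sigma_additive.

HB.instance Definition _ := Measure_isProbability.Build _ _ _ m g_mass.

Definition density_probability : probability X R := m.

Lemma density_probability_has_density : has_density density_probability nu g.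
Proof. by split. Qed.

End density_measure.

Section probability_of_mass1.
Context d (X : measurableType d) (R : realType).
Variables (mu : {measure set X -> \bar R}) (mu1 : mu setT = 1%E).

(** The proof is an argument so that the probability structure can be attached to the term. *)
Definition mass1_measure (_ : mu setT = 1%E) : set X -> \bar R := mu.

HB.instance Definition _ := Measure.on (mass1_measure mu1).
HB.instance Definition _ :=
  Measure_isProbability.Build _ _ _ (mass1_measure mu1) mu1.

Definition mass1_probability : probability X R := mass1_measure mu1.

End probability_of_mass1.

(** * Approximation by finitely many pieces in weighted L1 *)

Section weighted_approximation.
Context {R : realType} {E : pmetricType R}.
Variables (phi : weight E) (x_ : nat -> E).
Hypothesis x_dense : dense_sequence x_.
Local Notation piece := (piece (phi : E -> R) x_).
Local Notation approx := (approx (phi : E -> R) x_).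
Let phi_cont := @weight_continuous R E phi.

Lemma weight_measurable : measurable_fun [set: borel E] (phi : E -> R).
Proof. exact: continuous_borel_measurable. Qed.

Lemma oneDweight_ge0 (x : E) : 0 <= 1 + phi x.
Proof. by rewrite addr_ge0// weight_ge0. Qed.

Lemma piece_rest_cvg (mu : {measure set (borel E) -> \bar R}) n (g : E -> R) :
  measurable_fun [set: borel E] g -> (forall x, 0 <= g x) ->
  mu.-integrable [set: borel E] (EFin \o g) ->
  \int[mu]_x (g x * (1 - \sum_(i < N) piece n i x)) @[N --> \oo] --> 0.
Proof.
move=> mg g0 ig.
apply: (@Rintegral_cvg0 _ (borel E) R mu
  (fun N x => g x * (1 - \sum_(i < N) piece n i x)) g) => //.
- move=> N; apply: measurable_funM => //.
  apply: (@Cb_measurable R E); apply: CbB; first exact: Cb_cst.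
  by apply: (@Cb_sum R E N (fun i => piece n i)) => i; exact: Cb_piece.
- move=> N x; rewrite ger0_norm.
    by rewrite ler_piMr// gerBl sum_piece_ge0.
  by rewrite mulr_ge0// subr_ge0 sum_piece_le1.
- move=> x; apply: cvg_near_cst.
  apply: filterS (sum_piece_near phi_cont x_dense n x) => N ->.
  by rewrite subrr mulr0.
Qed.

(** This is where the oscillation of phi inside [spread] matters: on the support of piece i, phi (x_
    i) <= phi x + 2, whence 1 + phi (x_ i) <= 3 (1 + phi x). *)
Lemma approx_order1 (A : R) (h : E -> R) n N x :
  0 <= A -> (forall x, `|h x| <= A * (1 + phi x)) ->
  `|approx n N h x| <= A * 3 * (1 + phi x).
Proof.
move=> A0 hA; apply: le_trans (ler_norm_sum _ _ _) _.
apply: (@le_trans _ _ (\sum_(i < N) (A * 3 * (1 + phi x)) * piece n i x)).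
  apply: ler_sum => i _; rewrite normrM (ger0_norm (piece_ge0 _ _ _ _ _)).
  have [->|] := eqVneq (piece n i x) 0; first by rewrite !mulr0.
  move=> /piece_near; rewrite /spread => sx.
  apply: ler_wpM2r; first exact: piece_ge0.
  apply: le_trans (hA _) _; rewrite -mulrA; apply: ler_wpM2l => //.
  have n1 : n.+1%:R^-1 <= 1 :> R by rewrite invf_le1 ?ler1n.
  have := mdist_ge0 x (x_ i); have := ler_norm (- (phi x - phi (x_ i))).
  by rewrite normrN; have := weight_ge0 phi x; move: sx n1; set t := _^-1; lra.
rewrite -mulr_sumr ler_piMr ?sum_piece_le1//.
by rewrite mulr_ge0 ?oneDweight_ge0// mulr_ge0.
Qed.

Lemma approx_L1 (mu : {measure set (borel E) -> \bar R}) (W h : E -> R) (A e : R) :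
  measurable_fun [set: borel E] W -> (forall x, 0 <= W x) ->
  mu.-integrable [set: borel E] (EFin \o (fun x => (1 + phi x) * W x)) ->
  0 <= A -> continuous h -> (forall x, `|h x| <= A * (1 + phi x)) -> 0 < e ->
  exists n N, \int[mu]_x (`|h x - approx n N h x| * W x) <= e.
Proof.
move=> mW W0 iW A0 ch hA e0.
pose g x := A * ((1 + phi x) * W x).
have mphiW : measurable_fun [set: borel E] (fun x => (1 + phi x) * W x).
  by apply: measurable_funM => //; apply: measurable_funD => //; exact: weight_measurable.
have mg : measurable_fun [set: borel E] g by exact: measurable_funM.
have g0 x : 0 <= g x by rewrite mulr_ge0// mulr_ge0// oneDweight_ge0.
have ig : mu.-integrable [set: borel E] (EFin \o g).
  by have := integrableZl measurableT A iW.
have e2 : 0 < e / 2 by rewrite divr_gt0.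
(* The number of pieces is fixed as a function of n first, the rest costing e / 2 for every n; then
   n is taken large. The majorant 4 g below is g for h itself plus 3 g for its approximation. *)
have /choice[N_ NP] (n : nat) : exists N,
    \int[mu]_x (g x * (1 - \sum_(i < N) piece n i x)) <= e / 2.
  have /cvgrPdist_le/(_ _ e2)[N _ /(_ N (leqnn N))] := piece_rest_cvg n mg g0 ig.
  by rewrite sub0r normrN => h'; exists N; exact: le_trans (ler_norm _) h'.
pose S n x := \sum_(i < N_ n) piece n i x.
have mS n : measurable_fun [set: borel E] (S n).
  apply: (@Cb_measurable R E).
  by apply: (@Cb_sum R E _ (fun i => piece n i)) => i; exact: Cb_piece.
have mh : measurable_fun [set: borel E] h by exact: continuous_borel_measurable.
have ma n : measurable_fun [set: borel E] (approx n (N_ n) h).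
  by apply: (@Cb_measurable R E); exact: Cb_approx.
pose v n x := `|h x * S n x - approx n (N_ n) h x| * W x.
have mv n : measurable_fun [set: borel E] (v n).
  apply: measurable_funM => //; apply: measurableT_comp => //.
  by apply: measurable_funB => //; exact: measurable_funM.
have i4 : mu.-integrable [set: borel E] (EFin \o (fun x => 4 * g x)).
  by have := integrableZl measurableT 4 ig.
have vb n x : `|v n x| <= 4 * g x.
  rewrite ger0_norm ?mulr_ge0// /v /g mulrA mulrA; apply: ler_wpM2r => //.
  apply: le_trans (ler_normB _ _) _.
  have h1 : `|h x * S n x| <= A * (1 + phi x).
    rewrite normrM (@ger0_norm _ (S n x)) ?sum_piece_ge0//.
    by apply: le_trans (hA x); rewrite ler_piMr// sum_piece_le1.
  by have h2 := @approx_order1 A h n (N_ n) x A0 hA; lra.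
have v0 : \int[mu]_x v n x @[n --> \oo] --> 0.
  apply: (@Rintegral_cvg0 _ (borel E) R mu v (fun x => 4 * g x)) => //.
  move=> x; apply/cvgrPdist_le => d d0.
  have dW : 0 < d / (1 + W x) by rewrite divr_gt0// ltr_pwDl.
  have := continuous_spread (phi : E -> R) x (ltr0Sn _ 1) ch dW.
  apply: filterS => n hn; rewrite /= sub0r normrN ger0_norm ?mulr_ge0//.
  have := @approx_close R E phi x_ n (N_ n) h x _ (ltW dW) hn.
  move=> h'; apply: le_trans (ler_wpM2r (W0 x) h') _.
  rewrite mulrAC ler_pdivrMr; last by rewrite ltr_pwDl.
  by rewrite ler_pM2l// lerDr.
have /cvgrPdist_le/(_ _ e2)[n _ /(_ n (leqnn n))] := v0.
rewrite sub0r normrN => vn'; have {vn'} vn := le_trans (ler_norm _) vn'; exists n, (N_ n).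
have irest : mu.-integrable [set: borel E] (EFin \o (fun x => g x * (1 - S n x))).
  apply: (integrable_dominated _ ig).
    by apply: measurable_funM => //; apply: measurable_funB.
  move=> x; rewrite ger0_norm; first by rewrite ler_piMr// gerBl sum_piece_ge0.
  by rewrite mulr_ge0// subr_ge0 sum_piece_le1.
have iv : mu.-integrable [set: borel E] (EFin \o v n).
  exact: (integrable_dominated (mv n) i4 (vb n)).
apply: (@le_trans _ _ (\int[mu]_x (g x * (1 - S n x) + v n x))); last first.
  rewrite RintegralD// [leRHS](splitr e); apply: lerD => //; exact: NP.
apply: le_Rintegral => //.
- apply: (integrable_dominated _ i4).
    apply: measurable_funM => //; apply: measurableT_comp => //.
    exact: measurable_funB.
  move=> x; rewrite ger0_norm ?mulr_ge0// /g mulrA mulrA; apply: ler_wpM2r => //.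
  apply: le_trans (ler_normB _ _) _.
  by have h2 := @approx_order1 A h n (N_ n) x A0 hA; have := hA x; lra.
- by have := integrableD measurableT irest iv.
move=> x _; rewrite /g /v.
have -> : A * ((1 + phi x) * W x) * (1 - S n x) +
    `|h x * S n x - approx n (N_ n) h x| * W x =
  (A * (1 + phi x) * (1 - S n x) + `|h x * S n x - approx n (N_ n) h x|) * W x.
  by ring.
apply: ler_wpM2r => //.
rewrite (_ : h x - _ = h x * (1 - S n x) + (h x * S n x - approx n (N_ n) h x));
  last by ring.
apply: le_trans (ler_normD _ _) _; rewrite lerD2r normrM.
have S1 : 0 <= 1 - S n x by rewrite subr_ge0 sum_piece_le1.
by rewrite (ger0_norm S1) ler_wpM2r.
Qed.

End weighted_approximation.

(** * Relative compactness in Pphi *)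

Section Pphi_integration.
Context {R : realType} {E : pmetricType R} {phi : weight E}.
Implicit Types (mu : Pphi phi) (h : E -> R) (A : R).

Lemma Pphi_weight_integrable mu : mu.-integrable [set: borel E] (EFin \o (phi : E -> R)).
Proof.
apply/integrableP; split; first by apply/measurable_EFinP; exact: weight_measurable.
apply: le_lt_trans (pphi_moment mu); rewrite le_eqVlt; apply/orP; left; apply/eqP.
by apply: eq_integral => x _; rewrite /= ger0_norm// weight_ge0.
Qed.

Lemma Pphi_oneDweight_integrable mu A :
  mu.-integrable [set: borel E] (EFin \o (fun x => A * (1 + phi x))).
Proof.
have i1 : mu.-integrable [set: borel E] (EFin \o (fun x => 1 + phi x)).
  have := integrableD measurableT (finite_measure_integrable_cst mu 1 measurableT)
    (Pphi_weight_integrable mu).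
  exact.
by have := integrableZl measurableT A i1.
Qed.

Lemma Pphi_integrable mu h A : measurable_fun [set: borel E] h ->
  (forall x, `|h x| <= A * (1 + phi x)) ->
  mu.-integrable [set: borel E] (EFin \o h).
Proof.
by move=> mh hA; exact: (integrable_dominated mh (Pphi_oneDweight_integrable mu A) hA).
Qed.

Lemma Cb_order1 h : Cb h -> exists2 M, 0 <= M & forall x, `|h x| <= M * (1 + phi x).
Proof.
move=> [_ [M hM]]; have M0 : 0 <= M by exact: le_trans (hM point).
exists M => // x; apply: le_trans (hM x) _.
by rewrite ler_peMr// lerDl weight_ge0.
Qed.

Lemma cvg_pphi_order1 (mu_ : nat -> Pphi phi) mu :
  mu_ @ \oo --> mu <->
  (forall h, h = phi \/ Cb h -> \int[mu_ k]_x h x @[k --> \oo] --> \int[mu]_x h x).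
Proof.
rewrite cvg_pphiP; split=> [[h1 h2] h [->//|[ch bh]]|h]; first exact: h2.
by split=> [|f cf bf]; apply: h; [left|right].
Qed.

End Pphi_integration.

Section Pphi_extraction.
Context {R : realType} {E : pmetricType R} {phi : weight E}.
Hypothesis E_separable : separable E.
Variables (mu_ : nat -> Pphi phi) (nu : {measure set (borel E) -> \bar R}).
Variable W : E -> R.
Hypotheses (mW : measurable_fun [set: borel E] W) (W0 : forall x, 0 <= W x).
Hypothesis iW :
  nu.-integrable [set: borel E] (EFin \o (fun x => (1 + phi x) * W x)).
Hypothesis dominated : forall (h : E -> R) (A : R), continuous h ->
  (forall x, 0 <= h x <= A * (1 + phi x)) -> forall e : R, 0 < e ->
  \forall k \near \oo, \int[mu_ k]_x h x <= \int[nu]_x (h x * W x) + e.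

(** A linear space containing phi and the bounded continuous functions, hence every test function of
    the topology of [Pphi phi]. *)
Let order1 (h : E -> R) :=
  continuous h /\ exists2 A, 0 <= A & forall x, `|h x| <= A * (1 + phi x).

Let order1_measurable h : order1 h -> measurable_fun [set: borel E] h.
Proof. by move=> [ch _]; exact: continuous_borel_measurable. Qed.

Let order1_integrable (mu : Pphi phi) h : order1 h ->
  mu.-integrable [set: borel E] (EFin \o h).
Proof.
by move=> oh; have [ch [A _ hA]] := oh; apply: Pphi_integrable hA; exact: order1_measurable.
Qed.

Let order1_Cb h : Cb h -> order1 h.
Proof. by move=> hh; split; [exact: hh.1|exact: Cb_order1]. Qed.

Let order1_weight : order1 phi.
Proof.
split; first exact: weight_continuous.
by exists 1 => // x; rewrite mul1r ger0_norm ?weight_ge0// lerDr.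
Qed.

Let order1_lin (a : R) f g : order1 f -> order1 g -> order1 (fun x => a * f x + g x).
Proof.
move=> [cf [A A0 fA]] [cg [B B0 gB]]; split.
  by move=> x; apply: cvgD; [apply: cvgM; [exact: cvg_cst|exact: cf]|exact: cg].
exists (`|a| * A + B); first by rewrite addr_ge0// mulr_ge0.
move=> x; apply: le_trans (ler_normD _ _) _; rewrite mulrDl lerD//.
by rewrite normrM -mulrA ler_wpM2l.
Qed.

Let order1_norm f : order1 f -> order1 (fun x => `|f x|).
Proof.
move=> [cf [A A0 fA]]; split; first by move=> x; apply: cvg_norm; exact: cf.
by exists A => // x; rewrite normr_id.
Qed.

Let order1W h : order1 h ->
  nu.-integrable [set: borel E] (EFin \o (fun x => h x * W x)).
Proof.
move=> oh; have [ch [A A0 hA]] := oh.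
have iA : nu.-integrable [set: borel E] (EFin \o (fun x => A * ((1 + phi x) * W x))).
  by have := integrableZl measurableT A iW.
apply: (integrable_dominated _ iA).
  by apply: measurable_funM => //; exact: order1_measurable.
by move=> x; rewrite normrM (ger0_norm (W0 x)) mulrA ler_wpM2r.
Qed.

Let dominated_norm h e : order1 h -> 0 < e -> \forall k \near \oo,
  `|\int[mu_ k]_x h x| <= \int[nu]_x (`|h x| * W x) + e.
Proof.
move=> oh e0; have [ch [A A0 hA]] := order1_norm oh.
have := @dominated (fun x => `|h x|) A ch _ e e0.
move=> H; apply: filterS (H _) => [k hk|x]; last by rewrite normr_ge0/= -[leLHS]normr_id.
apply: le_trans hk; apply: le_trans (le_normr_Rintegral measurableT _) _ => //.
exact: order1_integrable.
Qed.

(** Convergence is arranged on countably many pieces, and passes to functions of order 1 + phi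
    because finite combinations of pieces approximate them in L1(W nu), a norm that controls the
    integrals asymptotically by [dominated]. *)
Let extraction_cvg : exists2 l : nat -> nat, {homo l : i j / (i < j)%N} &
  forall h, order1 h -> cvgn (fun k => \int[mu_ (l k)]_x h x).
Proof.
have [x_ x_dense] := separable_dense_sequence E_separable.
(* The pieces are enumerated through codes of pairs; a number that codes no pair yields the piece
   (0, 0). *)
pose p (j : nat) := let ni := odflt (0%N, 0%N) (@choice.unpickle (nat * nat)%type j) in
  piece (phi : E -> R) x_ ni.1 ni.2.
have pC j : Cb (p j) by apply: Cb_piece; exact: weight_continuous.
have [|l hl lP] := @bounded_sequences_extraction R
    (fun k j => \int[mu_ k]_x p j x) (fun=> 1).
  move=> k j.
  have p1 x : `|p j x| <= cst 1 x.
    rewrite ger0_norm ?piece_ge0// /p; set n := odflt _ _.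
    have := sum_piece_le1 (phi : E -> R) x_ n.1 n.2.+1 x.
    rewrite big_ord_recr/= => /(le_trans _); apply.
    by rewrite lerDr sum_piece_ge0.
  have i1 : (mu_ k).-integrable [set: borel E] (EFin \o (cst 1 : borel E -> R)).
    exact: finite_measure_integrable_cst.
  have := Rintegral_norm_le (Cb_measurable (pC j)) i1 p1.
  by rewrite Rintegral_probability_cst.
exists l => // h oh.
have pieceP n i : cvgn (fun k => \int[mu_ (l k)]_x piece (phi : E -> R) x_ n i x).
  by have := lP (@choice.pickle (nat * nat)%type (n, i)); rewrite /p choice.pickleK.
apply: cauchy_cvg; apply: cauchy_exP => e e0.
have e4 : 0 < e / 4 by rewrite divr_gt0.
have [ch [A A0 hA]] := oh.
have [n [N nN]] := approx_L1 x_dense mW W0 iW A0 ch hA e4.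
set g := approx _ _ n N h in nN.
have gC : Cb g by apply: Cb_approx; exact: weight_continuous.
have gcvg : cvgn (fun k => \int[mu_ (l k)]_x g x).
  have -> : (fun k => \int[mu_ (l k)]_x g x) = (fun k => \sum_(i < N)
      h (x_ i) * \int[mu_ (l k)]_x piece (phi : E -> R) x_ n i x).
    apply/funext => k; rewrite /g /approx.
    have := @Rintegral_Cb_sum R E (mu_ (l k)) N
      (fun i x => h (x_ i) * piece (phi : E -> R) x_ n i x).
    move=> ->; last by move=> i; apply: CbZ; apply: Cb_piece; exact: weight_continuous.
    apply: eq_bigr => i _; rewrite RintegralZl//.
    by apply: Cb_integrable; apply: Cb_piece; exact: weight_continuous.
  apply/cvg_ex; exists (\sum_(i < N) h (x_ i) *
    limn (fun k => \int[mu_ (l k)]_x piece (phi : E -> R) x_ n i x)).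
  apply: (@cvg_sum_ord R N (fun i k =>
    h (x_ i) * \int[mu_ (l k)]_x piece (phi : E -> R) x_ n i x)
    (fun i => h (x_ i) *
      limn (fun k => \int[mu_ (l k)]_x piece (phi : E -> R) x_ n i x))) => i.
  by apply: cvgM; [exact: cvg_cst|exact: pieceP].
(* The Cauchy property: the integrals of g converge, and replacing h by g costs e / 4 for the
   approximation plus e / 4 from [dominated]. *)
exists (limn (fun k => \int[mu_ (l k)]_x g x)).
have od : order1 (fun x => h x - g x).
  have := order1_lin (-1) (order1_Cb gC) oh.
  by congr order1; apply/funext => x; rewrite mulN1r addrC.
have H1 : \forall k \near \oo,
    `|\int[mu_ (l k)]_x (h x - g x)| <= \int[nu]_x (`|h x - g x| * W x) + e / 4.
  exact: (increasing_cvg hl (dominated_norm od e4)).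
have H2 : \forall k \near \oo,
    `|limn (fun k => \int[mu_ (l k)]_x g x) - \int[mu_ (l k)]_x g x| < e / 4.
  by move/cvgrPdist_lt : gcvg; exact.
apply: filterS2 H1 H2 => k; rewrite RintegralB//; last 2 first.
- exact: order1_integrable.
- exact/order1_integrable/order1_Cb.
rewrite /ball/=; move: nN; set a := \int[nu]_x _; set b := limn _.
set c := \int[mu_ (l k)]_x h x; set d := \int[mu_ (l k)]_x g x => h1 h2 h3.
rewrite (_ : b - c = (b - d) - (c - d)); last by ring.
by apply: le_lt_trans (ler_normB _ _) _; lra.
Qed.

(** Sequential compactness with domination in place of tightness: the limit functional is bounded by
    integration against W nu, hence continuous along decreasing sequences, hence a measure. The same
    continuity, applied to functions of order 1 + phi, prevents any loss of phi-moment in the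
    limit. *)
Theorem Pphi_extraction :
  exists2 l : nat -> nat, {homo l : i j / (i < j)%N} &
  exists mu : Pphi phi, mu_ \o l @ \oo --> mu.
Proof.
have [l hl lcvg] := extraction_cvg; exists l => //.
pose L h := limn (fun k => \int[mu_ (l k)]_x h x).
have LP h : order1 h -> \int[mu_ (l k)]_x h x @[k --> \oo] --> L h.
  exact: lcvg.
have L_lin (a : R) f g : order1 f -> order1 g ->
    L (fun x => a * f x + g x) = a * L f + L g.
  move=> hf hg; apply/cvg_lim => //.
  have -> : (fun k => \int[mu_ (l k)]_x (a * f x + g x)) =
      (fun k => a * \int[mu_ (l k)]_x f x + \int[mu_ (l k)]_x g x).
    apply/funext => k; rewrite RintegralD ?RintegralZl//; try exact: order1_integrable.
    by have := integrableZl measurableT a (order1_integrable (mu_ (l k)) hf).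
  by apply: cvgD; [apply: cvgM; [exact: cvg_cst|exact: LP]|exact: LP].
have L_ge0 f : order1 f -> (forall x, 0 <= f x) -> 0 <= L f.
  move=> hf f0; apply: limr_ge; first exact: lcvg.
  by apply: nearW => k; apply: Rintegral_ge0.
have L_dom f : order1 f -> (forall x, 0 <= f x) -> L f <= \int[nu]_x (f x * W x).
  move=> hf f0; apply/ler_addgt0Pr => e e0; apply: limr_le; first exact: lcvg.
  have [cf [A A0 fA]] := hf.
  apply: (increasing_cvg hl (@dominated f A cf _ e e0)) => x.
  by rewrite f0 (le_trans (ler_norm _)).
have L_cont (f : nat -> E -> R) : (forall n, order1 (f n)) ->
    (forall n x, 0 <= f n.+1 x <= f n x) -> (forall x, f ^~ x @ \oo --> 0) ->
    L (f n) @[n --> \oo] --> 0.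
  move=> fC fmono f0.
  have fge0 n x : 0 <= f n x by have /andP[h1 /(le_trans h1)] := fmono n x.
  have fle n x : f n x <= f 0%N x.
    by elim: n => // n ih; have /andP[_ h] := fmono n x; exact: le_trans ih.
  have fW : \int[nu]_x (f n x * W x) @[n --> \oo] --> 0.
    apply: (@Rintegral_cvg0 _ (borel E) R nu (fun n x => f n x * W x)
      (fun x => f 0%N x * W x)) => //.
    - by move=> n; apply: measurable_funM => //; exact: order1_measurable.
    - exact: order1W.
    - by move=> n x; rewrite ger0_norm ?mulr_ge0// ler_wpM2r.
    - by move=> x; rewrite -(mul0r (W x)); apply: cvgM; [exact: f0|exact: cvg_cst].
  apply: (squeeze_cvgr _ (cvg_cst 0) fW).
  by apply: nearW => n; rewrite L_ge0//= L_dom.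
have [mu [muE _]] := @daniell_representation R E L
  (fun a f g hf hg => L_lin a f g (order1_Cb hf) (order1_Cb hg))
  (fun f hf => L_ge0 f (order1_Cb hf))
  (fun f hf => L_cont f (fun n => order1_Cb (hf n))).
have L1 : L (fun=> 1) = 1.
  apply/cvg_lim => //; rewrite (_ : (fun k => _) = (fun=> 1)); first exact: cvg_cst.
  by apply/funext => k; rewrite Rintegral_probability_cst.
have mu1 : mu setT = 1%E.
  have := muE _ (Cb_cst 1); rewrite L1 Rintegral_cst// mul1r => h.
  by rewrite -(fineK (fin_num_measure mu _ measurableT)) h.
(* The representation only concerns bounded functions, so phi is reached through its truncations:
   monotone convergence for the moment, dominated convergence for the integral. *)
pose t (M : nat) x := Num.min (phi x) M%:R.
have tC M : Cb (t M).
  split.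
    move=> x; apply: (@continuous_min R E (phi : E -> R) (fun=> M%:R)).
      exact: weight_continuous.
    exact: cvg_cst.
  exists M%:R => x; rewrite ger0_norm /t ?ge_min ?lexx ?orbT//.
  by rewrite le_min weight_ge0 ler0n.
have t0 M x : 0 <= t M x by rewrite le_min weight_ge0 ler0n.
have tle M x : t M x <= phi x by rewrite ge_min lexx.
have tmono x : {homo t ^~ x : m n / (m <= n)%N >-> m <= n}.
  by move=> m n mn; rewrite /t le_min !ge_min lexx/= ler_nat mn orbT.
have tcvg x : t ^~ x @ \oo --> phi x.
  apply: cvg_near_cst; exists (Num.truncn (phi x)).+1 => // n /= hn.
  apply/min_idPl; apply: (@le_trans _ _ (Num.truncn (phi x)).+1%:R).
    by rewrite ltW// truncnS_gt.
  by rewrite ler_nat.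
have tintE M : (\int[mu]_x (t M x)%:E = (L (t M))%:E)%E.
  by rewrite -(muE _ (tC M)) EFin_Rintegral//; exact: Cb_integrable.
have tLe M : L (t M) <= L phi.
  have h := L_lin (-1) (t M) phi (order1_Cb (tC M)) order1_weight.
  have : 0 <= L (fun x => -1 * t M x + phi x).
    apply: L_ge0; first exact: order1_lin (order1_Cb (tC M)) order1_weight.
    by move=> x; rewrite mulN1r addrC subr_ge0.
  by rewrite h; lra.
have phimeas := @weight_measurable R E phi.
have moment : (\int[mu]_x (phi x)%:E < +oo)%E.
  apply: (@le_lt_trans _ _ (L phi)%:E); last exact: ltry.
  have := @cvg_monotone_convergence _ (borel E) R mu setT measurableT
    (fun M x => (t M x)%:E) (fun M => proj2 (@measurable_EFinP _ _ _ _ _)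
      (Cb_measurable (tC M))) (fun M x _ => t0 M x)
    (fun x _ m n mn => tmono x m n mn).
  rewrite (_ : (\int[mu]_x _)%E = (\int[mu]_x (phi x)%:E)%E); last first.
    apply: eq_integral => x _; apply/cvg_lim => //.
    by apply: cvg_EFin; [exact: nearW|exact: tcvg].
  move=> h; rewrite -(cvg_lim _ h)//; apply: lime_le; first by apply/cvg_ex; eexists; exact: h.
  by apply: nearW => M; rewrite tintE lee_fin.
pose mu' : Pphi phi := @MkPphi R E phi (mass1_probability mu1) moment.
exists mu'; apply/cvg_pphi_order1 => h [->|hC]; last first.
  by have := LP _ (order1_Cb hC); rewrite -(muE _ hC).
suff -> : \int[mu']_x phi x = L phi by exact: LP.
have c1 : \int[mu]_x t M x @[M --> \oo] --> \int[mu]_x phi x.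
  apply: (@Rintegral_cvg _ (borel E) R mu t _ (phi : E -> R)) => //.
  - by move=> M; exact: Cb_measurable.
  - exact: (Pphi_weight_integrable mu').
  - by move=> M x; rewrite ger0_norm.
(* The tails phi - t M decrease to 0, so that [L_cont] applies to them although they are
   unbounded. *)
have c2 : L (t M) @[M --> \oo] --> L phi.
  pose d M x := -1 * t M x + phi x.
  have dO M : order1 (d M) by exact: order1_lin (order1_Cb (tC M)) order1_weight.
  have d0 : L (d M) @[M --> \oo] --> 0.
    apply: L_cont => //.
      move=> M x; rewrite /d !mulN1r; have := tle M.+1 x.
      by have := tmono x M M.+1 (leqnSn M); lra.
    move=> x; rewrite -[X in _ --> X](subrr (phi x)).
    under eq_fun do rewrite /d mulN1r addrC.
    by apply: cvgB; [exact: cvg_cst|exact: tcvg].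
  have -> : (fun M => L (t M)) = (fun M => L phi - L (d M)).
    apply/funext => M; rewrite /d L_lin//; first by lra.
    exact: order1_Cb.
  by rewrite -[X in _ --> X]subr0; apply: cvgB => //; exact: cvg_cst.
move: c1; under eq_fun do rewrite muE//.
by move=> /cvg_unique; apply => //.
Qed.

End Pphi_extraction.

(** * Positive measures on a compact space *)

Lemma ultra_fmap (S U : Type) (f : S -> U) (F : set_system S) :
  UltraFilter F -> UltraFilter (f @ F).
Proof.
move=> FU; split=> [|G PG FG]; first exact: fmap_proper_filter.
apply/seteqP; split=> [B GB|]; last exact: FG.
have [//|FB] := in_ultra_setVsetC (f @^-1` B) FU.
have : G (~` B) by apply: FG.
by move=> /(filterI GB); rewrite setICr => /filter_not_empty.
Qed.

Section compact_measures.
Context {R : realType} {T : pmetricType R}.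
Hypothesis T_compact : compact [set: T].
Implicit Types (f : T -> R) (lambda : Mplus T).

Lemma compact_Cb f : continuous f -> Cb f.
Proof.
move=> cf; split=> //.
have [n|t|N NP] := @compact_nat_cover R T
    (fun n => [set t | `|f t| < n%:R]) T_compact.
- have /continuousP h : continuous (fun t => `|f t|).
    by move=> t; apply: cvg_norm; exact: cf.
  exact: (h [set y | y < n%:R] (@open_lt _ n%:R)).
- by exists (Num.truncn `|f t|).+1; exact: truncnS_gt.
- exists N%:R => t; have [n nN /= /ltW ftn] := NP t.
  by rewrite (le_trans ftn)// ler_nat ltnW.
Qed.

Lemma Mplus_integrable lambda f : continuous f ->
  lambda.-integrable [set: borel T] (EFin \o f).
Proof. by move=> /compact_Cb; exact: Cb_integrable. Qed.

(** By Dini's theorem a sequence decreasing to 0 pointwise on a compact space is eventually below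
    any constant d > 0, and positivity of L then gives the continuity that Daniell's theorem
    requires. *)
Lemma riesz_compact (L : (T -> R) -> R) :
  (forall (a : R) f g, continuous f -> continuous g ->
    L (fun x => a * f x + g x) = a * L f + L g) ->
  (forall f, continuous f -> (forall x, 0 <= f x) -> 0 <= L f) ->
  exists lambda : Mplus T, forall f, continuous f -> \int[lambda]_t f t = L f.
Proof.
move=> L_lin L_ge0.
have c1 : continuous (fun _ : T => 1 : R) by move=> t; exact: cvg_cst.
have c0 : continuous (fun _ : T => 0 : R) by move=> t; exact: cvg_cst.
have le_L f g : continuous f -> continuous g -> (forall t, f t <= g t) -> L f <= L g.
  move=> cf cg fg; have := L_lin (-1) f g cf cg.
  have : 0 <= L (fun x => -1 * f x + g x).
    apply: L_ge0 => [x|x]; last by rewrite mulN1r addrC subr_ge0.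
    by apply: cvgD; [apply: cvgM; [exact: cvg_cst|exact: cf]|exact: cg].
  by move=> + h; rewrite h; lra.
have L_Z (a : R) : L (fun=> a) = a * L (fun=> 1).
  have L0 : L (fun=> 0) = 0.
    have := L_lin 1 _ _ c0 c0; under eq_fun do rewrite mulr0 addr0.
    by rewrite mul1r; lra.
  by have := L_lin a _ _ c1 c0; rewrite L0 !addr0 mulr1.
have L_cont (f : nat -> T -> R) : (forall n, Cb (f n)) ->
    (forall n x, 0 <= f n.+1 x <= f n x) -> (forall x, f ^~ x @ \oo --> 0) ->
    L (f n) @[n --> \oo] --> 0.
  move=> fC fmono f0; apply/cvgrPdist_le => e e0.
  pose d := e / (1 + L (fun=> 1)).
  have L1 : 0 <= L (fun=> 1) by apply: L_ge0.
  have d0 : 0 < d by rewrite divr_gt0// ltr_pwDl.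
  have fge0 n x : 0 <= f n x by have /andP[h1 /(le_trans h1)] := fmono n x.
  have flem x : {homo f ^~ x : m n / (m <= n)%N >-> n <= m}.
    apply: homo_leq => [|y z t h1 h2|n] //; first exact: le_trans h2 h1.
    by have /andP[] := fmono n x.
  have [n|t|N NP] := @compact_nat_cover R T
      (fun n => [set t | f n t < d]) T_compact.
  - have [/continuousP h _] := fC n; exact: (h [set y | y < d] (@open_lt _ d)).
  - have /cvgrPdist_lt/(_ _ d0)[n _ /(_ n (leqnn n))] := f0 t.
    by rewrite sub0r normrN ger0_norm//; exists n.
  - exists N => // n /= Nn; rewrite sub0r normrN ger0_norm; last first.
      by apply: L_ge0 => //; exact: (fC n).1.
    apply: (@le_trans _ _ (L (fun=> d))).
      apply: le_L => [||t]; [exact: (fC n).1|by move=> x; exact: cvg_cst|].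
      have [m mN /= /ltW fm] := NP t; apply: le_trans fm.
      by apply: flem; apply: leq_trans Nn; exact: ltnW.
    rewrite L_Z /d mulrAC ler_pdivrMr ?ltr_pwDl//.
    by rewrite ler_pM2l// lerDr.
have [mu [muE mureg]] := @daniell_representation R T L
  (fun a f g hf hg => L_lin a f g hf.1 hg.1) (fun f hf => L_ge0 f hf.1) L_cont.
suff radon : forall A : set (borel T), measurable A -> mu A =
    ereal_sup [set mu K | K in [set K : set T | compact K /\ K `<=` A]].
  by exists (MkMplus radon) => f cf; apply: muE; exact: compact_Cb.
move=> A mA.
  have kmeas (K : set T) : compact K -> measurable (K : set (borel T)).
    move=> /compact_closed cK; rewrite -(setCK K); apply: measurableC.
    apply: sub_sigma_algebra; apply: closed_openC; apply: cK.
    exact: metric_hausdorff.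
  apply/eqP; rewrite eq_le; apply/andP; split; last first.
    apply: ge_ereal_sup => _ [K [cK KA] <-].
    by apply: le_measure => //; apply/mem_set => //; exact: kmeas.
  (* Inner regularity of A from outer regularity of its complement: if U is open and contains the
     complement of A up to e, then the complement of U is a compact subset of A of almost full
     measure. *)
  apply/lee_addgt0Pr => e e0.
  have [U [oU AU] mU] := mureg (~` A) e e0.
  have mU' : measurable (U : set (borel T)) by exact: sub_sigma_algebra.
  have cU : compact (~` U).
    by apply: (subclosed_compact _ T_compact) => //; exact: open_closedC.
  apply: (@le_trans _ _ (mu (~` U) + e%:E)%E); last first.
    rewrite leeD2r//; apply: ereal_sup_ubound; exists (~` U) => //.
    by split => // t Ut; apply: contrapT => At; apply: Ut; exact: AU.
  have mfin B : measurable B -> mu B \is a fin_num by exact: fin_num_measure.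
  have hc (B : set (borel T)) : measurable B ->
      fine (mu (~` B)) = fine (mu setT) - fine (mu B).
    move=> mB; have : mu setT = (mu B + mu (~` B))%E.
      by rewrite -measureU ?setUv ?setICr//; exact: measurableC.
    move=> ->; rewrite fineD ?mfin//; first by lra.
    exact: measurableC.
  move: mU; rewrite -(fineK (mfin _ mU')) -(fineK (mfin _ (measurableC mA))).
  rewrite -(fineK (mfin _ mA)) -(fineK (mfin _ (measurableC mU'))).
  by rewrite -!EFinD !lee_fin !hc//; lra.
Qed.

(** The mass is written as the integral of 1, one of the maps that define the topology, so that it
    is continuous in [lambda]. *)
Definition mass_ball (C : R) : set (Mplus T) :=
  [set lambda | \int[lambda]_t (1 : R) <= C].

Lemma mplus_eval_continuous f : continuous f ->
  continuous (fun lambda : Mplus T => \int[lambda]_t f t).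
Proof.
move=> cf lambda.
have c1 : continuous
    (@mplus_eval R T : initial_topology (@mplus_eval R T) -> _).
  exact: initial_continuous.
have /cvg_sup/(_ (exist _ f cf)) hg : mplus_eval l @[l --> lambda] --> mplus_eval lambda.
  exact: c1.
have H := cvg_comp _ _ (hg _) (@initial_continuous
  {ptws {f : T -> R | continuous f} -> R} R (fun h => h (exist _ f cf))
  (mplus_eval lambda)).

by apply: H; apply: fmap_filter; exact: (@nbhs_filter (Mplus T) lambda).
Qed.

Lemma cvg_mplus (F : set_system (Mplus T)) (FF : Filter F) lambda :
  (forall f, continuous f ->
    (fun l : Mplus T => \int[l]_t f t) @ F --> \int[lambda]_t f t) -> F --> lambda.
Proof.
move=> Fl.
have h : @mplus_eval R T @ F --> (mplus_eval lambda).
  apply/cvg_sup => -[f cf] A [_ [[B oB <-] /= Bmu BA]].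
  have : nbhs (mplus_eval lambda (exist _ f cf)) B by apply: open_nbhs_nbhs; split.
  move=> /(Fl f cf) hB; apply: (@filterS _ F _ _ _ _ hB) => k; exact: BA.
move=> A [_ [[B oB <-] /= Bmu BA]].
have : nbhs (mplus_eval lambda) B by apply: open_nbhs_nbhs; split.
by move=> /h hB; apply: (@filterS _ F _ _ _ _ hB) => k; exact: BA.
Qed.

Lemma mass_ball_closed C : closed (mass_ball C).
Proof.
have c1 : continuous (fun _ : T => 1 : R) by move=> t; exact: cvg_cst.
apply: (@preimage_closed (Mplus T) R (fun l : Mplus T => \int[l]_t (1 : R))
  [set y | y <= C]); last exact: closed_le.
by move=> l _; exact: mplus_eval_continuous.
Qed.

(** The Banach-Alaoglu argument: an ultrafilter of measures converges as functionals in a product of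
    segments, the limit is linear and positive, and Riesz' theorem turns it back into a measure. *)
Lemma mass_ball_compact C : compact (mass_ball C).
Proof.
rewrite compact_ultra => F FU FC.
(* The product is indexed by all functions T -> R; the value 0 off the continuous ones keeps every
   coordinate bounded. *)
pose a lambda f := if `[< continuous f >] then \int[lambda]_t f t else 0.
have /choice[M MP] f : exists M : R, continuous f -> forall t, `|f t| <= M.
  have [cf|cf] := pselect (continuous f); last by exists 0.
  by have [_ [M hM]] := compact_Cb cf; exists M.
pose B f := C * M f.
have aB lambda f : mass_ball C lambda -> `|a lambda f| <= `|B f|.
  move=> lC; rewrite /a; case: asboolP => cf; last by rewrite normr0.
  have i1 : lambda.-integrable [set: borel T] (EFin \o (cst (M f) : borel T -> R)).
    exact: finite_measure_integrable_cst.
  apply: le_trans (Rintegral_norm_le _ i1 (MP f cf)) _.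
    by apply: Cb_measurable; exact: compact_Cb.
  move: lC; rewrite /mass_ball/= !Rintegral_cst// mul1r => lC.
  have M0 : 0 <= M f by exact: le_trans (MP f cf point).
  have l0 : 0 <= fine (lambda setT) by exact: fine_ge0.
  rewrite /B ger0_norm ?mulr_ge0//; last exact: le_trans lC.
  by rewrite mulrC ler_wpM2r.
have := @tychonoff (T -> R) (fun=> R) (fun f => `[- `|B f|, `|B f|]%classic)
  (fun f => @segment_compact R _ _).
rewrite compact_ultra => H.
have [||L [_ FL]] := H (a @ F).
- exact: ultra_fmap.
- have FAA : F (a @^-1` [set f | forall i : T -> R, `[- `|B i|, `|B i|]%classic (f i)]).
    apply: (@filterS _ F _ (mass_ball C)) => //.
    move=> lambda lC f.
    by have := aB lambda f lC; rewrite ler_norml /= in_itv.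
  exact: FAA.
have aL f : continuous f -> (fun l : Mplus T => \int[l]_t f t) @ F --> L f.
  move=> cf; have -> : (fun l : Mplus T => \int[l]_t f t) = a ^~ f.
    by apply/funext => l; rewrite /a; case: asboolP.
  exact: (cvg_comp _ _ FL (@proj_continuous (T -> R) (fun=> R) f L)).
have [lambda lE] : exists lambda : Mplus T,
    forall f, continuous f -> \int[lambda]_t f t = L f.
  apply: riesz_compact.
    move=> k f g cf cg.
    have cfg : continuous (fun x => k * f x + g x).
      by move=> x; apply: cvgD; [apply: cvgM; [exact: cvg_cst|exact: cf]|exact: cg].
    have := aL _ cfg.
    rewrite (_ : (fun l : Mplus T => _) =
      (fun l : Mplus T => k * \int[l]_t f t + \int[l]_t g t)); last first.
      apply/funext => l; rewrite RintegralD ?RintegralZl//; try exact: Mplus_integrable.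
      by have := integrableZl measurableT k (Mplus_integrable l cf).
    move=> /cvg_unique; apply => //.
    by apply: cvgD; [apply: cvgM; [exact: cvg_cst|exact: aL]|exact: aL].
  move=> f cf f0; apply: (cvgr_to_ge (aL f cf)).
  by apply: nearW => l; exact: Rintegral_ge0.
have c1 : continuous (fun _ : T => 1 : R) by move=> t; exact: cvg_cst.
exists lambda; split; last by apply: cvg_mplus => f cf; rewrite lE//; exact: aL.
by rewrite /mass_ball/= lE//; exact: (cvgr_to_le (aL _ c1)).
Qed.

End compact_measures.

Section sequential_continuity.
Context {R : realType} {T : pmetricType R}.

(** Brings continuity of parameter integrals within reach of dominated convergence, which is stated
    for sequences. *)
Lemma continuous_of_sequences (f : T -> R) :
  (forall (u : nat -> T) t, u @ \oo --> t -> f (u n) @[n --> \oo] --> f t) ->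
  continuous f.
Proof.
move=> h t; apply/cvgrPdist_lt => e e0; apply: contrapT => ne.
have /choice[u uP] (n : nat) : exists s, mdist t s < n.+1%:R^-1 /\ ~ `|f t - f s| < e.
  apply: contrapT => nP; apply: ne; apply/nbhs_ballP; exists n.+1%:R^-1 => /=.
    by rewrite invr_gt0.
  move=> s; rewrite ballEmdist/= => ts; apply: contrapT => nf.
  by apply: nP; exists s.
have ut : u @ \oo --> t.
  apply/cvg_ballP => d d0; have := near_infty_natSinv_lt (PosNum d0).
  apply: filterS => n /= nd; rewrite ballEmdist/=.
  by apply: lt_trans nd; exact: (uP n).1.
have /cvgrPdist_lt/(_ _ e0)[n _ /(_ n (leqnn n))] := h u t ut.
exact: (uP n).2.
Qed.

End sequential_continuity.

(** * Discretisation of continuous functions on a compact space *)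

Section compact_discretisation.
Context {R : realType} {T : pmetricType R}.
Hypothesis T_compact : compact [set: T].
Variable x_ : nat -> T.
Hypothesis x_dense : dense_sequence x_.
Implicit Types (f : T -> R) (lambda : Mplus T).
Local Notation piece := (piece (fun _ : T => 0 : R) x_).
Local Notation approx := (approx (fun _ : T => 0 : R) x_).

Let c0 : continuous (fun _ : T => 0 : R).
Proof. by move=> t; exact: cvg_cst. Qed.

Let cpiece n i : continuous (piece n i).
Proof. exact: (Cb_piece x_ c0 n i).1. Qed.

Lemma compact_sum_piece n : exists N, forall t, \sum_(i < N) piece n i t = 1.
Proof.
have [i|t|N NP] := @compact_nat_cover R T
    (fun i => [set t | spread (fun _ : T => 0 : R) x_ i t < n.+1%:R^-1]) T_compact.
- have /continuousP h := spread_continuous (x_ := x_) c0 (i := i).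
  exact: (h [set y | y < n.+1%:R^-1] (@open_lt _ _)).
- by apply: spread_dense => //; rewrite invr_gt0.
- exists N => t; have [i iN /= /ltW ti] := NP t.
  exact: sum_piece_eq1 iN ti.
Qed.

Definition cover_size n := projT1 (cid (compact_sum_piece n)).

Lemma cover_sizeP n t : \sum_(i < cover_size n) piece n i t = 1.
Proof. exact: (projT2 (cid (compact_sum_piece n))). Qed.

Definition discretise n f := approx n (cover_size n) f.

Lemma discretise_cvg f t : continuous f -> discretise n f t @[n --> \oo] --> f t.
Proof.
move=> cf; apply/cvgrPdist_le => e e0.
have := continuous_spread (fun _ : T => 0 : R) t (ltr0Sn _ 1) cf e0; apply: filterS => n hn.
have := @approx_close R T (fun _ : T => 0 : R) x_ n (cover_size n) f t _ (ltW e0) hn.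
by rewrite cover_sizeP mulr1.
Qed.

Lemma discretise_le f n t (M : R) : (forall s, `|f s| <= M) -> `|discretise n f t| <= M.
Proof.
move=> fM; apply: le_trans (ler_norm_sum _ _ _) _.
apply: (@le_trans _ _ (\sum_(i < cover_size n) M * piece n i t)).
  apply: ler_sum => i _; rewrite normrM (ger0_norm (piece_ge0 _ _ _ _ _)).
  by rewrite ler_wpM2r// piece_ge0.
by rewrite -mulr_sumr cover_sizeP mulr1.
Qed.

(** The set A n asks for the oscillation bound around every s close to t, so that the interiors of
    the A n cover T. A finite subcover yields one index N, which works everywhere because a finer
    partition only asks for less. *)
Lemma uniformly_discretise f (e : R) : continuous f -> 0 < e ->
  exists n, forall t, `|f t - discretise n f t| <= e.
Proof.
move=> cf e0.
pose A n := [set t | forall s s', mdist t s < n.+1%:R^-1 ->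
   mdist s s' < 2 * n.+1%:R^-1 -> `|f s - f s'| <= e].
have e2 : 0 < e / 2 by rewrite divr_gt0.
have [n|t|N NP] := @compact_nat_cover R T (fun n => (A n)^°) T_compact.
- exact: open_interior.
- have /nbhs_ballP[d /= d0 dP] : nbhs t [set s | `|f t - f s| <= e / 2].
    by move/cvgrPdist_le : (cf t); exact.
  have d4 : 0 < d / 4 by rewrite divr_gt0.
  have [n _ /(_ n (leqnn n)) /= nd] := near_infty_natSinv_lt (PosNum d4).
  exists n; apply/nbhs_ballP; exists n.+1%:R^-1 => /=; first by rewrite invr_gt0.
  move=> r; rewrite ballEmdist/= => tr s s' rs ss'.
  have h1 := metric_triangle t r s; have h2 := metric_triangle t s s'.
  have h3 : `|f t - f s| <= e / 2.
    apply: dP; rewrite ballEmdist/=; apply: le_lt_trans h1 _.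
    by move: nd tr rs; set u := _^-1; lra.
  have h4 : `|f t - f s'| <= e / 2.
    apply: dP; rewrite ballEmdist/=; apply: le_lt_trans h2 _.
    by move: nd tr rs ss' h1; set u := _^-1; lra.
  rewrite (_ : f s - f s' = (f t - f s') - (f t - f s)); last by ring.
  by apply: le_trans (ler_normB _ _) _; lra.
- exists N => t; have [n nN /interior_subset tA] := NP t.
  rewrite -[f t]mulr1 -(cover_sizeP N t); apply: approx_close; first exact: ltW.
  have NnV : N.+1%:R^-1 <= n.+1%:R^-1 :> R.
    by rewrite lef_pV2 ?posrE// ler_nat ltnW.
  move=> s; rewrite subrr normr0 addr0 => ts; apply: tA.
    by rewrite mdistxx invr_gt0.
  by apply: lt_le_trans ts _; rewrite ler_pM2l.
Qed.

Lemma Rintegral_discretise lambda n f : \int[lambda]_t discretise n f t =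
  \sum_(i < cover_size n) f (x_ i) * \int[lambda]_t piece n i t.
Proof.
rewrite /discretise /approx (@Rintegral_Cb_sum R T lambda (cover_size n)
  (fun i t => f (x_ i) * piece n i t)); last by move=> i; apply: CbZ; exact: Cb_piece.
by apply: eq_bigr => i _; rewrite RintegralZl//; apply: Cb_integrable; exact: Cb_piece.
Qed.

Lemma Rintegral_discretise_cvg lambda f : continuous f ->
  \int[lambda]_t discretise n f t @[n --> \oo] --> \int[lambda]_t f t.
Proof.
move=> cf; have [_ [M fM]] := compact_Cb T_compact cf.
apply: (@Rintegral_cvg _ (borel T) R lambda (fun n => discretise n f) f (cst M)) => //.
- by move=> n; apply: (@Cb_measurable R T); exact: Cb_approx.
- exact: finite_measure_integrable_cst.
- by move=> n t; exact: discretise_le.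
- by move=> t; exact: discretise_cvg.
Qed.

(** A cluster point of a sequence need not be a subsequential limit in a general topology. Here
    countably many pieces suffice as tests, since every continuous function is uniformly close to a
    combination of them and the masses are bounded. *)
Lemma Mplus_cluster_extraction (lambda_ : nat -> Mplus T) lambda (C : R) :
  (\forall k \near \oo, mass_ball C (lambda_ k)) -> cluster (lambda_ @ \oo) lambda ->
  exists2 l : nat -> nat, {homo l : i j / (i < j)%N} &
    forall f, continuous f ->
      \int[lambda_ (l k)]_t f t @[k --> \oo] --> \int[lambda]_t f t.
Proof.
move=> mC lcl.
pose p (j : nat) := let ni := odflt (0%N, 0%N) (@choice.unpickle (nat * nat)%type j) in
  piece ni.1 ni.2.
have near_p n : nbhs lambda [set l : Mplus T | forall j : 'I_n,
    `|\int[lambda]_t p j t - \int[l]_t p j t| < n.+1%:R^-1].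
  apply: (@filter_forall _ 'I_n (fun j (l : Mplus T) =>
    `|\int[lambda]_t p j t - \int[l]_t p j t| < n.+1%:R^-1) (nbhs lambda) _) => j.
  have pc : continuous (p j) by exact: cpiece.
  have /cvgrPdist_lt := @mplus_eval_continuous R T _ pc lambda.
  by apply; rewrite invr_gt0.
have [l hl lP] := increasing_choice (fun n => cluster_sequence lcl (near_p n)).
exists l => // f cf.
have pieceP n i : \int[lambda_ (l k)]_t piece n i t @[k --> \oo] -->
    \int[lambda]_t piece n i t.
  apply/cvgrPdist_lt => e e0; pose j := @choice.pickle (nat * nat)%type (n, i).
  near=> k.
  have jk : (j < k)%N by near: k; exact: nbhs_infty_gt.
  have := lP k (Ordinal jk); rewrite /p /= /j choice.pickleK/= => /lt_trans; apply.
  by near: k; exact: near_infty_natSinv_lt (PosNum e0).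
have gP n : \int[lambda_ (l k)]_t discretise n f t @[k --> \oo] -->
    \int[lambda]_t discretise n f t.
  rewrite Rintegral_discretise (_ : (fun k => _) = (fun k =>
    \sum_(i < cover_size n) f (x_ i) * \int[lambda_ (l k)]_t piece n i t)).
    apply: (@cvg_sum_ord R (cover_size n) (fun i k =>
      f (x_ i) * \int[lambda_ (l k)]_t piece n i t)
      (fun i => f (x_ i) * \int[lambda]_t piece n i t)) => i.
    by apply: cvgM; [exact: cvg_cst|exact: pieceP].
  by apply/funext => k; exact: Rintegral_discretise.
apply/cvgrPdist_le => e e0.
(* M bounds both the mass of the limit and, eventually, the masses of the sequence; the 1 makes it
   positive. *)
pose M := 1 + `|C| + \int[lambda]_t (1 : R).
have l0 (l' : Mplus T) : 0 <= \int[l']_t (1 : R) by exact: Rintegral_ge0.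
have M0 : 0 < M by rewrite /M -addrA ltr_pwDl// addr_ge0.
have d0 : 0 < e / (3 * M) by rewrite divr_gt0// mulr_gt0.
have [n nP] := uniformly_discretise cf d0.
have gC : Cb (discretise n f) by exact: Cb_approx.
have dist (l' : Mplus T) : `|\int[l']_t f t - \int[l']_t discretise n f t| <=
    e / (3 * M) * \int[l']_t (1 : R).
  have iC : l'.-integrable [set: borel T] (EFin \o (cst (e / (3 * M)) : borel T -> R)).
    exact: finite_measure_integrable_cst.
  have dC : Cb (fun t => f t - discretise n f t) by exact: CbB (compact_Cb T_compact cf) gC.
  rewrite -RintegralB//; [|exact: Mplus_integrable|exact: Cb_integrable].
  have := Rintegral_norm_le (Cb_measurable dC) iC nP.
  by rewrite !Rintegral_cst// mul1r.
have e3 : 0 < e / 3 by rewrite divr_gt0.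
have bound (l' : Mplus T) : \int[l']_t (1 : R) <= M ->
    `|\int[l']_t f t - \int[l']_t discretise n f t| <= e / 3.
  move=> l'M; apply: le_trans (dist l') _.
  apply: le_trans (ler_wpM2l (ltW d0) l'M) _.
  by rewrite (_ : e / (3 * M) * M = e / 3)//; field; rewrite gt_eqF.
have /cvgrPdist_le/(_ _ e3) G := gP n.
have mC' := increasing_cvg hl mC.
apply: filterS2 G mC' => k h1; rewrite /mass_ball/= => h2.
have := bound lambda; have := bound (lambda_ (l k)).
have -> : \int[lambda]_t (1 : R) <= M by rewrite /M lerDr addr_ge0.
have -> : \int[lambda_ (l k)]_t (1 : R) <= M.
  apply: le_trans h2 _; apply: le_trans (ler_norm _) _.
  by rewrite /M addrAC lerDr addr_ge0.
move=> /(_ isT) + /(_ isT); move: h1.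
set a := \int[lambda]_t f t; set b := \int[lambda]_t discretise n f t.
set c := \int[lambda_ (l k)]_t f t; set d := \int[lambda_ (l k)]_t discretise n f t.
move=> h1 h3 h4; rewrite (_ : a - c = (a - b) + ((b - d) - (c - d))); last by ring.
apply: le_trans (ler_normD _ _) _.
have := ler_normB (b - d) (c - d); lra.
Unshelve. all: by end_near. Qed.

End compact_discretisation.

(** * Integrals depending on a parameter and their exchange *)

Section fubini_continuous.
Context {R : realType} {T : pmetricType R}.
Hypothesis T_compact : compact [set: T].
Context d (X : measurableType d).
Variables (lambda : Mplus T) (f : T -> X -> R) (g : X -> R).
Hypothesis f_measurable : forall t, measurable_fun setT (f t).
Hypothesis f_continuous : forall x, continuous (f ^~ x).
Hypothesis f_le : forall t x, `|f t x| <= g x.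

Let disc_cvg x_ (x_dense : dense_sequence x_) x :
  \int[lambda]_t discretise T_compact x_dense n (f ^~ x) t @[n --> \oo] -->
  \int[lambda]_t f t x.
Proof. by apply: Rintegral_discretise_cvg; exact: f_continuous. Qed.

(** f is only measurable in x and continuous in t; discretising in t presents the integral as a
    pointwise limit of finite combinations of the functions f (x_ i). *)
Lemma measurable_Rintegral_continuous :
  measurable_fun setT (fun x => \int[lambda]_t f t x).
Proof.
have [x_ x_dense] := separable_dense_sequence (compact_separable T_compact).
apply: (measurable_fun_cvg (h := fun n x =>
  \int[lambda]_t discretise T_compact x_dense n (f ^~ x) t)) => [n|x _]; last first.
  exact: disc_cvg.
under eq_fun do rewrite Rintegral_discretise.
by apply: measurable_sum => i; apply: measurable_funM.
Qed.

Lemma Rintegral_continuous_le x : `|\int[lambda]_t f t x| <= fine (lambda setT) * g x.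
Proof.
have i1 : lambda.-integrable [set: borel T] (EFin \o (cst (g x) : borel T -> R)).
  exact: finite_measure_integrable_cst.
have := Rintegral_norm_le (f := f ^~ x : borel T -> R) _ i1 (fun t => f_le t x).
rewrite Rintegral_cst// mulrC; apply.
by apply: (@Cb_measurable R T); apply: compact_Cb => //; exact: f_continuous.
Qed.

Variable mu : {measure set X -> \bar R}.
Hypothesis g_integrable : mu.-integrable setT (EFin \o g).

Let f_integrable t : mu.-integrable setT (EFin \o f t).
Proof. exact: (integrable_dominated (f_measurable t) g_integrable (f_le t)). Qed.

Lemma continuous_Rintegral_parameter : continuous (fun t => \int[mu]_x f t x).
Proof.
apply: continuous_of_sequences => u t ut.
apply: (@Rintegral_cvg _ X R mu (fun n => f (u n)) (f t) g) => //.
by move=> x; exact: (cvg_comp _ _ ut (@f_continuous x t)).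
Qed.

(** For the discretised integrand the exchange is linearity over a finite sum; dominated convergence
    on both sides gives the general case, with separate regularity of f in its two variables. *)
Lemma Rintegral_exchange : \int[mu]_x (\int[lambda]_t f t x) =
  \int[lambda]_t (\int[mu]_x f t x).
Proof.
have [x_ x_dense] := separable_dense_sequence (compact_separable T_compact).
have h1 := Rintegral_discretise_cvg T_compact x_dense (lambda := lambda)
  continuous_Rintegral_parameter.
have h2 : \int[mu]_x (\int[lambda]_t discretise T_compact x_dense n (f ^~ x) t)
    @[n --> \oo] --> \int[mu]_x (\int[lambda]_t f t x).
  apply: (@Rintegral_cvg _ X R mu _ _ (fun x => fine (lambda setT) * g x)).
  - move=> n; under eq_fun do rewrite Rintegral_discretise.
    by apply: measurable_sum => i; apply: measurable_funM.
  - by have := integrableZl measurableT (fine (lambda setT)) g_integrable.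
  - move=> n x.
    have i1 : lambda.-integrable [set: borel T] (EFin \o (cst (g x) : borel T -> R)).
      exact: finite_measure_integrable_cst.
    have := Rintegral_norm_le (f := discretise T_compact x_dense n (f ^~ x) : borel T -> R) _ i1
      (fun t => discretise_le T_compact x_dense n t (fun s => f_le s x)).
    rewrite Rintegral_cst// mulrC; apply.
    by apply: (@Cb_measurable R T); apply: Cb_approx => t; exact: cvg_cst.
  - by move=> x; exact: disc_cvg.
apply: (cvg_unique _ h2) => //.
rewrite (_ : (fun n => _) = (fun n => \int[lambda]_t discretise T_compact x_dense n
  (fun t => \int[mu]_x f t x) t)) //.
apply/funext => n; rewrite Rintegral_discretise.
under eq_Rintegral do rewrite Rintegral_discretise.
set a := fun i => \int[lambda]_t piece (fun=> 0) x_ n i t.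
rewrite (@Rintegral_sum_ord _ X R mu _ (fun i x => f (x_ i) x * a i)).
  by apply: eq_bigr => i _; rewrite RintegralZr.
by move=> i; have := integrableZr measurableT (a i) (f_integrable (x_ i)).
Qed.

End fubini_continuous.

(** * Hahn-Banach *)

Section hahn_banach.
Context {R : realType} {T : Type}.
Variable C : set (T -> R).
Hypothesis C_linear : forall (a : R) f g, C f -> C g -> C (fun t => a * f t + g t).

Definition sublinear_on (q : (T -> R) -> R) :=
  (forall f g, C f -> C g -> q (fun t => f t + g t) <= q f + q g) /\
  (forall (a : R) f, 0 < a -> C f -> q (fun t => a * f t) = a * q f).

Variable p : (T -> R) -> R.
Hypothesis p_sublinear : sublinear_on p.
Hypothesis C0 : C (fun=> 0).

Let C_D f g : C f -> C g -> C (fun t => f t + g t).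
Proof.
move=> Cf Cg; have := C_linear 1 Cf Cg.
by congr C; apply/funext => t; rewrite mul1r.
Qed.

Let C_Z (a : R) f : C f -> C (fun t => a * f t).
Proof.
move=> Cf; have := C_linear a Cf C0.
by congr C; apply/funext => t; rewrite addr0.
Qed.

Let sublinear0 q : sublinear_on q -> q (fun=> 0) = 0.
Proof.
move=> [_ h]; have := h 2 _ _ C0; under eq_fun do rewrite mulr0.
by move=> /(_ ltac:(by rewrite ltr0n)); lra.
Qed.

Let sublinear_lower q f : sublinear_on q -> C f -> - q (fun t => -1 * f t) <= q f.
Proof.
move=> sq Cf; have := sq.1 _ _ Cf (C_Z (-1) Cf).
rewrite (_ : (fun t => f t + -1 * f t) = (fun=> 0)) ?sublinear0//; first by lra.
by apply/funext => t; ring.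
Qed.

(** The value 0 imposed off C makes minorants equal as soon as they agree on C, as the antisymmetry
    in Zorn's lemma requires. *)
Let minorant := {q : (T -> R) -> R |
  [/\ sublinear_on q, forall f, C f -> q f <= p f & forall f, ~ C f -> q f = 0]}.

(** The order is reversed: the maximal elements given by Zorn's lemma are the minimal sublinear
    functionals. *)
Let below (q1 q2 : minorant) : bool := `[< forall f, sval q2 f <= sval q1 f >].

Let minorant_eq (q1 q2 : minorant) : (forall f, sval q1 f = sval q2 f) -> q1 = q2.
Proof.
case: q1 q2 => [q1 h1] [q2 h2] /= h; have q12 : q1 = q2 by exact/funext.
by subst q2; congr exist; exact: Prop_irrelevance.
Qed.

(** A lower bound common to all minorants, which makes the infimum over a chain finite. *)
Let minorant_lb (q : minorant) f : C f -> - p (fun t => -1 * f t) <= sval q f.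
Proof.
case: q => q [sq qp q0] /= Cf; apply: le_trans (sublinear_lower sq Cf).
by rewrite lerN2 qp//; exact: C_Z.
Qed.

Let p_minorant : minorant.
Proof.
exists (fun f => if `[< C f >] then p f else 0); split.
- split=> [f g Cf Cg|a f a0 Cf].
    by rewrite !asboolT//; [exact: p_sublinear.1|exact: C_D].
  by rewrite !asboolT//; [exact: p_sublinear.2|exact: C_Z].
- by move=> f Cf; rewrite asboolT.
- by move=> f Cf; rewrite asboolF.
Defined.

(** The pointwise infimum of a chain is subadditive because of totality: of two functionals nearly
    optimal at f and at g, the smaller is nearly optimal at both. For the empty chain p itself
    serves. *)
Let chain_lower_bound (A : set minorant) : total_on A below ->
  exists t, forall s, A s -> below s t.
Proof.
move=> tA; have [[q0 Aq0]|nA] := pselect (exists q, A q); last first.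
  by exists p_minorant => s As; exfalso; apply: nA; exists s.
pose S f := [set sval q f | q in A].
have Slb f : C f -> has_lbound (S f).
  by move=> Cf; exists (- p (fun t => -1 * f t)) => _ [q _ <-]; exact: minorant_lb.
have Sne f : S f !=set0 by exists (sval q0 f), q0.
pose m f := if `[< C f >] then inf (S f) else 0.
have mle f q : C f -> A q -> m f <= sval q f.
  by move=> Cf Aq; rewrite /m asboolT//; apply: ge_inf; [exact: Slb|exists q].
have mex f (e : R) : C f -> 0 < e -> exists2 q, A q & sval q f < m f + e.
  move=> Cf e0; have [|_ [q Aq <-] qe] := @inf_adherent _ (S f) e e0.
    by split; [exact: Sne|exact: Slb].
  by exists q => //; rewrite /m asboolT.
have mZ (a : R) f : 0 < a -> C f -> m (fun t => a * f t) <= a * m f.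
  move=> a0 Cf; apply/ler_addgt0Pr => e e0.
  have [|q Aq qe] := mex f (e / a) Cf; first by rewrite divr_gt0.
  apply: le_trans (mle _ q (C_Z a Cf) Aq) _.
  case: q qe {Aq} => q [[_ sq] _ _] /= qe; rewrite sq//.
  have := ler_wpM2l (ltW a0) (ltW qe); rewrite mulrDr [a * (e / a)]mulrC divfK//.
  by rewrite gt_eqF.
have mP : [/\ sublinear_on m, forall f, C f -> m f <= p f & forall f, ~ C f -> m f = 0].
  split.
  - split=> [f g Cf Cg|a f a0 Cf].
      apply/ler_addgt0Pr => e e0; have e2 : 0 < e / 2 by rewrite divr_gt0.
      have [q1 A1 h1] := mex f _ Cf e2; have [q2 A2 h2] := mex g _ Cg e2.
      have key (q : minorant) : A q -> sval q f <= sval q1 f ->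
          sval q g <= sval q2 g -> m (fun t => f t + g t) <= m f + m g + e.
        move=> Aq q1f q2g; apply: le_trans (mle _ q (C_D Cf Cg) Aq) _.
        move: q1f q2g; case: q {Aq} => q [[sq _] _ _] /= q1f q2g.
        by have := sq f g Cf Cg; lra.
      have [/asboolP h|/asboolP h] := tA _ _ A1 A2.
        by apply: (key q2).
      by apply: (key q1).
    apply/eqP; rewrite eq_le mZ//=.
    have := @mZ a^-1 (fun t => a * f t) _ (C_Z a Cf); rewrite invr_gt0 => /(_ a0).
    rewrite (_ : (fun t => a^-1 * (a * f t)) = f); last first.
      by apply/funext => t; rewrite mulrA mulVf ?mul1r// gt_eqF.
    by rewrite ler_pdivlMl.
  - move=> f Cf; apply: le_trans (mle _ q0 Cf Aq0) _.
    by case: q0 {Aq0 Sne} => q [_ + _] /=; apply.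
  - by move=> f Cf; rewrite /m asboolF.
exists (exist _ m mP) => s As; apply/asboolP => f /=.
have [Cf|Cf] := pselect (C f); first exact: mle.
by rewrite /m asboolF//; case: s {As} => s [_ _ s0] /=; rewrite s0.
Qed.

(* A minimal sublinear functional q below p is linear: for a fixed h, the
   functional f |-> inf_{s >= 0} q (f + s h) - s q h is sublinear and below q. *)
Let minimal_superadditive (q : minorant) : (forall s, below q s -> s = q) ->
  forall f h, C f -> C h -> sval q f + sval q h <= sval q (fun t => f t + h t).
Proof.
move=> qmin f h Cf Ch; case: q qmin => q [sq qp q0] qmin /=.
pose S f := [set q (fun t => s * h t + f t) - s * q h | s in [set s : R | 0 <= s]].
have qZ0 (s : R) : 0 <= s -> q (fun t => s * h t) = s * q h.
  rewrite le_eqVlt => /predU1P[<-|s0]; last exact: sq.2.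
  by under eq_fun do rewrite mul0r; rewrite sublinear0// mul0r.
have Slb g : C g -> has_lbound (S g).
  move=> Cg; exists (- q (fun t => -1 * g t)) => _ [s s0 <-].
  have := sq.1 _ _ (C_linear s Ch Cg) (C_Z (-1) Cg).
  rewrite (_ : (fun t => _ + -1 * g t) = (fun t => s * h t)); last first.
    by apply/funext => t; ring.
  by rewrite qZ0//; lra.
have Sne g : S g !=set0.
  by exists (q (fun t => 0 * h t + g t) - 0 * q h); exists 0 => //=.
pose m g := if `[< C g >] then inf (S g) else 0.
have mle g (s : R) : C g -> 0 <= s -> m g <= q (fun t => s * h t + g t) - s * q h.
  by move=> Cg s0; rewrite /m asboolT//; apply: ge_inf; [exact: Slb|exists s].
have mex g (e : R) : C g -> 0 < e ->
    exists2 s, 0 <= s & q (fun t => s * h t + g t) - s * q h < m g + e.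
  move=> Cg e0; have [|_ [s s0 <-] qe] := @inf_adherent _ (S g) e e0.
    by split; [exact: Sne|exact: Slb].
  by exists s => //; rewrite /m asboolT.
have mq g : C g -> m g <= q g.
  move=> Cg; have := mle g 0 Cg (lexx _); rewrite mul0r subr0.
  by under eq_fun do rewrite mul0r add0r.
have mZ (a : R) g : 0 < a -> C g -> m (fun t => a * g t) <= a * m g.
  move=> a0 Cg; apply/ler_addgt0Pr => e e0.
  have [|s s0 qe] := mex g (e / a) Cg; first by rewrite divr_gt0.
  have as0 : 0 <= a * s by rewrite mulr_ge0// ltW.
  apply: le_trans (mle _ _ (C_Z a Cg) as0) _.
  rewrite (_ : (fun t => _ + _) = (fun t => a * (s * h t + g t))); last first.
    by apply/funext => t; ring.
  rewrite sq.2//; last exact: C_linear.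
  have := ler_wpM2l (ltW a0) (ltW qe).
  rewrite [a * (m g + _)]mulrDr [a * (e / a)]mulrC divfK ?gt_eqF//.
  by rewrite mulrBr mulrA.
have mP : [/\ sublinear_on m, forall f, C f -> m f <= p f & forall f, ~ C f -> m f = 0].
  split.
  - split=> [g k Cg Ck|a g a0 Cg].
      apply/ler_addgt0Pr => e e0; have e2 : 0 < e / 2 by rewrite divr_gt0.
      have [s s0 hs] := mex g _ Cg e2; have [u u0 hu] := mex k _ Ck e2.
      have su : 0 <= s + u by rewrite addr_ge0.
      apply: le_trans (mle _ _ (C_D Cg Ck) su) _.
      have := sq.1 _ _ (C_linear s Ch Cg) (C_linear u Ch Ck).
      rewrite (_ : (fun t => s * h t + g t + (u * h t + k t)) =
        (fun t => (s + u) * h t + (g t + k t))); last by apply/funext => t; ring.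
      by rewrite [(s + u) * q h]mulrDl; lra.
    apply/eqP; rewrite eq_le mZ//=.
    have := @mZ a^-1 (fun t => a * g t) _ (C_Z a Cg); rewrite invr_gt0 => /(_ a0).
    rewrite (_ : (fun t => a^-1 * (a * g t)) = g); last first.
      by apply/funext => t; rewrite mulrA mulVf ?mul1r// gt_eqF.
    by rewrite ler_pdivlMl.
  - by move=> g Cg; exact: le_trans (mq g Cg) (qp g Cg).
  - by move=> g Cg; rewrite /m asboolF.
have mq' : below (exist _ q (And3 sq qp q0)) (exist _ m mP).
  apply/asboolP => g /=.
  have [Cg|Cg] := pselect (C g); first exact: mq.
  by rewrite /m asboolF// q0.
have /= mqf := congr1 (fun s : minorant => sval s f) (qmin _ mq').
have := mle f 1 Cf ler01; rewrite mqf mul1r.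
rewrite (_ : (fun t => 1 * h t + f t) = (fun t => f t + h t)); first by lra.
by apply/funext => t; ring.
Qed.

Theorem hahn_banach : exists l : (T -> R) -> R,
  (forall (a : R) f g, C f -> C g -> l (fun t => a * f t + g t) = a * l f + l g) /\
  (forall f, C f -> l f <= p f).
Proof.
have [q qmin] : exists q : minorant, forall s, below q s -> s = q.
  apply: Zorn => //.
  - by move=> q; apply/asboolP => f.
  - move=> q1 q2 q3 /asboolP h1 /asboolP h2; apply/asboolP => f.
    exact: le_trans (h2 f) (h1 f).
  - move=> q1 q2 /asboolP h1 /asboolP h2; apply: minorant_eq => f.
    by apply/eqP; rewrite eq_le h1 h2.
have super := minimal_superadditive qmin.
case: q qmin super => q [sq qp q0] _ /= super; exists q; split => // a f g Cf Cg.
have qD f' g' : C f' -> C g' -> q (fun t => f' t + g' t) = q f' + q g'.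
  by move=> Cf' Cg'; apply/eqP; rewrite eq_le sq.1//= super.
have qN f' : C f' -> q (fun t => -1 * f' t) = - q f'.
  move=> Cf'; have := qD _ _ Cf' (C_Z (-1) Cf').
  rewrite (_ : (fun t => f' t + -1 * f' t) = (fun=> 0)) ?sublinear0//; first by lra.
  by apply/funext => t; ring.
rewrite (qD (fun t => a * f t) g)//; last exact: C_Z.
congr (_ + _); have [a0|a0|->] := ltgtP a 0.
- rewrite (_ : (fun t => a * f t) = (fun t => -1 * (- a * f t))); last first.
    by apply/funext => t; ring.
  rewrite qN; last exact: C_Z.
  by rewrite sq.2// ?oppr_gt0//; ring.
- exact: sq.2.
- by under eq_fun do rewrite mul0r; rewrite sublinear0// mul0r.
Qed.

End hahn_banach.

(** * Relative entropy and Gibbs' inequality *)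

Section entropy_function.
Context {R : realType}.
Implicit Types g v : R.

(** The integrand of the entropy, made nonnegative by the terms - s + 1, whose integral vanishes
    when s is the density of a probability with respect to a probability. *)
Definition xi (s : R) : R := s * ln s - s + 1.

Lemma xi_measurable : measurable_fun setT xi.
Proof.
apply: measurable_funD => //; apply: measurable_funB => //.
by apply: measurable_funM => //; exact: measurable_ln.
Qed.

(* Young's inequality for the conjugate pair xi, v |-> e^v - 1. *)
Lemma entropy_young g v : 0 <= g -> 0 <= g * ln g + g * v - g + expR (- v).
Proof.
rewrite le_eqVlt => /predU1P[<-|g0]; first by rewrite !mul0r !subr0 !add0r expR_ge0.
have gE : g = expR (ln g) by rewrite lnK.
have -> : expR (- v) = g * expR (- (ln g + v)).
  by rewrite {1}gE -expRD; congr expR; ring.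
rewrite (_ : _ + _ = g * (expR (- (ln g + v)) - (1 + - (ln g + v)))); last by ring.
by rewrite mulr_ge0 ?subr_ge0 ?expR_ge1Dx// ltW.
Qed.

Lemma entropy_young_eq0 g v : 0 <= g ->
  g * ln g + g * v - g + expR (- v) = 0 -> g = expR (- v).
Proof.
rewrite le_eqVlt => /predU1P[<-|g0].
  by rewrite !mul0r !subr0 !add0r => h; have := expR_gt0 (- v); rewrite h ltxx.
have gE : g = expR (ln g) by rewrite lnK.
have eE : expR (- v) = g * expR (- (ln g + v)).
  by rewrite {1}gE -expRD; congr expR; ring.
have [h _|h] := eqVneq (- (ln g + v)) 0; first by rewrite eE h expR0 mulr1.
have := expR_gt1Dx h; rewrite -subr_gt0 => /(mulr_gt0 g0) h0 h'; exfalso.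
suff h1 : g * (expR (- (ln g + v)) - (1 + - (ln g + v))) = 0 by rewrite h1 ltxx in h0.
by rewrite -h' eE; ring.
Qed.

Lemma xi_ge0 s : 0 <= s -> 0 <= xi s.
Proof. by move=> s0; have := entropy_young 0 s0; rewrite mulr0 addr0 oppr0 expR0. Qed.

(** The tangent inequality of the convex function xi, of derivative ln: it is Young's inequality at
    v = - ln a. *)
Lemma xi_bregman a b : 0 < a -> 0 <= b -> xi a + ln a * (b - a) <= xi b.
Proof.
move=> a0 b0; have := entropy_young (- ln a) b0; rewrite opprK lnK// /xi.
by set la := ln a; set lb := ln b; lra.
Qed.

Lemma xi_bregman_eq a b : 0 < a -> 0 <= b -> xi b = xi a + ln a * (b - a) -> b = a.
Proof.
move=> a0 b0 h; have := @entropy_young_eq0 b (- ln a) b0; rewrite opprK lnK//.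
by apply; move: h; rewrite /xi; set la := ln a; set lb := ln b; lra.
Qed.

Lemma xi_convex e a b : 0 <= e <= 1 -> 0 <= a -> 0 <= b ->
  xi ((1 - e) * a + e * b) <= (1 - e) * xi a + e * xi b.
Proof.
move=> /andP[e0 e1] a0 b0; set m := (1 - e) * a + e * b.
have e1' : 0 <= 1 - e by lra.
have : 0 <= m by rewrite /m addr_ge0// mulr_ge0.
rewrite le_eqVlt => /predU1P[m0|m0].
  (* xi has no finite slope at 0, so the case m = 0 is separate; both weighted points then
     vanish. *)
  have h1 : (1 - e) * a = 0.
    by apply/eqP; rewrite eq_le mulr_ge0// andbT m0 /m lerDl mulr_ge0.
  have h2 : e * b = 0 by move: m0; rewrite /m h1 add0r.
  have -> : (1 - e) * xi a = (1 - e).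
    by rewrite /xi mulrDr mulrBr mulrA h1 mul0r subrr add0r mulr1.
  have -> : e * xi b = e by rewrite /xi mulrDr mulrBr mulrA h2 mul0r subrr add0r mulr1.
  by rewrite -m0 /xi mul0r; lra.
have ha := ler_wpM2l e1' (xi_bregman m0 a0).
have hb := ler_wpM2l e0 (xi_bregman m0 b0).
apply: le_trans (lerD ha hb); rewrite le_eqVlt; apply/orP; left; apply/eqP.
by rewrite /m; ring.
Qed.

Lemma xi_midpoint_eq a b : 0 <= a -> 0 <= b ->
  xi (2^-1 * a + 2^-1 * b) = 2^-1 * xi a + 2^-1 * xi b -> a = b.
Proof.
move=> a0 b0; set m := 2^-1 * a + 2^-1 * b => h.
have : 0 <= m by rewrite /m addr_ge0// mulr_ge0.
rewrite le_eqVlt => /predU1P[m0|m0].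
  by move: m0; rewrite /m; lra.
have ha := xi_bregman m0 a0; have hb := xi_bregman m0 b0.
have := @xi_bregman_eq m a m0 a0; have -> : xi a = xi m + ln m * (a - m).
  have : ln m * (a - m) + ln m * (b - m) = 0.
    by rewrite -mulrDr (_ : a - m + (b - m) = 0) ?mulr0// /m; lra.
  move: ha hb h; set u := ln m * (a - m); set w := ln m * (b - m).
  move: (xi a) (xi b) (xi m) u w => xa xb xm u w ha hb h uw.
  by apply/eqP; rewrite eq_le; apply/andP; split; lra.
by move=> /(_ erefl); rewrite /m; lra.
Qed.

End entropy_function.

Section relative_entropy_density.
Context {R : realType} {E : pmetricType R}.
Implicit Types mu nu : probability (borel E) R.

Lemma has_density_mass mu nu (g : E -> R) : has_density mu nu g ->
  \int[nu]_x g x = 1.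
Proof.
move=> dg; have [mg g0 gE] := dg.
have := gE setT measurableT; rewrite /Rintegral => <-.
by rewrite [X in fine X](_ : _ = 1%E)//; exact: probability_setT.
Qed.

(** With h = g ln g, the negative part of h is at most 1, so its integral is finite and may be
    subtracted. The equality of integrals then follows by integrating xi g + h^- + g = h^+ + 1, all
    of whose terms are nonnegative. *)
Lemma rel_entropyE mu nu (g : E -> R) : has_density mu nu g ->
  rel_entropy mu nu = (\int[nu]_x (xi (g x))%:E)%E.
Proof.
move=> dg; have munu := has_density_dominates dg; have [mg g0 gE] := dg.
rewrite /rel_entropy asboolT//.
have mlng : measurable_fun [set: borel E] (fun x => ln (g x)).
  by apply: (measurableT_comp _ mg); exact: measurable_ln.
have densE : {ae mu, forall x, density mu nu x = (g x)%:E}.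
  have [N [mN N0 hN]] := has_density_RN dg; exists N; split => //.
  by move/null_content_dominatesP : munu; apply.
(* The density is positive almost everywhere for mu itself, which is where [lne] agrees with the
   real logarithm. *)
have gpos : {ae mu, forall x, (0 < g x)}.
  exists [set x | g x = 0]; split.
  - by rewrite -[X in measurable X]setTI; apply: (mg measurableT [set 0]); exact: measurable_set1.
  - rewrite gE; last first.
      by rewrite -[X in measurable X]setTI; apply: (mg measurableT [set 0]); exact: measurable_set1.
    by apply: integral0_eq => x /= ->.
  - move=> x /= /negP; rewrite -leNgt => h; apply/eqP.
    by rewrite eq_le h g0.
transitivity (\int[mu]_x (ln (g x))%:E)%E.
  apply: ae_eq_integral => //.
  - have dfin x : density mu nu x = (fine (density mu nu x))%:E.
      by rewrite fineK//; exact: Radon_Nikodym_fin_num.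
    rewrite (_ : (fun x => lne _) = (fun x => if fine (density mu nu x) <= 0 then -oo%E
        else (ln (fine (density mu nu x)))%:E)); last first.
      by apply/funext => x; rewrite {1}dfin.
    have md : measurable_fun [set: borel E] (fun x => fine (density mu nu x)).
      apply: measurableT_comp => //; apply: measurable_int.
      exact: Radon_Nikodym_integrable.
    apply: measurable_fun_ifT => //.
    + by apply: measurable_fun_ler.
    + apply/measurable_EFinP; apply: (measurableT_comp _ md); exact: measurable_ln.
  - exact/measurable_EFinP.
  - apply: filterS2 densE gpos => x h1 h2 _.
    by rewrite h1 lne_EFin.
rewrite (integral_density dg); last exact/measurable_EFinP.
pose h (x : borel E) := (ln (g x) * g x)%:E.
have mh : measurable_fun setT h by apply/measurable_EFinP; exact: measurable_funM.
have -> : (\int[nu]_x ((ln (g x))%:E * (g x)%:E) = \int[nu]_x h x)%E.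
  by apply: eq_integral => x _.
rewrite integralE.
have hneg x : (h^\- x <= 1)%E.
  rewrite funenegE /h -EFinN ge_max lee_fin; apply/andP; split; last by rewrite lee01.
  have := xi_ge0 (g0 x); have := g0 x; rewrite /xi; set u := ln _; lra.
have i1 : (\int[nu]_x 1 = 1)%E.
  by rewrite integral_cst// mul1e; exact: probability_setT.
have negfin : (\int[nu]_x h^\- x)%E \is a fin_num.
  rewrite ge0_fin_numE; last by apply: integral_ge0.
  apply: (@le_lt_trans _ _ 1%E); last exact: ltry.
  rewrite -[leRHS]i1; apply: ge0_le_integral => //.
  exact: measurable_funeneg.
have mxi : measurable_fun [set: borel E] (fun x => (xi (g x))%:E).
  by apply/measurable_EFinP; apply: (measurableT_comp _ mg); exact: xi_measurable.
have gmass : (\int[nu]_x (g x)%:E = 1)%E.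
  by rewrite -gE//; exact: probability_setT.
have key : (\int[nu]_x (xi (g x))%:E + \int[nu]_x h^\- x = \int[nu]_x h^\+ x)%E.
  have E1 : (\int[nu]_x ((xi (g x))%:E + h^\- x + (g x)%:E) =
             \int[nu]_x (h^\+ x + 1))%E.
    apply: eq_integral => x _.
    have : h x = (h^\+ x - h^\- x)%E by rewrite {1}(funeposneg h).
    rewrite funeposE funenegE /h; rewrite -EFinN -!EFin_max.
    rewrite -EFinB => -[]; set p := Num.max _ _; set n := Num.max _ _ => hx.
    by rewrite -!EFinD /xi; congr EFin; move: hx; set u := ln _; lra.
  rewrite ge0_integralD// in E1; last 4 first.
  - by move=> x _; rewrite adde_ge0// lee_fin xi_ge0.
  - by apply: emeasurable_funD => //; exact: measurable_funeneg.
  - by move=> x _; rewrite lee_fin.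
  - exact/measurable_EFinP.
  rewrite ge0_integralD// in E1; last 2 first.
  - by move=> x _; rewrite lee_fin xi_ge0.
  - exact: measurable_funeneg.
  rewrite ge0_integralD// in E1; last exact: measurable_funepos.
  rewrite gmass i1 in E1.
  by have := congr1 (fun z => (z - 1)%E) E1; rewrite !addeK.
by rewrite -key addeK.
Qed.

End relative_entropy_density.

Section entropy_theory.
Context {R : realType} {E : pmetricType R}.
Implicit Types mu nu : probability (borel E) R.

Lemma rel_entropy_ge0 mu nu : (0 <= rel_entropy mu nu)%E.
Proof.
have [munu|munu] := pselect (mu `<< nu); last by rewrite /rel_entropy asboolF// leey.
have [g dg] := dominates_has_density munu; rewrite (rel_entropyE dg).
apply: integral_ge0 => x _; rewrite lee_fin xi_ge0//; exact: (let: And3 _ g0 _ := dg in g0 x).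
Qed.

Lemma rel_entropy_dominates mu nu : (rel_entropy mu nu < +oo)%E -> mu `<< nu.
Proof. by rewrite /rel_entropy; case: asboolP. Qed.

Lemma xi_density_measurable (g : E -> R) : measurable_fun [set: borel E] g ->
  measurable_fun [set: borel E] (fun x => xi (g x)).
Proof. by move=> mg; apply: (measurableT_comp _ mg); exact: xi_measurable. Qed.

Lemma rel_entropy_lty mu nu (g : E -> R) : has_density mu nu g ->
  (rel_entropy mu nu < +oo)%E ->
  nu.-integrable [set: borel E] (EFin \o (fun x => xi (g x))).
Proof.
move=> dg; have [mg g0 _] := dg; rewrite (rel_entropyE dg) => fin.
apply/integrableP; split; first by apply/measurable_EFinP; exact: xi_density_measurable.
by under eq_integral do rewrite /= ger0_norm ?xi_ge0//.
Qed.

Lemma rel_entropy_fineE mu nu (g : E -> R) : has_density mu nu g ->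
  fine (rel_entropy mu nu) = \int[nu]_x xi (g x).
Proof. by move=> dg; rewrite (rel_entropyE dg). Qed.

Lemma rel_entropy_bounded mu nu (g : E -> R) (M : R) : has_density mu nu g ->
  1 <= M -> (forall x, g x <= M) -> (rel_entropy mu nu <= (ln M + 1)%:E)%E.
Proof.
move=> dg M1 gM; have [mg g0 gE] := dg; rewrite (rel_entropyE dg).
have lnM0 : 0 <= ln M by rewrite ln_ge0.
have xile x : xi (g x) <= g x * ln M + 1.
  have : g x * ln (g x) <= g x * ln M.
    have := g0 x; rewrite le_eqVlt => /predU1P[<-|gx]; first by rewrite !mul0r.
    by rewrite ler_pM2l// ler_ln ?posrE//; exact: lt_le_trans gx (gM x).
  by have := g0 x; rewrite /xi; set u := g x * ln (g x); set v := g x * ln M; lra.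
apply: (@le_trans _ _ (\int[nu]_x (g x * ln M + 1)%:E)%E).
  apply: ge0_le_integral => //.
  - by move=> x _; rewrite lee_fin xi_ge0.
  - by apply/measurable_EFinP; exact: xi_density_measurable.
  - apply/measurable_EFinP; apply: measurable_funD => //; exact: measurable_funM.
  - by move=> x _; rewrite lee_fin.
rewrite (_ : (\int[nu]_x (g x * ln M + 1)%:E)%E =
  (\int[nu]_x ((ln M)%:E * (g x)%:E + 1%:E))%E); last first.
  by apply: eq_integral => x _; rewrite -EFinM -EFinD mulrC.
rewrite ge0_integralD//; last 2 first.
- by move=> x _; rewrite mule_ge0// lee_fin.
- by apply/measurable_EFinP; exact: measurable_funM.
rewrite ge0_integralZl//; last 2 first.
- exact/measurable_EFinP.
- by move=> x _; rewrite lee_fin.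
rewrite -gE// integral_cst// mul1e.
rewrite [X in (_ * X + _)%E](_ : _ = 1%E); last exact: probability_setT.
by rewrite [X in (_ + X)%E](_ : _ = 1%E) ?mule1//; exact: probability_setT.
Qed.

Lemma has_density_bounded mu nu (g : E -> R) (M : R) : has_density mu nu g ->
  (forall x, g x <= M) -> has_bounded_density mu nu.
Proof.
move=> dg gM; split; first exact: has_density_dominates dg.
exists M; apply: filterS (has_density_RN dg) => x h.
by rewrite /density h lee_fin.
Qed.

Lemma has_density_ae_unique mu nu (g : E -> R) (h : E -> R) : has_density mu nu g ->
  measurable_fun [set: borel E] h -> (forall x, 0 <= h x) ->
  {ae nu, forall x, g x = h x} -> has_density mu nu h.
Proof.
move=> dg mh h0 gh; apply: (RN_has_density (has_density_dominates dg)) => //.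
by apply: filterS2 (has_density_RN dg) gh => x h1 <-.
Qed.

Lemma has_density_self nu : has_density nu nu (cst 1 : E -> R).
Proof.
split=> // A mA.
by rewrite -[RHS]/(\int[nu]_(x in A) (cst 1%E x))%E integral_cst// mul1e.
Qed.

End entropy_theory.

Section mixture_integral.
Context {R : realType} {E : pmetricType R} {phi : weight E}.
Implicit Types (mu : Pphi phi) (nu : probability (borel E) R).

Lemma ge0_integral_mix mu mu' (e : R) (h : E -> \bar R) : 0 <= e <= 1 ->
  measurable_fun [set: borel E] h -> (forall x, 0 <= h x)%E ->
  (\int[mix e mu mu']_x h x =
   (1 - e)%:E * \int[mu]_x h x + e%:E * \int[mu']_x h x)%E.
Proof.
move=> e01 mh h0.
have E1 : (\int[mix e mu mu']_x h x = \int[mix_measure e mu mu']_x h x)%E by [].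
rewrite E1 ge0_integral_measure_add// !ge0_integral_mscale//=.
by rewrite clamp01E.
Qed.

Lemma Rintegral_mix mu mu' (e : R) (h : E -> R) : 0 <= e <= 1 ->
  measurable_fun [set: borel E] h ->
  mu.-integrable [set: borel E] (EFin \o h) ->
  mu'.-integrable [set: borel E] (EFin \o h) ->
  \int[mix e mu mu']_x h x = (1 - e) * \int[mu]_x h x + e * \int[mu']_x h x.
Proof.
move=> e01 mh ih ih'.
have mE : measurable_fun [set: borel E] (EFin \o h) by exact/measurable_EFinP.
have E1 (m : Pphi phi) : (\int[m]_x (h x)%:E =
    \int[m]_x ((EFin \o h)^\+ x) - \int[m]_x ((EFin \o h)^\- x))%E.
  by rewrite integralE.
have fp (m : Pphi phi) : m.-integrable [set: borel E] (EFin \o h) ->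
    (\int[m]_x ((EFin \o h)^\+ x))%E \is a fin_num.
  by move=> im; exact: integrable_pos_fin_num.
have fn (m : Pphi phi) : m.-integrable [set: borel E] (EFin \o h) ->
    (\int[m]_x ((EFin \o h)^\- x))%E \is a fin_num.
  by move=> im; exact: integrable_neg_fin_num.
rewrite /Rintegral !E1 !ge0_integral_mix//; last 2 first.
- exact: measurable_funeneg.
- exact: measurable_funepos.
move: (fp mu ih) (fp mu' ih') (fn mu ih) (fn mu' ih').
move: (\int[mu]_x _)%E (\int[mu']_x _)%E (\int[mu]_x _)%E (\int[mu']_x _)%E.
by move=> [a| |] [b| |] [c| |] [d| |] //= _ _ _ _; ring.
Qed.

Lemma has_density_mix mu mu' nu (e : R) (g g' : E -> R) : 0 <= e <= 1 ->
  has_density mu nu g -> has_density mu' nu g' ->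
  has_density (mix e mu mu') nu (fun x => (1 - e) * g x + e * g' x).
Proof.
move=> e01 [mg g0 gE] [mg' g'0 g'E]; have /andP[e0 e1] := e01.
have e1' : 0 <= 1 - e by lra.
split.
- by apply: measurable_funD; exact: measurable_funM.
- by move=> x; rewrite addr_ge0// mulr_ge0.
move=> A mA.
transitivity (mix_measure e mu mu' A); first by [].
rewrite mix_measureE clamp01E// gE// g'E//.
have mT (f : E -> R) : measurable_fun [set: borel E] f ->
    measurable_fun (A : set (borel E)) (EFin \o f).
  by move=> mf; apply/measurable_EFinP; exact: measurable_funTS.
under [RHS]eq_integral do rewrite EFinD !EFinM.
rewrite ge0_integralD//.
- rewrite !ge0_integralZl//; try exact: mT; by move=> x _; rewrite lee_fin.
- by move=> x _; rewrite mule_ge0// lee_fin.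
- by apply: (mT (fun x => (1 - e) * g x)); exact: measurable_funM.
- by move=> x _; rewrite mule_ge0// lee_fin.
- by apply: (mT (fun x => e * g' x)); exact: measurable_funM.
Qed.

Lemma rel_entropy_mix mu mu' nu (e : R) : 0 <= e <= 1 ->
  (rel_entropy mu nu < +oo)%E -> (rel_entropy mu' nu < +oo)%E ->
  (rel_entropy (mix e mu mu') nu <=
   (1 - e)%:E * rel_entropy mu nu + e%:E * rel_entropy mu' nu)%E.
Proof.
move=> e01 hm hm'; have /andP[e0 e1] := e01.
have e1' : 0 <= 1 - e by lra.
have [g dg] := dominates_has_density (rel_entropy_dominates hm).
have [g' dg'] := dominates_has_density (rel_entropy_dominates hm').
have [mg g0 _] := dg; have [mg' g'0 _] := dg'.
rewrite (rel_entropyE (has_density_mix e01 dg dg')) (rel_entropyE dg) (rel_entropyE dg').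
have mxi (f : E -> R) : measurable_fun [set: borel E] f ->
    measurable_fun [set: borel E] (fun x => (xi (f x))%:E).
  by move=> mf; apply/measurable_EFinP; exact: xi_density_measurable.
have pxi (f : E -> R) : (forall x, 0 <= f x) -> forall x : borel E, [set: borel E] x ->
    (0 <= (xi (f x))%:E)%E.
  by move=> f0 x _; rewrite lee_fin xi_ge0.
rewrite -!ge0_integralZl//; try exact: mxi; try exact: pxi.
rewrite -ge0_integralD//; last 4 first.
- by move=> x _; rewrite mule_ge0 ?lee_fin ?xi_ge0.
- by apply: emeasurable_funM => //; exact: mxi.
- by move=> x _; rewrite mule_ge0 ?lee_fin ?xi_ge0.
- by apply: emeasurable_funM => //; exact: mxi.
apply: ge0_le_integral => //.
- by move=> x _; rewrite lee_fin xi_ge0// addr_ge0// mulr_ge0.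
- by apply: mxi; apply: measurable_funD; exact: measurable_funM.
- by apply: emeasurable_funD; apply: emeasurable_funM => //; exact: mxi.
- by move=> x _; rewrite -!EFinM -EFinD lee_fin xi_convex.
Qed.

Lemma half01 : 0 <= (2^-1 : R) <= 1.
Proof. by apply/andP; split; lra. Qed.

(** The convexity gap of xi at the midpoint is nonnegative and has nonpositive integral, so it
    vanishes almost everywhere and strict convexity forces g = g'. *)
Lemma rel_entropy_midpoint_eq mu mu' nu :
  (rel_entropy mu nu < +oo)%E -> (rel_entropy mu' nu < +oo)%E ->
  2^-1 * fine (rel_entropy mu nu) + 2^-1 * fine (rel_entropy mu' nu) <=
  fine (rel_entropy (mix 2^-1 mu mu') nu) -> measure_eq mu mu'.
Proof.
move=> hm hm'.
have [g dg] := dominates_has_density (rel_entropy_dominates hm).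
have [g' dg'] := dominates_has_density (rel_entropy_dominates hm').
have [mg g0 gE] := dg; have [mg' g'0 g'E] := dg'.
have dm := has_density_mix half01 dg dg'.
have [mm m0 _] := dm.
set m := fun x => (1 - 2^-1) * g x + 2^-1 * g' x in dm mm m0.
rewrite (rel_entropy_fineE dg) (rel_entropy_fineE dg') (rel_entropy_fineE dm).
have ig := rel_entropy_lty dg hm; have ig' := rel_entropy_lty dg' hm'.
have im : nu.-integrable [set: borel E] (EFin \o (fun x => xi (m x))).
  apply: (rel_entropy_lty dm); apply: le_lt_trans (rel_entropy_mix half01 hm hm') _.
  by rewrite lte_add_pinfty// lte_mul_pinfty// lee_fin; lra.
have iZ (h : E -> R) : nu.-integrable [set: borel E] (EFin \o h) ->
    nu.-integrable [set: borel E] (EFin \o (fun x => 2^-1 * h x)).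
  by move=> ih; have := integrableZl measurableT 2^-1 ih.
pose s x := 2^-1 * xi (g x) + 2^-1 * xi (g' x).
have is_ : nu.-integrable [set: borel E] (EFin \o s).
  by have := integrableD measurableT (iZ _ ig) (iZ _ ig').
have sm x : 0 <= s x - xi (m x).
  have := xi_convex half01 (g0 x) (g'0 x); rewrite -/(m x) /s.
  by rewrite (_ : 1 - 2^-1 = 2^-1); [lra|lra].
rewrite -!RintegralZl// -RintegralD//; try exact: iZ.
rewrite -subr_le0 -RintegralB// => le0.
have isub : nu.-integrable [set: borel E] (EFin \o (fun x => s x - xi (m x))).
  by have := integrableB measurableT is_ im.
have eq0 : (\int[nu]_x `|(s x - xi (m x))%:E| = 0)%E.
  under eq_integral do rewrite gee0_abs ?lee_fin//.
  rewrite -EFin_Rintegral//; congr EFin; apply/eqP; rewrite eq_le le0/=.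
  exact: Rintegral_ge0.
have mS : measurable_fun [set: borel E] (EFin \o (fun x => s x - xi (m x))).
  exact: measurable_int isub.
have aeE : {ae nu, forall x, g x = g' x}.
  have := (ae_eq_integral_abs nu measurableT mS).1 eq0.
  apply: filterS => x /(_ I) /= [h]; apply: xi_midpoint_eq => //.
  move: h; rewrite /s /m (_ : 1 - 2^-1 = 2^-1); last by lra.
  by lra.
move=> A mA; apply: (eq_trans (gE A mA)); apply: (eq_trans _ (esym (g'E A mA))).
apply: ae_eq_integral => //.
- by apply/measurable_EFinP; exact: measurable_funTS.
- by apply/measurable_EFinP; exact: measurable_funTS.
- by apply: filterS aeE => x -> _.
Qed.

End mixture_integral.

(** * The Gibbs variational inequality and its equality case *)

Section gibbs.
Context {R : realType} {E : pmetricType R}.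
Variables (nu : probability (borel E) R) (V : E -> R).
Hypothesis mV : measurable_fun [set: borel E] V.
Implicit Types mu : probability (borel E) R.
Hypothesis iexpV : nu.-integrable [set: borel E] (EFin \o (fun x => expR (- V x))).

Definition partition_function := \int[nu]_x expR (- V x).
Local Notation Z := partition_function.

(** Jensen's inequality, from the tangent of exp(- v) at the mean m. It serves both to get Z > 0 and
    to bound Z from below quantitatively. *)
Lemma partition_function_jensen : nu.-integrable [set: borel E] (EFin \o V) ->
  expR (- \int[nu]_x V x) <= Z.
Proof.
move=> iV; set m := \int[nu]_x V x.
have ic (c : R) : nu.-integrable [set: borel E] (EFin \o (cst c : borel E -> R)).
  exact: finite_measure_integrable_cst.
have i1 : nu.-integrable [set: borel E] (EFin \o (fun x => (1 + m) - V x)).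
  by have := integrableB measurableT (ic (1 + m)) iV.
have i2 : nu.-integrable [set: borel E]
    (EFin \o (fun x => expR (- m) * ((1 + m) - V x))).
  by have := integrableZl measurableT (expR (- m)) i1.
have -> : expR (- m) = \int[nu]_x (expR (- m) * ((1 + m) - V x)).
  rewrite RintegralZl// RintegralB//; last exact: ic.
  by rewrite Rintegral_probability_cst -/m addrK mulr1.
apply: le_Rintegral => // x _.
have -> : expR (- V x) = expR (- m) * expR (m - V x).
  by rewrite -expRD; congr expR; ring.
by rewrite ler_wpM2l ?expR_ge0//; have := expR_ge1Dx (m - V x); lra.
Qed.

Hypothesis Z_gt0 : 0 < Z.

(** The defect in the variational inequality is the integral of the defect k in Young's inequality
    at v = V x + ln Z. Nonnegativity and the equality case thus reduce to pointwise statements. *)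
Lemma gibbs_identity mu (g : E -> R) : has_density mu nu g ->
  (rel_entropy mu nu < +oo)%E -> mu.-integrable [set: borel E] (EFin \o V) ->
  let k x := g x * ln (g x) + g x * (V x + ln Z) - g x + expR (- (V x + ln Z)) in
  nu.-integrable [set: borel E] (EFin \o k) /\
  fine (rel_entropy mu nu) + \int[mu]_x V x + ln Z = \int[nu]_x k x.
Proof.
move=> dg hm iV k; have [mg g0 gE] := dg.
have ixi := rel_entropy_lty dg hm.
have igV : nu.-integrable [set: borel E] (EFin \o (fun x => V x * g x)).
  exact/(integrable_density dg mV).
have ig := has_density_integrable dg.
have igZ : nu.-integrable [set: borel E] (EFin \o (fun x => ln Z * g x)).
  by have := integrableZl measurableT (ln Z) ig.
have ie : nu.-integrable [set: borel E] (EFin \o (fun x => Z^-1 * expR (- V x))).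
  by have := integrableZl measurableT Z^-1 iexpV.
have i1 : nu.-integrable [set: borel E] (EFin \o (cst (-1) : borel E -> R)).
  exact: finite_measure_integrable_cst.
have kE : k = (fun x => ((xi (g x) + V x * g x) + (ln Z * g x + Z^-1 * expR (- V x))) + -1).
  apply/funext => x; rewrite /k /xi opprD expRD [expR (- ln Z)]expRN lnK//; ring.
have iA : nu.-integrable [set: borel E] (EFin \o (fun x => xi (g x) + V x * g x)).
  by have := integrableD measurableT ixi igV.
have iB : nu.-integrable [set: borel E] (EFin \o (fun x => ln Z * g x + Z^-1 * expR (- V x))).
  by have := integrableD measurableT igZ ie.
have iC : nu.-integrable [set: borel E] (EFin \o
    (fun x => (xi (g x) + V x * g x) + (ln Z * g x + Z^-1 * expR (- V x)))).
  by have := integrableD measurableT iA iB.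
rewrite kE; split; first by have := integrableD measurableT iC i1.
rewrite (RintegralD measurableT iC i1) (RintegralD measurableT iA iB).
rewrite (RintegralD measurableT ixi igV) (RintegralD measurableT igZ ie).
rewrite (rel_entropy_fineE dg) (Rintegral_density dg mV).
rewrite (RintegralZl _ measurableT ig) (has_density_mass dg).
rewrite (RintegralZl _ measurableT iexpV) -/Z mulVf ?gt_eqF//.
rewrite Rintegral_probability_cst mulr1.
set a := \int[nu]_x xi _; set b := \int[nu]_x (V x * g x); lra.
Qed.

Lemma gibbs_ineq mu : (rel_entropy mu nu < +oo)%E ->
  mu.-integrable [set: borel E] (EFin \o V) ->
  0 <= fine (rel_entropy mu nu) + \int[mu]_x V x + ln Z.
Proof.
move=> hm iV; have [g dg] := dominates_has_density (rel_entropy_dominates hm).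
have [_ ->] := gibbs_identity dg hm iV.
have [_ g0 _] := dg.
by apply: Rintegral_ge0 => x _; exact: entropy_young.
Qed.

Lemma gibbs_density_measurable :
  measurable_fun [set: borel E] (fun x => Z^-1 * expR (- V x)).
Proof.
apply: measurable_funM => //; apply: measurableT_comp => //.
exact: measurableT_comp.
Qed.

Lemma gibbs_eq mu : (rel_entropy mu nu < +oo)%E ->
  mu.-integrable [set: borel E] (EFin \o V) ->
  fine (rel_entropy mu nu) + \int[mu]_x V x + ln Z <= 0 ->
  has_density mu nu (fun x => Z^-1 * expR (- V x)).
Proof.
move=> hm iV; have [g dg] := dominates_has_density (rel_entropy_dominates hm).
have [_ g0 _] := dg.
have [ik ->] := gibbs_identity dg hm iV; set k := fun x => _ in ik *.
have k0 x : 0 <= k x by exact: entropy_young.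
move=> le0; apply: (has_density_ae_unique dg).
- exact: gibbs_density_measurable.
- by move=> x; rewrite mulr_ge0 ?invr_ge0 ?expR_ge0// ltW.
have eq0 : (\int[nu]_x `|(k x)%:E| = 0)%E.
  under eq_integral do rewrite gee0_abs ?lee_fin//.
  rewrite -EFin_Rintegral//; congr EFin; apply/eqP; rewrite eq_le le0/=.
  exact: Rintegral_ge0.
have mk : measurable_fun [set: borel E] (EFin \o k) by exact: measurable_int ik.
have := (ae_eq_integral_abs nu measurableT mk).1 eq0.
apply: filterS => x /(_ I) /= [/(entropy_young_eq0 (g0 x)) ->].
by rewrite opprD expRD [expR (- ln Z)]expRN lnK// mulrC.
Qed.

Lemma gibbs_value mu : has_density mu nu (fun x => Z^-1 * expR (- V x)) ->
  mu.-integrable [set: borel E] (EFin \o V) ->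
  rel_entropy mu nu = (- (\int[mu]_x V x) - ln Z)%:E.
Proof.
move=> dg iV; have [mg g0 gE] := dg.
pose g x := Z^-1 * expR (- V x).
have xiE x : xi (g x) = - (V x * g x) + (- ln Z * g x + (1 - g x)).
  have -> : xi (g x) = g x * (- V x - ln Z) - g x + 1.
    by rewrite /xi {2}/g lnM ?posrE ?invr_gt0 ?expR_gt0// expRK lnV// [- ln Z + _]addrC.
  ring.
have igV : nu.-integrable [set: borel E] (EFin \o (fun x => - (V x * g x))).
  have : nu.-integrable [set: borel E] (EFin \o (fun x => V x * g x)).
    exact/(integrable_density dg mV).
  by move=> /integrableN.
have ig : nu.-integrable [set: borel E] (EFin \o g) := has_density_integrable dg.
have igZ : nu.-integrable [set: borel E] (EFin \o (fun x => - ln Z * g x)).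
  by have := integrableZl measurableT (- ln Z) ig.
have i1 : nu.-integrable [set: borel E] (EFin \o (cst 1 : borel E -> R)).
  exact: finite_measure_integrable_cst.
have i1g : nu.-integrable [set: borel E] (EFin \o (fun x => 1 - g x)).
  by have := integrableB measurableT i1 ig.
have i2 : nu.-integrable [set: borel E] (EFin \o (fun x => - ln Z * g x + (1 - g x))).
  by have := integrableD measurableT igZ i1g.
rewrite (rel_entropyE dg).
rewrite (_ : (\int[nu]_x _)%E =
  (\int[nu]_x (- (V x * g x) + (- ln Z * g x + (1 - g x)))%:E)%E); last first.
  by apply: eq_integral => x _; rewrite -xiE.
rewrite -EFin_Rintegral; last by have := integrableD measurableT igV i2.
rewrite (RintegralD measurableT igV i2) (RintegralD measurableT igZ i1g).
rewrite (RintegralZl _ measurableT ig) (RintegralB measurableT i1 ig).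
rewrite (has_density_mass dg) Rintegral_probability_cst subrr addr0 mulr1.
rewrite (Rintegral_density dg mV). congr EFin; congr (_ + _).
have iVg : nu.-integrable [set: borel E] (EFin \o (fun x => V x * g x)).
  exact/(integrable_density dg mV).
under eq_Rintegral do rewrite -mulN1r.
by rewrite RintegralZl// mulN1r.
Qed.

End gibbs.

(** * Constrained minimisation of the entropy *)

Section minimisation.
Context {R : realType} {E : pmetricType R} {phi : weight E} {T : pmetricType R}.
Variables (nu : Pphi phi) (F : Pphi phi -> \bar R) (Theta : T -> Pphi phi -> R).
Hypothesis F_Ny : forall mu, (-oo < F mu)%E.
Local Notation J := (penalised nu F).
Local Notation D := (penalised_dom nu F).

Lemma penalised_dom_fin mu : D mu ->
  rel_entropy mu nu \is a fin_num /\ F mu \is a fin_num.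
Proof.
move=> [hH hF]; split.
  by rewrite ge0_fin_numE// rel_entropy_ge0.
by rewrite fin_numElt F_Ny.
Qed.

Lemma penalisedE mu : D mu ->
  J mu = (fine (rel_entropy mu nu) + fine (F mu))%:E.
Proof. by move=> /penalised_dom_fin[h1 h2]; rewrite EFinD !fineK. Qed.

Lemma penalised_dom_lty mu : (J mu < +oo)%E -> D mu.
Proof.
rewrite /penalised; have := rel_entropy_ge0 mu nu; have := F_Ny mu.
rewrite /penalised_dom/=.
by case: (rel_entropy mu nu) => [a| |]; case: (F mu) => [b| |]//=; rewrite ?ltry.
Qed.

Hypothesis F_convex : convex_functional F.
Hypothesis Theta_convex : forall t, convex_functional (fun mu => (Theta t mu)%:E).

Lemma penalised_dom_convex : convex_subset D.
Proof.
move=> mu mu' e [hH hF] [hH' hF'] e01; have /andP[e0 e1] := e01.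
have h (a b : \bar R) : (a < +oo -> b < +oo -> (1 - e)%:E * a + e%:E * b < +oo)%E.
  move=> ha hb; rewrite lte_add_pinfty// lte_mul_pinfty// lee_fin; lra.
split.
  by apply: le_lt_trans (rel_entropy_mix e01 hH hH') _; exact: h.
by apply: le_lt_trans (F_convex mu mu' e01) _; exact: h.
Qed.

Lemma constraint_mix mu mu' (e : R) t : 0 <= e <= 1 ->
  Theta t (mix e mu mu') <= (1 - e) * Theta t mu + e * Theta t mu'.
Proof. by move=> e01; have := Theta_convex t mu mu' e01; rewrite -!EFinM -EFinD lee_fin. Qed.

Lemma penalised_mix mu mu' (e : R) : 0 <= e <= 1 -> D mu -> D mu' ->
  fine (F (mix e mu mu')) <= (1 - e) * fine (F mu) + e * fine (F mu').
Proof.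
move=> e01 Dmu Dmu'; have Dm := penalised_dom_convex Dmu Dmu' e01.
have [_ f1] := penalised_dom_fin Dmu; have [_ f2] := penalised_dom_fin Dmu'.
have [_ f3] := penalised_dom_fin Dm.
by rewrite -lee_fin EFinD !EFinM !fineK//; exact: F_convex.
Qed.

Lemma admissible_mix mu mu' (e : R) : 0 <= e <= 1 -> admissible Theta mu ->
  admissible Theta mu' -> admissible Theta (mix e mu mu').
Proof.
move=> e01 Amu Amu' t; apply: le_trans (constraint_mix _ _ _ e01) _.
have /andP[e0 e1] := e01; have e1' : 0 <= 1 - e by lra.
have := ler_wpM2l e1' (Amu t); have := ler_wpM2l e0 (Amu' t).
by rewrite !mulr0; lra.
Qed.

Lemma minimiser_measure_eq mu mu' : is_minimiser J (D `&` admissible Theta) mu ->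
  is_minimiser J (D `&` admissible Theta) mu' -> measure_eq mu mu'.
Proof.
move=> [[Dmu Amu] mmin] [[Dmu' Amu'] mmin'].
apply: (rel_entropy_midpoint_eq (nu := nu) Dmu.1 Dmu'.1).
set m := mix 2^-1 mu mu'.
have Dm : D m by exact: penalised_dom_convex Dmu Dmu' half01.
have Am : admissible Theta m by exact: admissible_mix half01 Amu Amu'.
have h1 := mmin m (conj Dm Am); have h2 := mmin' m (conj Dm Am).
have h3 := mmin mu' (conj Dmu' Amu').
move: h1 h2 h3; rewrite !penalisedE// !lee_fin.
have := penalised_mix half01 Dmu Dmu'; rewrite -/m.
by rewrite (_ : 1 - 2^-1 = 2^-1 :> R); lra.
Qed.

Hypothesis J_lsc : lower_semicontinuous J.
Hypothesis J_compact : forall a : R, compact [set mu | (J mu <= a%:E)%E].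
Hypothesis Theta_lsc : forall t, lower_semicontinuous (fun mu => (Theta t mu)%:E).

(** The direct method with filters: the sets K mu are closed, nonempty and totally ordered by
    inclusion, so that they generate a filter, and a cluster point inside one compact level set
    belongs to all of them. *)
Lemma minimiser_exists : D `&` admissible Theta !=set0 ->
  exists mu, is_minimiser J (D `&` admissible Theta) mu.
Proof.
move=> [mu0 S0]; set S := D `&` admissible Theta in S0 *.
have closed_sub (f : Pphi phi -> \bar R) (a : R) : lower_semicontinuous f ->
    closed [set mu | (f mu <= a%:E)%E].
  move=> /lower_semicontinuousP/(_ a) oa.
  rewrite (_ : [set mu | (f mu <= a%:E)%E] = ~` [set mu | (a%:E < f mu)%E]).
    exact: open_closedC.
  by apply/seteqP; split => mu /=; rewrite leNgt => /negP.
have Acl : closed (admissible Theta).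
  rewrite (_ : admissible Theta = \bigcap_t [set mu | ((Theta t mu)%:E <= 0%:E)%E]).
    by apply: closed_bigI => t _; exact: closed_sub.
  by apply/seteqP; split => mu /= h t; [move=> _; rewrite /= lee_fin|rewrite -lee_fin; exact: h].
pose K mu := [set mu' | (J mu' <= J mu)%E] `&` admissible Theta.
have Jfin mu : S mu -> J mu = (fine (J mu))%:E.
  by move=> [Dmu _]; rewrite penalisedE.
have Kcl mu : S mu -> closed (K mu).
  move=> Smu; apply: closedI => //; rewrite (Jfin _ Smu); exact: closed_sub.
have FF : ProperFilter (filter_from S K).
  apply: filter_from_proper; last first.
    by move=> mu [Dmu Amu]; exists mu; split => //=.
  apply: filter_from_filter; first by exists mu0.
  move=> mu mu' Smu Smu'; have [h|h] := leP (J mu) (J mu').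
    by exists mu => // m [/= hm Am]; do 2 split => //; exact: le_trans hm h.
  by exists mu' => // m [/= hm Am]; do 2 split => //; apply: le_trans hm (ltW h).
have [|p [_ pcl]] := J_compact (a := fine (J mu0)) FF.
  by exists mu0 => // m [/= hm _]; rewrite -Jfin.
have pK mu : S mu -> K mu p.
  move=> Smu; apply: (Kcl _ Smu) => B pB.
  by apply: pcl pB; exists mu.
exists p; split; last by move=> mu /pK[].
have [Jp Ap] := pK mu0 S0; split => //; apply: penalised_dom_lty.
by apply: le_lt_trans Jp _; rewrite (Jfin _ S0) ltry.
Qed.

End minimisation.

(** * Exponential moments *)

Section exponential_moments.
Context {R : realType} {E : pmetricType R} {phi : weight E}.
Implicit Types (m : Pphi phi) (h g : E -> R).

Definition exp_moment_le m (a B : R) :=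
  (\int[m]_x (expR (a * phi x))%:E <= B%:E)%E.

Let exp_measurable (a : R) : measurable_fun [set: borel E] (fun x => expR (a * phi x)).
Proof.
apply: measurableT_comp => //; apply: measurable_funM => //.
exact: weight_measurable.
Qed.

Lemma exp_integrable m (a B : R) : exp_moment_le m a B ->
  m.-integrable [set: borel E] (EFin \o (fun x => expR (a * phi x))).
Proof.
move=> mB; apply/integrableP; split; first exact/measurable_EFinP.
under eq_integral do rewrite /= ger0_norm ?expR_ge0//.
by apply: le_lt_trans mB _; rewrite ltry.
Qed.

Lemma exp_Rintegral_le m (a B : R) : exp_moment_le m a B ->
  \int[m]_x expR (a * phi x) <= B.
Proof.
by move=> mB; rewrite -lee_fin EFin_Rintegral//; exact: exp_integrable mB.
Qed.

Lemma oneD_weight_le_exp (x : E) : 1 + phi x <= expR (phi x).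
Proof. exact: expR_ge1Dx. Qed.

Lemma exp_order_integrable m h (A c B : R) : exp_moment_le m c B ->
  measurable_fun [set: borel E] h -> (forall x, `|h x| <= A * expR (c * phi x)) ->
  m.-integrable [set: borel E] (EFin \o h).
Proof.
move=> mB mh hA.
have iA : m.-integrable [set: borel E] (EFin \o (fun x => A * expR (c * phi x))).
  by have := integrableZl measurableT A (exp_integrable mB).
exact: (integrable_dominated mh iA hA).
Qed.

(** A continuous cutoff: 1 where phi <= M, 0 where phi >= M + 1. *)
Definition plateau (M : R) (x : E) := Num.min 1 (Num.max 0 (M + 1 - phi x)).

Lemma plateau_continuous M : continuous (plateau M).
Proof.
move=> x; apply: (@continuous_min R E (fun=> 1)); first exact: cvg_cst.
apply: (@continuous_max R E (fun=> 0)); first exact: cvg_cst.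
by apply: cvgB; [exact: cvg_cst|exact: weight_continuous].
Qed.

Lemma plateau_ge0 M x : 0 <= plateau M x.
Proof. by rewrite /plateau le_min ler01 le_max lexx. Qed.

Lemma plateau_le1 M x : plateau M x <= 1.
Proof. by rewrite /plateau ge_min lexx. Qed.

Lemma plateau_tail M (c : R) x : 0 <= c ->
  expR (c * phi x) * (1 - plateau M x) <= expR (- (c * M)) * expR ((2 * c) * phi x).
Proof.
move=> c0; have [h|h] := leP (phi x) M.
  rewrite /plateau (_ : Num.min _ _ = 1); last first.
    by apply/min_idPl; rewrite le_max; apply/orP; right; lra.
  by rewrite subrr mulr0 mulr_ge0 ?expR_ge0.
rewrite -expRD; apply: (@le_trans _ _ (expR (c * phi x))).
  by rewrite ler_piMr ?expR_ge0// gerBl plateau_ge0.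
rewrite ler_expR; have : 0 <= c * (phi x - M) by rewrite mulr_ge0// subr_ge0 ltW.
lra.
Qed.

Variables (nu : Pphi phi) (nu_ : nat -> Pphi phi).
Hypothesis nu_cvg : nu_ @ \oo --> nu.
Hypothesis exp_moments : forall a : R, 0 < a -> exists B : R,
  exp_moment_le nu a B /\ forall k, exp_moment_le (nu_ k) a B.

(** Convergence in [Pphi phi] extends to exponential growth in phi: the cut-off integrand is bounded
    and continuous, and moments of order 2 c make the tail small uniformly in k. *)
Lemma cvg_exp_order h (A c : R) : continuous h -> 0 <= A -> 0 < c ->
  (forall x, `|h x| <= A * expR (c * phi x)) ->
  \int[nu_ k]_x h x @[k --> \oo] --> \int[nu]_x h x.
Proof.
move=> ch A0 c0 hA.
have [B [nuB nukB]] := exp_moments (mulr_gt0 (ltr0Sn _ 1 : 0 < 2) c0).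
have [B1 [nuB1 nukB1]] := exp_moments c0.
have mh := continuous_borel_measurable ch.
apply/cvgrPdist_le => e e0; have e3 : 0 < e / 3 by rewrite divr_gt0.
have B0 : 0 <= B.
  by apply: le_trans (exp_Rintegral_le nuB); apply: Rintegral_ge0 => x _; exact: expR_ge0.
(* Chosen so that exp(c M) >= 1 + c M >= A B / (e / 3), which makes the tail bound A exp(- c M) B at
   most e / 3. *)
pose M := A * B / (c * (e / 3)).
have M0 : 0 <= M by rewrite divr_ge0 ?mulr_ge0// ltW// mulr_gt0.
have MP : A * expR (- (c * M)) * B <= e / 3.
  rewrite mulrAC expRN ler_pdivrMr ?expR_gt0//.
  apply: le_trans (ler_wpM2l (ltW e3) (expR_ge1Dx (c * M))).
  rewrite /M mulrDr mulr1 (_ : e / 3 * (c * (A * B / (c * (e / 3)))) = A * B).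
    by rewrite lerDr ltW.
  by field; rewrite !gt_eqF.
have tail (m : Pphi phi) : exp_moment_le m c B1 -> exp_moment_le m (2 * c) B ->
    `|\int[m]_x h x - \int[m]_x (h x * plateau M x)| <= e / 3.
  move=> mB1 mB.
  have ih : m.-integrable [set: borel E] (EFin \o h) by exact: (exp_order_integrable mB1 mh hA).
  have mp : measurable_fun [set: borel E] (plateau M).
    by apply: continuous_borel_measurable; exact: plateau_continuous.
  have ihp : m.-integrable [set: borel E] (EFin \o (fun x => h x * plateau M x)).
    apply: (exp_order_integrable mB1 (A := A)); first by apply: measurable_funM.
    move=> x; rewrite normrM (ger0_norm (plateau_ge0 _ _)).
    by apply: le_trans (hA x); rewrite ler_piMr ?plateau_le1.
  rewrite -RintegralB//.
  have i2 : m.-integrable [set: borel E]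
      (EFin \o (fun x => A * expR (- (c * M)) * expR ((2 * c) * phi x))).
    by have := integrableZl measurableT (A * expR (- (c * M))) (exp_integrable mB).
  apply: le_trans (Rintegral_norm_le _ i2 _) _.
  - by apply: measurable_funB => //; apply: measurable_funM.
  - move=> x; rewrite -{1}[h x]mulr1 -mulrBr normrM.
    rewrite (@ger0_norm _ (1 - _)) ?subr_ge0 ?plateau_le1//.
    apply: (@le_trans _ _ (A * expR (c * phi x) * (1 - plateau M x))).
      by rewrite ler_wpM2r// subr_ge0 plateau_le1.
    by rewrite -(mulrA A _ (1 - _)) -(mulrA A) ler_wpM2l//; apply: plateau_tail; exact: ltW.
  rewrite RintegralZl//; last exact: exp_integrable mB.
  apply: le_trans MP; rewrite ler_wpM2l ?mulr_ge0 ?expR_ge0//.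
  exact: exp_Rintegral_le.
have hpC : Cb (fun x => h x * plateau M x).
  split; first by move=> x; apply: cvgM; [exact: ch|exact: plateau_continuous].
  exists (A * expR (c * (M + 1))) => x.
  rewrite normrM (ger0_norm (plateau_ge0 _ _)).
  have [hx|hx] := leP (phi x) (M + 1).
    apply: (@le_trans _ _ `|h x|); first by rewrite ler_piMr ?plateau_le1.
    by apply: le_trans (hA x) _; rewrite ler_wpM2l// ler_expR ler_wpM2l// ltW.
  rewrite /plateau (_ : Num.min _ _ = 0); last first.
    by rewrite max_l ?min_r//; lra.
  by rewrite mulr0 mulr_ge0// expR_ge0.
have := (cvg_pphi_order1 nu_ nu).1 nu_cvg _ (or_intror hpC).
move=> /cvgrPdist_le/(_ _ e3); apply: filterS => k hk.
have := tail nu nuB1 nuB; have := tail (nu_ k) (nukB1 k) (nukB k); move: hk.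
set a := \int[nu]_x h x; set b := \int[nu]_x (h x * plateau M x).
set d := \int[nu_ k]_x h x; set f := \int[nu_ k]_x (h x * plateau M x).
move=> h1 h2 h3; rewrite (_ : a - d = (a - b) + ((b - f) - (d - f))); last by ring.
by apply: le_trans (ler_normD _ _) _; have := ler_normB (b - f) (d - f); lra.
Qed.

Variables (V_ : nat -> E -> R) (V : E -> R) (C : R).
Hypothesis C_gt0 : 0 < C.
Hypothesis V_equicontinuous : forall x (e : R), 0 < e ->
  \forall y \near x, forall k, `|V_ k x - V_ k y| <= e.
Hypothesis V_cvg : forall x, V_ ^~ x @ \oo --> V x.
Hypothesis V_le : forall k x, `|V_ k x| <= C * (1 + phi x).

Lemma equicontinuous_limit_le x : `|V x| <= C * (1 + phi x).
Proof.
apply: (cvgr_to_le (cvg_norm (V_cvg (x := x)))).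
by apply: nearW => k; exact: V_le.
Qed.

Lemma equicontinuous_limit_near x (e : R) : 0 < e ->
  \forall y \near x, `|V x - V y| <= e.
Proof.
move=> e0; apply: filterS (V_equicontinuous x e0) => y hy.
apply: (cvgr_to_le (cvg_norm (cvgB (V_cvg (x := x)) (V_cvg (x := y))))).
by apply: nearW => k; exact: hy.
Qed.

Lemma equicontinuous_limit_continuous : continuous V.
Proof. by move=> x; apply/cvgrPdist_le => e e0; exact: equicontinuous_limit_near. Qed.

(** One envelope for all indices k >= n. Equicontinuity makes it continuous, so that it may be
    integrated against the moving measures. *)
Let gap n x := sup [set `|V_ k x - V x| | k in [set k | (n <= k)%N]].

Let gap_ub n x : ubound [set `|V_ k x - V x| | k in [set k | (n <= k)%N]]
  (2 * (C * (1 + phi x))).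
Proof.
move=> _ [k _ <-]; apply: le_trans (ler_normB _ _) _.
by have := V_le k x; have := equicontinuous_limit_le x; lra.
Qed.

Let gap_ge n k x : (n <= k)%N -> `|V_ k x - V x| <= gap n x.
Proof. by move=> nk; apply: ub_le_sup; [eexists; exact: gap_ub|exists k]. Qed.

Let gap_le n x : gap n x <= 2 * (C * (1 + phi x)).
Proof. by apply: ge_sup; [exists `|V_ n x - V x|, n => //=|exact: gap_ub]. Qed.

Let gap_ge0 n x : 0 <= gap n x.
Proof. exact: le_trans (gap_ge x (leqnn n)). Qed.

Let gap_continuous n : continuous (gap n).
Proof.
move=> x; apply/cvgrPdist_le => e e0; have e2 : 0 < e / 2 by rewrite divr_gt0.
have key y z : (forall k, `|V_ k y - V_ k z| <= e / 2) -> `|V y - V z| <= e / 2 ->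
    gap n y <= gap n z + e.
  move=> h1 h2; apply: ge_sup; first by exists `|V_ n y - V y|, n => //=.
  move=> _ [k nk <-]; have := gap_ge z nk; have := h1 k.
  rewrite (_ : V_ k y - V y = (V_ k y - V_ k z) + ((V_ k z - V z) - (V y - V z)));
    last by ring.
  move=> h3 h4; apply: le_trans (ler_normD _ _) _.
  by have := ler_normB (V_ k z - V z) (V y - V z); lra.
apply: filterS2 (V_equicontinuous x e2) (equicontinuous_limit_near x e2) => y h1 h2.
have k1 := key x y h1 h2.
have k2 : gap n y <= gap n x + e.
  by apply: key => [k|]; rewrite distrC.
by rewrite ler_norml; apply/andP; split; lra.
Qed.

Let gap_cvg x : gap n x @[n --> \oo] --> 0.
Proof.
apply/cvgrPdist_le => e e0.
have /cvgrPdist_le/(_ _ e0)[N _ NP] := V_cvg (x := x).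
exists N => // n /= Nn; rewrite sub0r normrN ger0_norm//.
apply: ge_sup; first by exists `|V_ n x - V x|, n => //=.
by move=> _ [k nk <-]; rewrite distrC; apply: NP => /=; exact: leq_trans nk.
Qed.

Let expV_le (v : R) (a : R) x : `|v| <= a * (1 + phi x) -> 0 <= a ->
  expR (- v) <= expR a * expR (a * phi x).
Proof.
move=> va a0; rewrite -expRD ler_expR; have := ler_norm (- v); rewrite normrN.
by move: va; rewrite mulrDr mulr1; lra.
Qed.

(** Integrand and measure move together. For k >= n the change of integrand is dominated by the
    function w n, independent of k; its integrals converge as k grows, and their limit is small for
    n large. *)
Lemma cvg_equicontinuous_exp g : Cb g ->
  \int[nu_ k]_x (g x * expR (- V_ k x)) @[k --> \oo] --> \int[nu]_x (g x * expR (- V x)).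
Proof.
move=> gC; have [cg [A gA]] := gC.
have A0 : 0 <= A by exact: le_trans (gA point).
have C3 : 0 < 3 * C by rewrite mulr_gt0.
have [B [nuB nukB]] := exp_moments C3.
have [B1 [nuB1 nukB1]] := exp_moments C_gt0.
have cV := equicontinuous_limit_continuous.
have cexp (f : E -> R) : continuous f -> continuous (fun x => expR (f x)).
  by move=> cf x; apply: continuous_comp; [exact: cf|exact: continuous_expR].
have cNV : continuous (fun x => - V x) by move=> x; apply: cvgN; exact: cV.
have cV_ k : continuous (V_ k).
  move=> x; apply/cvgrPdist_le => e e0.
  by apply: filterS (V_equicontinuous x e0) => y; exact.
have cNV_ k : continuous (fun x => - V_ k x) by move=> x; apply: cvgN; exact: cV_.
pose w n x := A * expR (- V x) * (expR (gap n x) - 1).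
have w0 n x : 0 <= w n x.
  rewrite mulr_ge0// ?mulr_ge0 ?expR_ge0// subr_ge0.
  by rewrite -expR0 ler_expR.
(* The constant 3 C adds the bound C on V and the bound 2 C on [gap]. *)
have wA n x : `|w n x| <= (A * expR (3 * C)) * expR (3 * C * phi x).
  rewrite ger0_norm// /w -!mulrA ler_wpM2l//.
  apply: (@le_trans _ _ (expR (- V x) * expR (gap n x))).
    by rewrite ler_wpM2l ?expR_ge0// gerBl.
  rewrite -!expRD ler_expR.
  have := gap_le n x; have := equicontinuous_limit_le x; have := ler_norm (- V x).
  by rewrite normrN; lra.
have wcont n : continuous (w n).
  move=> x; apply: cvgM; first by apply: cvgM; [exact: cvg_cst|exact: (cexp _ cNV)].
  by apply: cvgB; [exact: (cexp _ (@gap_continuous n))|exact: cvg_cst].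
have AE0 : 0 <= A * expR (3 * C) by rewrite mulr_ge0// expR_ge0.
have w_cvg n : \int[nu_ k]_x w n x @[k --> \oo] --> \int[nu]_x w n x.
  exact: (cvg_exp_order (wcont n) AE0 C3 (wA n)).
have w_cvg0 : \int[nu]_x w n x @[n --> \oo] --> 0.
  apply: (@Rintegral_cvg0 _ (borel E) R nu w
    (fun x => (A * expR (3 * C)) * expR (3 * C * phi x))) => //.
  - by move=> n; exact: continuous_borel_measurable.
  - by have := integrableZl measurableT (A * expR (3 * C)) (exp_integrable nuB).
  - move=> x; rewrite -(mulr0 (A * expR (- V x))); apply: cvgM; first exact: cvg_cst.
    rewrite -[X in _ --> X](subrr 1); apply: cvgB; last exact: cvg_cst.
    rewrite -[X in _ --> X]expR0; apply: (cvg_comp _ _ (gap_cvg x)).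
    exact: continuous_expR.
have gV_order (f : E -> R) x : `|f x| <= C * (1 + phi x) ->
    `|g x * expR (- f x)| <= A * expR C * expR (C * phi x).
  move=> fx; rewrite normrM (ger0_norm (expR_ge0 _)) -mulrA.
  by apply: ler_pM; rewrite ?expR_ge0//; apply: expV_le => //; exact: ltW.
have AC0 : 0 <= A * expR C by rewrite mulr_ge0// expR_ge0.
have base : \int[nu_ k]_x (g x * expR (- V x)) @[k --> \oo] -->
    \int[nu]_x (g x * expR (- V x)).
  apply: (cvg_exp_order _ AC0 C_gt0).
    by move=> x; apply: cvgM; [exact: cg|exact: (cexp _ cNV)].
  by move=> x; apply: gV_order; exact: equicontinuous_limit_le.
apply/cvgrPdist_le => e e0; have e3 : 0 < e / 3 by rewrite divr_gt0.
have /cvgrPdist_le/(_ _ e3)[n _ /(_ n (leqnn n))] := w_cvg0.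
rewrite sub0r normrN => /(le_trans (ler_norm _)) hn.
have /cvgrPdist_le/(_ _ e3) H1 := w_cvg n.
have /cvgrPdist_le/(_ _ e3) H2 := base.
near=> k.
have nk : (n <= k)%N by near: k; exact: nbhs_infty_ge.
have h1 : `|\int[nu]_x w n x - \int[nu_ k]_x w n x| <= e / 3 by near: k.
have h2 : `|\int[nu]_x (g x * expR (- V x)) - \int[nu_ k]_x (g x * expR (- V x))| <= e / 3.
  by near: k.
have mgV (f : E -> R) : continuous f -> measurable_fun [set: borel E] (fun x => g x * expR (f x)).
  move=> cf; apply: continuous_borel_measurable => x.
  by apply: cvgM; [exact: cg|exact: (cexp _ cf)].
have i1 : (nu_ k).-integrable [set: borel E] (EFin \o (fun x => g x * expR (- V_ k x))).
  apply: (exp_order_integrable (nukB1 k) (mgV _ (cNV_ k))) => x.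
  by apply: gV_order; exact: V_le.
have i2 : (nu_ k).-integrable [set: borel E] (EFin \o (fun x => g x * expR (- V x))).
  apply: (exp_order_integrable (nukB1 k) (mgV _ cNV)) => x.
  by apply: gV_order; exact: equicontinuous_limit_le.
have iw : (nu_ k).-integrable [set: borel E] (EFin \o w n).
  by apply: (exp_order_integrable (nukB k) _ (wA n)); exact: continuous_borel_measurable.
have h3 : `|\int[nu_ k]_x (g x * expR (- V_ k x)) - \int[nu_ k]_x (g x * expR (- V x))| <=
    \int[nu_ k]_x w n x.
  rewrite -RintegralB//; apply: Rintegral_norm_le => //.
    by apply: measurable_funB; exact: mgV.
  move=> x; rewrite -mulrBr normrM /w -mulrA.
  apply: ler_pM => //.
  have := gap_ge x nk; rewrite ler_norml => /andP[d1 d2].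
  have eE : expR (- V_ k x) = expR (- V x) * expR (V x - V_ k x).
    by rewrite -expRD; congr expR; ring.
  rewrite eE -{2}[expR (- V x)]mulr1 -mulrBr normrM (ger0_norm (expR_ge0 _)).
  rewrite ler_wpM2l ?expR_ge0// ler_norml; apply/andP; split; last first.
    by rewrite lerD2r ler_expR; lra.
  have : expR (- gap n x) <= expR (V x - V_ k x) by rewrite ler_expR; lra.
  have := expR_ge1Dx (gap n x); have := expR_gt0 (gap n x).
  (* e^{-s} + e^s >= 2 *)
  have : 0 <= expR (gap n x) + expR (- gap n x) - 2.
    have := expR_gt0 (gap n x); rewrite expRN; set s := expR _ => s0.
    rewrite (_ : s + s^-1 - 2 = (s - 1) ^+ 2 / s); last by field; rewrite gt_eqF.
    by rewrite divr_ge0 ?sqr_ge0// ltW.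
  by lra.
move: hn h1 h2 h3.
set a := \int[nu]_x (g x * expR (- V x)); set b := \int[nu_ k]_x (g x * expR (- V x)).
set d := \int[nu_ k]_x (g x * expR (- V_ k x)); set p := \int[nu_ k]_x w n x.
set q := \int[nu]_x w n x => hn h1 h2 h3.
rewrite (_ : a - d = (a - b) - (d - b)); last by ring.
apply: le_trans (ler_normB _ _) _.
by have := ler_norm (- (q - p)); rewrite normrN; lra.
Unshelve. all: by end_near. Qed.

End exponential_moments.

(** * Strictly feasible points of the approximate problems *)

Section Pphi_density.
Context {R : realType} {E : pmetricType R} {phi : weight E}.
Implicit Types (nu mu : Pphi phi) (g h : E -> R).

Lemma Pphi_of_density nu g (M : R) : measurable_fun [set: borel E] g ->
  (forall x, 0 <= g x <= M) -> \int[nu]_x g x = 1 ->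
  exists mu : Pphi phi, has_density mu nu g.
Proof.
move=> mg gM g1; have g0 x : 0 <= g x by have /andP[] := gM x.
have M0 : 0 <= M by have /andP[h1 /(le_trans h1)] := gM point.
have ig : nu.-integrable [set: borel E] (EFin \o g).
  apply: (integrable_dominated mg (finite_measure_integrable_cst nu M measurableT)).
  by move=> x; rewrite ger0_norm//=; have /andP[] := gM x.
have gmass : (\int[nu]_x (g x)%:E = 1)%E by rewrite -EFin_Rintegral// g1.
have dP := density_probability_has_density mg g0 gmass.
set P := density_probability mg g0 gmass in dP.
have mom : (\int[P]_x (phi x)%:E < +oo)%E.
  have mphi : measurable_fun [set: borel E] (EFin \o (phi : borel E -> R)).
    by apply/measurable_EFinP; exact: weight_measurable.
  rewrite (ge0_integral_density dP)//; last by move=> x; rewrite lee_fin weight_ge0.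
  apply: (@le_lt_trans _ _ (\int[nu]_x (M%:E * (phi x)%:E))%E).
    apply: ge0_le_integral => //.
    - by move=> x _; rewrite mule_ge0// lee_fin ?weight_ge0.
    - by apply: emeasurable_funM => //; exact/measurable_EFinP.
    - by apply: emeasurable_funM.
    - move=> x _; rewrite -!EFinM lee_fin mulrC ler_wpM2r ?weight_ge0//.
      by have /andP[] := gM x.
  rewrite ge0_integralZl//; last by move=> x _; rewrite lee_fin weight_ge0.
  by rewrite lte_mul_pinfty// ?lee_fin// pphi_moment.
by exists (MkPphi mom).
Qed.

Lemma Rintegral_normB_le nu h f (e : R) : measurable_fun [set: borel E] h ->
  nu.-integrable [set: borel E] (EFin \o h) ->
  nu.-integrable [set: borel E] (EFin \o f) ->
  (forall x, `|h x| <= e * f x) -> `|\int[nu]_x h x| <= e * \int[nu]_x f x.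
Proof.
move=> mh ih i_f hf; rewrite -RintegralZl//.
apply: (Rintegral_norm_le (g := fun x => e * f x)) => //.
by have := integrableZl measurableT e i_f.
Qed.

End Pphi_density.

Section density_approximation.
Context {R : realType} {E : pmetricType R} {phi : weight E}.
Hypothesis E_separable : separable E.
Variables (nu mu : Pphi phi).
Hypothesis munu : mu `<< nu.

(* The approximants replace mu by its conditional averages w.r.t. nu on the
   pieces of a partition of unity. *)
Lemma density_approximation : exists (g : nat -> E -> R) (mu_ : nat -> Pphi phi),
  [/\ forall n, Cb (g n), forall n x, 0 <= g n x,
      forall n, has_density (mu_ n) nu (g n) & mu_ @ \oo --> mu].
Proof.
have [x_ x_dense] := separable_dense_sequence E_separable.
have cphi := @weight_continuous R E phi.
pose p n i := piece (phi : E -> R) x_ n i.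
have pC n i : Cb (p n i) by exact: Cb_piece.
have p0 n i x : 0 <= p n i x by exact: piece_ge0.
have mp n i : measurable_fun [set: borel E] (p n i) by exact: Cb_measurable.
have ip (m : Pphi phi) n i : m.-integrable [set: borel E] (EFin \o p n i).
  exact: Cb_integrable.
have i1phi (m : Pphi phi) : m.-integrable [set: borel E] (EFin \o (fun x => 1 + phi x)).
  have := Pphi_oneDweight_integrable m 1.
  by apply: eq_integrable => // x _; rewrite /= mul1r.
have m1phi : measurable_fun [set: borel E] (fun x => 1 + phi x).
  by apply: measurable_funD => //; exact: weight_measurable.
have /choice[N_ NP] (n : nat) : exists N,
    \int[mu]_x ((1 + phi x) * (1 - \sum_(i < N) p n i x)) <= n.+1%:R^-1.
  have n0 : 0 < n.+1%:R^-1 :> R by rewrite invr_gt0.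
  have /cvgrPdist_le/(_ _ n0)[N _ /(_ N (leqnn N))] :=
    @piece_rest_cvg R E phi x_ x_dense mu n _ m1phi (@oneDweight_ge0 R E phi) (i1phi mu).
  by rewrite sub0r normrN => /(le_trans (ler_norm _)) h; exists N.
pose a n i := \int[mu]_x p n i x; pose b n i := \int[nu]_x p n i x.
have a0 n i : 0 <= a n i by apply: Rintegral_ge0.
have b0 n i : 0 <= b n i by apply: Rintegral_ge0.
(* Absolute continuity: pieces that are null for nu carry no mass of mu, so the default value 0 of a
   / b at b = 0 loses nothing. *)
have ab n i : b n i = 0 -> a n i = 0.
  move=> bni; have mpE : measurable_fun [set: borel E] (EFin \o p n i).
    exact/measurable_EFinP.
  have : (\int[nu]_x `|(p n i x)%:E| = 0)%E.
    under eq_integral do rewrite gee0_abs ?lee_fin//.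
    by have := EFin_Rintegral (ip nu n i); rewrite -/(b n i) bni => <-.
  move/(ae_eq_integral_abs nu measurableT mpE).1 => nu0.
  have mu0 := null_dominates_ae_eq measurableT munu nu0.
  have := (ae_eq_integral_abs mu measurableT mpE).2 mu0.
  under eq_integral do rewrite gee0_abs ?lee_fin//.
  by have := EFin_Rintegral (ip mu n i); rewrite -/(a n i) => <- -[].
pose S n x := \sum_(i < N_ n) p n i x.
have SC n : Cb (S n) by apply: (@Cb_sum _ _ (N_ n) (fun i => p n i)) => i.
(* The mass of mu left out by the first N_ n pieces; it is put back as a constant density with
   respect to nu. *)
pose eta n := 1 - \int[mu]_x S n x.
have S01 n x : 0 <= 1 - S n x by rewrite subr_ge0 sum_piece_le1.
have etaE n : eta n = \int[mu]_x (1 - S n x).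
  rewrite RintegralB//; [|exact/Cb_integrable/Cb_cst|exact: Cb_integrable].
  by rewrite Rintegral_probability_cst.
have eta0 n : 0 <= eta n by rewrite etaE; exact: Rintegral_ge0.
have imS n : mu.-integrable [set: borel E] (EFin \o (fun x => 1 - S n x)).
  by apply: Cb_integrable; apply: CbB => //; exact: Cb_cst.
have mS n : measurable_fun [set: borel E] (S n) by exact: Cb_measurable.
have irest n : mu.-integrable [set: borel E] (EFin \o (fun x => (1 + phi x) * (1 - S n x))).
  apply: (integrable_dominated _ (i1phi mu)).
    by apply: measurable_funM => //; apply: measurable_funB.
  move=> x; rewrite ger0_norm ?mulr_ge0 ?oneDweight_ge0//.
  by rewrite ler_piMr ?oneDweight_ge0// gerBl sum_piece_ge0.
have eta1 n : eta n <= n.+1%:R^-1.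
  rewrite etaE; apply: le_trans (NP n).
  apply: le_Rintegral; [exact: measurableT|exact: imS|exact: irest|move=> x _].
  by rewrite ler_peMl ?S01// lerDl weight_ge0.
pose g n x := (\sum_(i < N_ n) (a n i / b n i) * p n i x) + eta n.
have gC n : Cb (g n).
  apply: CbD; last exact: Cb_cst.
  by apply: (@Cb_sum _ _ (N_ n) (fun i x => a n i / b n i * p n i x)) => i; exact: CbZ.
have g0 n x : 0 <= g n x.
  by rewrite addr_ge0// sumr_ge0// => i _; rewrite mulr_ge0// divr_ge0.
have mg n : measurable_fun [set: borel E] (g n) by exact: Cb_measurable.
(* The mean of h over piece i under nu; on null pieces the value h (x_ i) is a convention that keeps
   [avg_close] valid. *)
pose avg n (h : E -> R) i :=
  if b n i == 0 then h (x_ i) else (b n i)^-1 * \int[nu]_x (h x * p n i x).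
have order_int (m : Pphi phi) n i (h : E -> R) (A : R) : continuous h ->
    (forall x, `|h x| <= A * (1 + phi x)) ->
    m.-integrable [set: borel E] (EFin \o (fun x => h x * p n i x)).
  move=> ch hA; apply: (Pphi_integrable m (A := A)).
    by apply: measurable_funM => //; exact: continuous_borel_measurable.
  move=> x; rewrite normrM (ger0_norm (p0 _ _ _)).
  apply: le_trans (hA x); rewrite ler_piMr//.
  have := sum_piece_le1 (phi : E -> R) x_ n i.+1 x; rewrite big_ord_recr/=.
  by apply: le_trans; rewrite lerDr sum_piece_ge0.
have gint n (h : E -> R) (A : R) : continuous h -> (forall x, `|h x| <= A * (1 + phi x)) ->
    \int[nu]_x (h x * g n x) = \sum_(i < N_ n) a n i * avg n h i + eta n * \int[nu]_x h x.
  move=> ch hA.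
  have mh : measurable_fun [set: borel E] h by exact: continuous_borel_measurable.
  have ih : nu.-integrable [set: borel E] (EFin \o h) by exact: Pphi_integrable mh hA.
  have i2 i : nu.-integrable [set: borel E]
      (EFin \o (fun x => (a n i / b n i) * (h x * p n i x))).
    by have := integrableZl measurableT (a n i / b n i) (order_int nu n i h A ch hA).
  have i3 : nu.-integrable [set: borel E] (EFin \o (fun x => eta n * h x)).
    by have := integrableZl measurableT (eta n) ih.
  transitivity (\int[nu]_x ((\sum_(i < N_ n) (a n i / b n i) * (h x * p n i x)) + eta n * h x)).
    apply: eq_Rintegral => x _; rewrite /g mulrDr [h x * eta n]mulrC; congr (_ + _).
    by rewrite mulr_sumr; apply: eq_bigr => i _; ring.
  rewrite (RintegralD measurableT (integrable_sum_ord (N_ n) i2) i3).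
  rewrite RintegralZl//; congr (_ + _).
  rewrite (Rintegral_sum_ord (N_ n) i2); apply: eq_bigr => i _.
  rewrite RintegralZl//; last exact: order_int hA.
  rewrite /avg; case: eqP => [/ab ->|bn]; first by rewrite !mul0r.
  by rewrite mulrA.
have gmass n : \int[nu]_x g n x = 1.
  have c1 : continuous (fun _ : E => 1 : R) by move=> x; exact: cvg_cst.
  have h1 (x : E) : `|1| <= 1 * (1 + phi x) by rewrite normr1 mul1r lerDl weight_ge0.
  have := gint n (fun=> 1) 1 c1 h1.
  under eq_Rintegral do rewrite mul1r.
  move=> ->; rewrite Rintegral_probability_cst mulr1.
  rewrite (_ : \sum_(i < N_ n) _ = \sum_(i < N_ n) a n i); last first.
    apply: eq_bigr => i _; rewrite /avg; case: eqP => [_|bn]; first by rewrite mulr1.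
    under eq_Rintegral do rewrite mul1r.
    by rewrite mulVf ?mulr1//; apply/eqP.
  rewrite /eta /S (Rintegral_sum_ord (N_ n) (fun i => ip mu n i)).
  by rewrite addrC subrK.
have /choice[mu_ muP] n : exists m : Pphi phi, has_density m nu (g n).
  have [_ [M gM]] := gC n.
  apply: (Pphi_of_density (M := M)) => // x.
  by rewrite g0/=; apply: le_trans (ler_norm _) (gM x).
exists g, mu_; split => //.
apply/cvg_pphi_order1 => h hh.
have [ch [A A0 hA]] : continuous h /\ exists2 A : R, 0 <= A & forall x, `|h x| <= A * (1 + phi x).
  case: hh => [->|hC]; last by split; [exact: hC.1|exact: Cb_order1].
  split => //; exists 1 => // x.
  by rewrite mul1r ger0_norm ?weight_ge0// lerDr.
have mh : measurable_fun [set: borel E] h by exact: continuous_borel_measurable.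
have ih (m : Pphi phi) : m.-integrable [set: borel E] (EFin \o h).
  exact: Pphi_integrable mh hA.
have avg_close n i (c e : R) : 0 <= e ->
    (forall y, spread (phi : E -> R) x_ i y < 2 * n.+1%:R^-1 -> `|h y - c| <= e) ->
    `|avg n h i - c| <= e.
  move=> e0 he; rewrite /avg; case: eqP => [_|bn].
    apply: he; rewrite /spread mdistxx subrr normr0 addr0.
    by rewrite mulr_gt0// invr_gt0.
  have bn0 : 0 < b n i by rewrite lt_neqAle b0 andbT eq_sym; exact/eqP.
  have ihc : nu.-integrable [set: borel E] (EFin \o (fun x => (h x - c) * p n i x)).
    apply: (order_int nu n i (fun x => h x - c) (A + `|c|)).
      by move=> x; apply: cvgB; [exact: ch|exact: cvg_cst].
    move=> x; apply: le_trans (ler_normB _ _) _; rewrite mulrDl lerD//.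
    by rewrite ler_peMr// lerDl weight_ge0.
  have -> : (b n i)^-1 * \int[nu]_x (h x * p n i x) - c =
      (b n i)^-1 * \int[nu]_x ((h x - c) * p n i x).
    have ic : nu.-integrable [set: borel E] (EFin \o (fun x => c * p n i x)).
      by have := integrableZl measurableT c (ip nu n i).
    have iho : nu.-integrable [set: borel E] (EFin \o (fun x => h x * p n i x)).
      exact: order_int hA.
    have -> : \int[nu]_x ((h x - c) * p n i x) = \int[nu]_x (h x * p n i x) - c * b n i.
      rewrite /b -(RintegralZl c measurableT (ip nu n i)) -(RintegralB measurableT iho ic).
      by apply: eq_Rintegral => x _; rewrite mulrBl.
    by rewrite mulrBr mulrCA mulVf ?mulr1// gt_eqF.
  rewrite normrM ger0_norm ?invr_ge0// ler_pdivrMl// mulrC.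
  apply: Rintegral_normB_le => //.
    apply: measurable_funM => //; exact: measurable_funB.
  move=> x; rewrite normrM (ger0_norm (p0 _ _ _)).
  have [->|] := eqVneq (p n i x) 0; first by rewrite !mulr0.
  by move=> /piece_near/he; apply: ler_wpM2r.
pose r n x := \sum_(i < N_ n) `|avg n h i - h x| * p n i x.
have mr n : measurable_fun [set: borel E] (r n).
  apply: measurable_sum => i; apply: measurable_funM => //.
  by apply: measurableT_comp => //; apply: measurable_funB.
(* The radius 4 / (n + 1) is twice that of a piece: x and y are compared through the centre x_ i. *)
have r_bound n (e : R) x : 0 <= e ->
    (forall y, mdist x y + `|phi x - phi y| < 4 * n.+1%:R^-1 -> `|h x - h y| <= e) ->
    r n x <= e.
  move=> e0 he; apply: (@le_trans _ _ (\sum_(i < N_ n) e * p n i x)).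
    apply: ler_sum => i _; have [->|] := eqVneq (p n i x) 0; first by rewrite !mulr0.
    move=> /piece_near; rewrite /spread => xi_; apply: ler_wpM2r => //.
    apply: avg_close => // y; rewrite /spread => yi; rewrite distrC; apply: he.
    have := metric_triangle x (x_ i) y; rewrite (metric_sym (x_ i) y).
    have := ler_normB (phi x - phi (x_ i)) (phi y - phi (x_ i)).
    rewrite (_ : phi x - phi (x_ i) - (phi y - phi (x_ i)) = phi x - phi y); last by ring.
    by move: xi_ yi; set u := _^-1; lra.
  by rewrite -mulr_sumr ler_piMr// sum_piece_le1.
have r0 n x : 0 <= r n x by apply: sumr_ge0 => i _; rewrite mulr_ge0.
(* The factor 6 bounds |h x| + |h y| when phi x and phi y differ by less than 4, that is A (1 + phi
   x) + A (5 + phi x). *)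
have i6 : mu.-integrable [set: borel E] (EFin \o (fun x => 6 * A * (1 + phi x))).
  exact: Pphi_oneDweight_integrable.
have r_cvg : \int[mu]_x r n x @[n --> \oo] --> 0.
  apply: (@Rintegral_cvg0 _ (borel E) R mu r (fun x => 6 * A * (1 + phi x))) => //.
  - move=> n x; rewrite ger0_norm//; apply: r_bound.
      by rewrite mulr_ge0 ?oneDweight_ge0// mulr_ge0.
    move=> y xy; apply: le_trans (ler_normB _ _) _.
    have n1 : n.+1%:R^-1 <= 1 :> R by rewrite invf_le1 ?ler1n.
    have hy : `|h y| <= A * (5 + phi x).
      apply: le_trans (hA y) _; rewrite ler_wpM2l//.
      have := mdist_ge0 x y; have := ler_norm (- (phi x - phi y)); rewrite normrN.
      by move: xy n1; set u := _^-1; lra.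
    have hp : 0 <= A * phi x by rewrite mulr_ge0// weight_ge0.
    by have := hA x; lra.
  - move=> x; apply/cvgrPdist_le => e e0.
    have := continuous_spread (phi : E -> R) x (ltr0Sn _ 3) ch e0.
    apply: filterS => n hn; rewrite sub0r normrN ger0_norm//.
    by apply: r_bound => //; exact: ltW.
have hS n : mu.-integrable [set: borel E] (EFin \o (fun x => h x * (1 - S n x))).
  apply: (integrable_dominated _ (Pphi_oneDweight_integrable mu A)).
    by apply: measurable_funM => //; apply: measurable_funB.
  move=> x; rewrite normrM (ger0_norm (S01 n x)); apply: le_trans (hA x).
  by rewrite ler_piMr// gerBl sum_piece_ge0.
have ir n : mu.-integrable [set: borel E] (EFin \o r n).
  apply: (@integrable_sum_ord _ (borel E) R mu (N_ n)
    (fun i x => `|avg n h i - h x| * p n i x)) => i.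
  apply: (order_int mu n i (fun x => `|avg n h i - h x|) (`|avg n h i| + A)).
    by move=> x; apply: cvg_norm; apply: cvgB; [exact: cvg_cst|exact: ch].
  move=> x; rewrite normr_id; apply: le_trans (ler_normB _ _) _; rewrite mulrDl lerD//.
  by rewrite ler_peMr// lerDl weight_ge0.
have main n : `|\int[mu_ n]_x h x - \int[mu]_x h x| <=
    \int[mu]_x r n x + (A + `|\int[nu]_x h x|) * n.+1%:R^-1.
  rewrite (Rintegral_density (muP n) mh) (gint n h A ch hA).
  have ihp i : mu.-integrable [set: borel E] (EFin \o (fun x => h x * p n i x)).
    exact: order_int hA.
  have iap i : mu.-integrable [set: borel E] (EFin \o (fun x => avg n h i * p n i x)).
    by have := integrableZl measurableT (avg n h i) (ip mu n i).
  have idp i : mu.-integrable [set: borel E] (EFin \o (fun x => (avg n h i - h x) * p n i x)).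
    apply: (order_int mu n i (fun x => avg n h i - h x) (`|avg n h i| + A)).
      by move=> x; apply: cvgB; [exact: cvg_cst|exact: ch].
    move=> x; apply: le_trans (ler_normB _ _) _; rewrite mulrDl lerD//.
    by rewrite ler_peMr// lerDl weight_ge0.
  have E1 : \int[mu]_x h x = \sum_(i < N_ n) \int[mu]_x (h x * p n i x) +
      \int[mu]_x (h x * (1 - S n x)).
    rewrite -(Rintegral_sum_ord (N_ n) ihp).
    rewrite -(RintegralD measurableT (integrable_sum_ord (N_ n) ihp) (hS n)).
    by apply: eq_Rintegral => x _; rewrite -mulr_sumr -/(S n x); ring.
  have E2 i : a n i * avg n h i - \int[mu]_x (h x * p n i x) =
      \int[mu]_x ((avg n h i - h x) * p n i x).
    rewrite mulrC /a -(RintegralZl _ measurableT (ip mu n i)).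
    rewrite -(RintegralB measurableT (iap i) (ihp i)).
    by apply: eq_Rintegral => x _; rewrite mulrBl.
  rewrite E1 (_ : _ - _ = \sum_(i < N_ n) (a n i * avg n h i - \int[mu]_x (h x * p n i x))
    + (eta n * \int[nu]_x h x - \int[mu]_x (h x * (1 - S n x)))); last first.
    by rewrite sumrB; ring.
  apply: le_trans (ler_normD _ _) _; apply: lerD.
    rewrite (_ : \sum_(i < N_ n) _ =
      \sum_(i < N_ n) \int[mu]_x ((avg n h i - h x) * p n i x)); last first.
      by apply: eq_bigr => i _; exact: E2.
    rewrite -(Rintegral_sum_ord (N_ n) idp).
    apply: Rintegral_norm_le => //.
      by apply: measurable_sum => i; apply: measurable_funM => //; apply: measurable_funB.
    move=> x; apply: le_trans (ler_norm_sum _ _ _) _; apply: ler_sum => i _.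
    by rewrite normrM (ger0_norm (p0 _ _ _)).
  apply: le_trans (ler_normB _ _) _; rewrite [leLHS]addrC [leRHS]mulrDl; apply: lerD.
    apply: (@le_trans _ _ (A * \int[mu]_x ((1 + phi x) * (1 - S n x)))).
      apply: Rintegral_normB_le => //.
        by apply: measurable_funM => //; apply: measurable_funB.
      by move=> x; rewrite normrM (ger0_norm (S01 n x)) mulrA ler_wpM2r.
    by apply: ler_wpM2l => //; exact: NP.
  by rewrite normrM (ger0_norm (eta0 n)) mulrC ler_wpM2l.
apply/cvgrPdist_le => e e0; have e2 : 0 < e / 2 by rewrite divr_gt0.
pose K := 1 + A + `|\int[nu]_x h x|.
have K0 : 0 < K by rewrite /K -addrA ltr_pwDl// addr_ge0.
have eK : 0 < e / 2 / K by rewrite divr_gt0.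
have /cvgrPdist_le/(_ _ e2) H1 := r_cvg.
have H2 := near_infty_natSinv_lt (PosNum eK).
apply: filterS2 H1 H2 => n; rewrite sub0r normrN => /(le_trans (ler_norm _)) h1 /= h2.
rewrite distrC; apply: le_trans (main n) _; rewrite [leRHS]splitr; apply: lerD => //.
have hK : (A + `|\int[nu]_x h x|) * n.+1%:R^-1 <= K * n.+1%:R^-1.
  by rewrite ler_wpM2r ?invr_ge0// /K -addrA lerDr.
apply: le_trans hK _; rewrite mulrC -ler_pdivlMr//; exact: ltW.
Qed.

End density_approximation.

Section slater.
Context {R : realType} {E : pmetricType R} {phi : weight E}.
Hypothesis E_separable : separable E.
Variables (nu : Pphi phi) (nu_ : nat -> Pphi phi).
Hypothesis nu_cvg : nu_ @ \oo --> nu.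
Hypothesis exp_moments : forall a : R, 0 < a -> exists B : R,
  exp_moment_le nu a B /\ forall k, exp_moment_le (nu_ k) a B.

(** A continuous bounded density keeps its meaning when nu is replaced by nu_ k, up to the
    normalisation Z k, which tends to 1. *)
Lemma density_transfer (g : E -> R) (mu : Pphi phi) : Cb g -> (forall x, 0 <= g x) ->
  has_density mu nu g ->
  exists (mu_ : nat -> Pphi phi) (M : R),
    [/\ 1 <= M, forall k, exists2 h : E -> R, has_density (mu_ k) (nu_ k) h &
          forall x, h x <= M & mu_ @ \oo --> mu].
Proof.
move=> gC g0 dg; have [cg [M gM]] := gC.
have M0 : 0 <= M by exact: le_trans (gM point).
have mg : measurable_fun [set: borel E] g by exact: Cb_measurable.
pose Z k := \int[nu_ k]_x g x.
have Z1 : Z k @[k --> \oo] --> (1 : R).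
  rewrite -(has_density_mass dg).
  exact: (cvg_pphi_order1 nu_ nu).1 nu_cvg _ (or_intror gC).
(* For the finitely many k at which Z k may be small, nu_ k itself is used; all densities are then
   bounded by 1 + 2 M. *)
have /choice[mu_ muP] k : exists m : Pphi phi, if 2^-1 < Z k
    then has_density m (nu_ k) (fun x => (Z k)^-1 * g x) else m = nu_ k.
  case: (boolP (2^-1 < Z k)) => [Zk|_]; last by exists (nu_ k).
  have Z0 : 0 < Z k by apply: lt_trans Zk; rewrite invr_gt0.
  apply: (Pphi_of_density (M := (Z k)^-1 * M)).
  - by apply: measurable_funM.
  - move=> x; have Zi0 : 0 <= (Z k)^-1 by rewrite invr_ge0 ltW.
    rewrite mulr_ge0//=; apply: ler_wpM2l => //.
    exact: le_trans (ler_norm _) (gM x).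
  - rewrite RintegralZl//; last exact: Cb_integrable.
    by rewrite mulVf// gt_eqF.
have half1 : 2^-1 < 1 :> R by lra.
have Znear : \forall k \near \oo, 2^-1 < Z k by exact: (cvgr_gt 1 Z1).
exists mu_, (1 + 2 * M); split.
- by rewrite lerDl mulr_ge0.
- move=> k; have := muP k; case: ifPn => [Zk dk|_ ->].
    exists (fun x => (Z k)^-1 * g x) => // x.
    have Z0 : 0 < Z k by apply: lt_trans Zk; rewrite invr_gt0.
    rewrite mulrC ler_pdivrMr//.
    have gx : g x <= M by exact: le_trans (ler_norm _) (gM x).
    apply: le_trans gx _; have : (1 + 2 * M) * 2^-1 <= (1 + 2 * M) * Z k.
      by apply: ler_wpM2l; [rewrite addr_ge0// mulr_ge0|exact: ltW].
    by apply: le_trans; lra.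
  exists (cst 1) => [|x /=]; first exact: has_density_self.
  by rewrite lerDl mulr_ge0.
apply/cvg_pphi_order1 => h hh.
have [ch [A A0 hA]] : continuous h /\ exists2 A : R, 0 <= A & forall x, `|h x| <= A * (1 + phi x).
  case: hh => [->|hC]; last by split; [exact: hC.1|exact: Cb_order1].
  split; first exact: weight_continuous.
  exists 1 => // x.
  by rewrite mul1r ger0_norm ?weight_ge0// lerDr.
have mh : measurable_fun [set: borel E] h by exact: continuous_borel_measurable.
have hg_cvg : \int[nu_ k]_x (h x * g x) @[k --> \oo] --> \int[nu]_x (h x * g x).
  apply: (cvg_exp_order nu_cvg exp_moments (A := A * M) (c := 1)) => //.
  - by move=> x; apply: cvgM; [exact: ch|exact: cg].
  - exact: mulr_ge0.
  move=> x; rewrite normrM mul1r [A * M]mulrC -mulrA mulrC; apply: ler_pM => //.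
  by apply: le_trans (hA x) _; rewrite ler_wpM2l// oneD_weight_le_exp.
rewrite (Rintegral_density dg mh).
have L : (Z k)^-1 * \int[nu_ k]_x (h x * g x) @[k --> \oo] --> \int[nu]_x (h x * g x).
  have Zi : (Z k)^-1 @[k --> \oo] --> (1 : R)^-1 by apply: cvgV => //; exact: oner_neq0.
  have := cvgM Zi hg_cvg; rewrite invr1 mul1r.
  by apply.
apply: cvg_trans L; apply: near_eq_cvg; apply: filterS Znear => k Zk.
have := muP k; rewrite Zk => dk.
have ihg : (nu_ k).-integrable [set: borel E] (EFin \o (fun x => h x * g x)).
  apply: (Pphi_integrable _ (A := A * M)); first exact: measurable_funM.
  move=> x; rewrite normrM mulrAC; exact: ler_pM.
rewrite (Rintegral_density dk mh) -RintegralZl//.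
by apply: eq_Rintegral => x _; ring.
Qed.

Variables (S_ : nat -> Pphi phi -> \bar R) (S : Pphi phi -> \bar R).
Hypothesis S_lim : forall mu, cvgn (S_ ^~ mu) /\ (limn (S_ ^~ mu) <= S mu)%E.
Hypothesis S_equi : forall (mul : nat -> Pphi phi) (mu : Pphi phi), mul @ \oo --> mu ->
  (fun l => ereal_sup (range (fun k => `| S_ k (mul l) - S_ k mu |))%E) @ \oo --> 0%E.

(** mu is approximated by a measure with continuous bounded density, which is then transferred to
    the nu_ k. The bound on the densities controls the entropies; uniformity of [S_equi] in k lets
    each of the two approximations cost at most d out of an initial margin 3 d. *)
Lemma slater_sequence (mu : Pphi phi) : mu `<< nu -> (S mu < 0)%E ->
  exists (mut : nat -> Pphi phi) (k0 : nat) (M d : R),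
    [/\ forall k, has_bounded_density (mut k) (nu_ k),
        forall k, (rel_entropy (mut k) (nu_ k) <= M%:E)%E, 0 < d &
        forall k, (k0 <= k)%N -> (S_ k (mut k) <= (- d)%:E)%E].
Proof.
move=> munu Smu.
have [d d0 Sd] : exists2 d : R, 0 < d & (S mu < (- (3 * d))%:E)%E.
  case: (S mu) Smu => [r| |]//=.
    rewrite lte_fin => r0; exists (- r / 4); first by rewrite divr_gt0// oppr_gt0.
    by rewrite lte_fin; lra.
  by move=> _; exists 1 => //; rewrite ltNyr.
have H1 : \forall k \near \oo, (S_ k mu < (- (3 * d))%:E)%E.
  have [cS lS] := S_lim mu.
  have : (limn (S_ ^~ mu) < (- (3 * d))%:E)%E by exact: le_lt_trans lS Sd.
  move=> ltl; have nb : nbhs (limn (S_ ^~ mu)) [set y | (y < (- (3 * d))%:E)%E].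
    by apply: open_nbhs_nbhs; split => //; exact: open_ereal_lt_ereal.
  exact: (cS _ nb).
have small (v : nat -> \bar R) : v @ \oo --> 0%E -> \forall l \near \oo, (v l < d%:E)%E.
  move=> v0; have nb : nbhs 0%E [set y : \bar R | (y < d%:E)%E].
    by apply: open_nbhs_nbhs; split; [exact: open_ereal_lt_ereal|rewrite /= lte_fin].
  exact: (v0 _ nb).
have dist (a b : \bar R) (c : R) : (`|a - b| < d%:E)%E -> (b <= c%:E)%E -> (a <= (c + d)%:E)%E.
  case: a b => [a| |] [b| |]//=; rewrite ?lte_fin ?lee_fin//.
  by have := ler_norm (a - b); lra.
have [g [mul [gC g0 dg mulcvg]]] := density_approximation E_separable munu.
have [l _ /(_ l (leqnn l)) /= hl] := small _ (S_equi mulcvg).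
have [mut [M [M1 dM mutcvg]]] := density_transfer (gC l) (g0 l) (dg l).
have H2 := small _ (S_equi mutcvg).
have sup_le (f : nat -> \bar R) k (c : R) : (ereal_sup (range f) < c%:E)%E -> (f k < c%:E)%E.
  by apply: le_lt_trans; apply: ereal_sup_ubound; exists k.
have [k1 _ hk1] := H1; have [k2 _ hk2] := H2.
exists mut, (maxn k1 k2), (ln M + 1), d; split => // k.
- by have [h dh hM] := dM k; exact: has_density_bounded dh hM.
- by have [h dh hM] := dM k; exact: rel_entropy_bounded dh M1 hM.
rewrite geq_max => /andP[kk1 kk2].
have h1 := ltW (hk1 k kk1).
have h2 := dist _ _ _ (sup_le _ k _ hl) h1.
have h3 := dist _ _ _ (sup_le _ k _ (hk2 k kk2)) h2.
by apply: le_trans h3 _; rewrite lee_fin; lra.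
Qed.

End slater.

(** * Lagrange multipliers *)

Section nonpositive_integral.
Context {R : realType} {T : pmetricType R}.
Hypothesis T_compact : compact [set: T].
Variable lambda : Mplus T.

Lemma mass_ballE (C : R) : mass_ball C lambda = (fine (lambda setT) <= C) :> Prop.
Proof. by rewrite /mass_ball/= Rintegral_cst// mul1r. Qed.

Lemma Rintegral_nonpos_eq0 (f : T -> R) : continuous f -> (forall t, f t <= 0) ->
  \int[lambda]_t f t = 0 ->
  {ae (lambda : {finite_measure set (borel T) -> \bar R}), forall t, f t = 0}.
Proof.
move=> cf f0 If; have intf := Mplus_integrable T_compact lambda cf.
have mf : measurable_fun [set: borel T] (EFin \o f) by exact: measurable_int intf.
have eq0 : (\int[lambda]_t `|(f t)%:E| = 0)%E.
  rewrite (_ : (\int[lambda]_t _)%E = (\int[lambda]_t (-1 * f t)%:E)%E); last first.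
    by apply: eq_integral => t _; rewrite /= ler0_norm ?mulN1r//; exact: f0.
  have iN : lambda.-integrable [set: borel T] (EFin \o (fun t => -1 * f t)).
    by have := integrableZl measurableT (-1) intf.
  by rewrite -EFin_Rintegral// RintegralZl// If mulr0.
have := (ae_eq_integral_abs lambda measurableT mf).1 eq0.
by apply: filterS => t /(_ I) [].
Qed.

Lemma Rintegral_ae_eq0 (f : T -> R) : continuous f ->
  {ae (lambda : {finite_measure set (borel T) -> \bar R}), forall t, f t = 0} ->
  \int[lambda]_t f t = 0.
Proof.
move=> cf f0; have intf := Mplus_integrable T_compact lambda cf.
have mf : measurable_fun [set: borel T] (EFin \o f) by exact: measurable_int intf.
rewrite /Rintegral (@ae_eq_integral _ _ _ _ setT (cst 0%E))// ?integral0//.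
by have Fl := ae_filter_ringOfSetsType lambda; move: f0; apply: filterS => t /= -> _.
Qed.

End nonpositive_integral.

(** * The linearised problem and its multiplier *)

Section linearisation.
Context {R : realType} {E : pmetricType R} {phi : weight E} {T : pmetricType R}.
Hypothesis T_compact : compact [set: T].
Variables (nu mub : Pphi phi) (F : Pphi phi -> \bar R) (Theta : T -> Pphi phi -> R).
Variables (dF : E -> R) (dTheta : T -> E -> R).
Hypothesis F_Ny : forall mu, (-oo < F mu)%E.
Hypothesis F_convex : convex_functional F.
Hypothesis Theta_convex : forall t, convex_functional (fun mu => (Theta t mu)%:E).
Hypothesis reg : regular_at nu F Theta mub dF dTheta.
Local Notation J := (penalised nu F).
Local Notation D := (penalised_dom nu F).
Local Notation H mu := (fine (rel_entropy mu nu)).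

Lemma convex_derivative_le (C : set (Pphi phi)) (G : Pphi phi -> R) (dG : E -> R) mu :
  is_derivative_at C G mub dG ->
  C mu -> (forall e, 0 <= e <= 1 -> G (mix e mub mu) <= (1 - e) * G mub + e * G mu) ->
  \int[mu]_x dG x <= G mu - G mub.
Proof.
move=> [_ _ _ dlim nrm] Cmu conv.
have := dlim mu Cmu; rewrite nrm subr0 => L; apply: (cvgr_to_le L).
near=> e.
have e0 : 0 < e by near: e; exact: nbhs_right_gt.
have e1 : e <= 1 by near: e; apply: nbhs_right_le.
rewrite mulrC ler_pdivrMr//.
have := conv e; rewrite (ltW e0) e1 => /(_ isT); lra.
Unshelve. all: by end_near. Qed.

Lemma constraint_derivative_le t (mu : Pphi phi) :
  \int[mu]_x dTheta t x <= Theta t mu - Theta t mub.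
Proof.
apply: (convex_derivative_le (regular_constraint_derivative reg t)) => // e e01.
exact: (constraint_mix Theta_convex).
Qed.

Lemma penalty_derivative_le mu : D mu -> D mub ->
  \int[mu]_x dF x <= fine (F mu) - fine (F mub).
Proof.
move=> Dmu Dmub; apply: (convex_derivative_le (regular_derivative reg)) => // e e01.
exact: (penalised_mix F_Ny F_convex e01 Dmub Dmu).
Qed.

Variable B : R.
Hypothesis B_ge0 : 0 <= B.
Hypothesis dF_le : forall x, `|dF x| <= B * (1 + phi x).
Hypothesis dTheta_le : forall t x, `|dTheta t x| <= B * (1 + phi x).

Lemma dF_measurable : measurable_fun [set: borel E] dF.
Proof. by have [_ ? _ _ _] := regular_derivative reg. Qed.

Lemma dTheta_measurable t : measurable_fun [set: borel E] (dTheta t).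
Proof. by have [_ ? _ _ _] := regular_constraint_derivative reg t. Qed.

Lemma dF_integrable (mu : Pphi phi) : mu.-integrable [set: borel E] (EFin \o dF).
Proof. exact: Pphi_integrable dF_measurable dF_le. Qed.

Lemma dTheta_integrable t (mu : Pphi phi) : mu.-integrable [set: borel E] (EFin \o dTheta t).
Proof. exact: Pphi_integrable (@dTheta_measurable t) (dTheta_le t). Qed.

Let dTheta_cont x : continuous (dTheta ^~ x).
Proof. exact: (regular_derivative_continuous reg). Qed.

Definition potential (lambda : Mplus T) x := dF x + \int[lambda]_t dTheta t x.

Lemma potential_measurable lambda : measurable_fun [set: borel E] (potential lambda).
Proof.
apply: measurable_funD; first exact: dF_measurable.
apply: (measurable_Rintegral_continuous T_compact lambda).
  exact: dTheta_measurable.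
exact: dTheta_cont.
Qed.

Lemma potential_le (lambda : Mplus T) x :
  `|potential lambda x| <= B * (1 + fine (lambda setT)) * (1 + phi x).
Proof.
apply: le_trans (ler_normD _ _) _.
have h := Rintegral_continuous_le T_compact (X := borel E) lambda dTheta_cont dTheta_le x.
by have := dF_le x; move: h; set u := fine _; lra.
Qed.

Lemma potential_integrable lambda (mu : Pphi phi) :
  mu.-integrable [set: borel E] (EFin \o potential lambda).
Proof. exact: Pphi_integrable (potential_measurable lambda) (potential_le lambda). Qed.

Lemma dTheta_mean_continuous (mu : Pphi phi) :
  continuous (fun t => \int[mu]_x dTheta t x).
Proof.
exact: (continuous_Rintegral_parameter dTheta_measurable dTheta_cont dTheta_le
  (Pphi_oneDweight_integrable mu B)).
Qed.

Lemma Rintegral_potential lambda (mu : Pphi phi) : \int[mu]_x potential lambda x =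
  \int[mu]_x dF x + \int[lambda]_t (\int[mu]_x dTheta t x).
Proof.
have mI : measurable_fun [set: borel E] (fun x => \int[lambda]_t dTheta t x).
  apply: (measurable_Rintegral_continuous T_compact lambda).
    exact: dTheta_measurable.
  exact: dTheta_cont.
have iI : mu.-integrable [set: borel E] (EFin \o (fun x => \int[lambda]_t dTheta t x)).
  apply: (Pphi_integrable mu (A := fine (lambda setT) * B)) => // x.
  have := Rintegral_continuous_le T_compact (X := borel E) lambda dTheta_cont dTheta_le x.
  by rewrite mulrA.
rewrite (RintegralD measurableT (dF_integrable mu) iI); congr (_ + _).
exact: (Rintegral_exchange T_compact lambda dTheta_measurable dTheta_cont dTheta_le
  (Pphi_oneDweight_integrable mu B)).
Qed.

Lemma Rintegral_potential_mub lambda : \int[mub]_x potential lambda x = 0.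
Proof.
rewrite Rintegral_potential.
have [_ _ _ _ ->] := regular_derivative reg; rewrite add0r.
rewrite (_ : (fun t => _) = cst 0); last first.
  by apply/funext => t; have [_ _ _ _ ->] := regular_constraint_derivative reg t.
by rewrite /Rintegral integral0.
Qed.

Definition linear_constraint (mu : Pphi phi) t := Theta t mub + \int[mu]_x dTheta t x.

Definition linear_penalised (mu : Pphi phi) := H mu + \int[mu]_x dF x.

Local Notation c := linear_constraint.
Local Notation G := linear_penalised.

Lemma linear_constraint_continuous mu : continuous (c mu).
Proof.
move=> t; apply: cvgD; first exact: (regular_constraint_continuous reg).
exact: dTheta_mean_continuous.
Qed.

Lemma linear_constraint_mix mu mu' (e : R) t : 0 <= e <= 1 ->
  c (mix e mu mu') t = (1 - e) * c mu t + e * c mu' t.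
Proof.
move=> e01; rewrite /c Rintegral_mix//;
  [|exact: dTheta_measurable|exact: dTheta_integrable|exact: dTheta_integrable].
ring.
Qed.

Lemma linear_penalised_mix mu mu' (e : R) : 0 <= e <= 1 -> D mu -> D mu' ->
  G (mix e mu mu') <= (1 - e) * G mu + e * G mu'.
Proof.
move=> e01 Dmu Dmu'; rewrite /G Rintegral_mix//;
  [|exact: dF_measurable|exact: dF_integrable|exact: dF_integrable].
have Dm := penalised_dom_convex F_convex Dmu Dmu' e01.
have [f1 _] := penalised_dom_fin F_Ny Dmu; have [f2 _] := penalised_dom_fin F_Ny Dmu'.
have [f3 _] := penalised_dom_fin F_Ny Dm.
have : H (mix e mu mu') <= (1 - e) * H mu + e * H mu'.
  by rewrite -lee_fin EFinD !EFinM !fineK//; exact: rel_entropy_mix e01 Dmu.1 Dmu'.1.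
lra.
Qed.

Lemma linear_penalised_mub : G mub = H mub.
Proof. by rewrite /G; have [_ _ _ _ ->] := regular_derivative reg; rewrite addr0. Qed.

Lemma linear_constraint_mub t : c mub t = Theta t mub.
Proof. by rewrite /c; have [_ _ _ _ ->] := regular_constraint_derivative reg t; rewrite addr0. Qed.

Lemma linear_constraint_le mu t : c mu t <= Theta t mu.
Proof. by have := constraint_derivative_le t mu; rewrite /c; lra. Qed.

Hypothesis mub_min : is_minimiser J (D `&` admissible Theta) mub.

Let Dmub : D mub := mub_min.1.1.
Let Amub : admissible Theta mub := mub_min.1.2.

(* First-order optimality along mix e mub mu, which is admissible for small e. *)
Lemma linear_optimality_strict mu (eta : R) : D mu -> 0 < eta ->
  (forall t, c mu t <= - eta) -> G mub <= G mu.
Proof.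
move=> Dmu eta0 cle.
have [_ _ _ dlim nrm] := regular_derivative reg.
have := dlim mu Dmu; rewrite nrm subr0 => L.
rewrite linear_penalised_mub /G -lerBlDl; apply: (cvgr_to_ge L).
have U := regular_constraint_uniform reg mu.
have U1 : \forall e \near (0 : R)^'+, (sup_over (fun t =>
    `|e^-1 * (Theta t (mix e mub mu) - Theta t mub)
      - (\int[mu]_x dTheta t x - \int[mub]_x dTheta t x)|%R) < eta%:E)%E.
  have nb : nbhs 0%E [set y : \bar R | (y < eta%:E)%E].
    by apply: open_nbhs_nbhs; split; [exact: open_ereal_lt_ereal|rewrite /= lte_fin].
  exact: (U _ nb).
near=> e.
have e0 : 0 < e by near: e; exact: nbhs_right_gt.
have e1 : e <= 1 by near: e; exact: nbhs_right_le.
have e01 : 0 <= e <= 1 by rewrite ltW.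
have ue : (sup_over (fun t =>
    `|e^-1 * (Theta t (mix e mub mu) - Theta t mub)
      - (\int[mu]_x dTheta t x - \int[mub]_x dTheta t x)|%R) < eta%:E)%E by near: e.
have Dm := penalised_dom_convex F_convex Dmub Dmu e01.
have Am : admissible Theta (mix e mub mu).
  move=> t; have [_ _ _ _ nt] := regular_constraint_derivative reg t.
  have : `|e^-1 * (Theta t (mix e mub mu) - Theta t mub)
      - (\int[mu]_x dTheta t x - \int[mub]_x dTheta t x)| < eta.
    rewrite -lte_fin; apply: le_lt_trans ue; apply: ereal_sup_ubound.
    by exists t.
  rewrite nt subr0 => /(le_lt_trans (ler_norm _)) h.
  have : e^-1 * (Theta t (mix e mub mu) - Theta t mub) <= \int[mu]_x dTheta t x + eta by lra.
  rewrite mulrC ler_pdivrMr// => h'.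
  have := cle t; rewrite /c => ct.
  have : (\int[mu]_x dTheta t x + eta) * e <= (- Theta t mub) * e.
    by rewrite ler_wpM2r ?(ltW e0)//; lra.
  have : 0 <= (1 - e) * (- Theta t mub) by rewrite mulr_ge0 ?oppr_ge0 ?Amub//; lra.
  by move: h'; lra.
have := mub_min.2 _ (conj Dm Am); rewrite !penalisedE// lee_fin => hm.
have [f1 _] := penalised_dom_fin F_Ny Dmu; have [f2 _] := penalised_dom_fin F_Ny Dmub.
have [f3 _] := penalised_dom_fin F_Ny Dm.
have hH : H (mix e mub mu) <= (1 - e) * H mub + e * H mu.
  by rewrite -lee_fin EFinD !EFinM !fineK//; exact: rel_entropy_mix e01 Dmub.1 Dmu.1.
rewrite /= [leRHS]mulrC ler_pdivlMr//; lra.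
Unshelve. all: by end_near. Qed.

Variables (mut : Pphi phi) (delta : R).
Hypothesis Dmut : D mut.
Hypothesis delta_gt0 : 0 < delta.
Hypothesis mut_slater : forall t, Theta t mut <= - delta.

(** Mixing in a weight e of mut makes every linear constraint at most - e delta, so the strict case
    applies to the mixture. *)
Lemma linear_optimality mu : D mu -> (forall t, c mu t <= 0) -> G mub <= G mu.
Proof.
move=> Dmu c0; rewrite leNgt; apply/negP => lt.
pose a := G mub - G mu; have a0 : 0 < a by rewrite subr_gt0.
pose K := 1 + `|G mut - G mu|.
have K0 : 0 < K by rewrite ltr_pwDl.
(* Small enough for the mixture to raise the objective by at most a / 2, half of the assumed gain
   a. *)
pose e := Num.min 1 (a / (2 * K)).
have e0 : 0 < e by rewrite lt_min ltr01 divr_gt0// mulr_gt0.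
have e1 : e <= 1 by rewrite ge_min lexx.
have e01 : 0 <= e <= 1 by rewrite ltW.
have Dm := penalised_dom_convex F_convex Dmu Dmut e01.
have ed : 0 < e * delta by rewrite mulr_gt0.
have : G mub <= G (mix e mu mut).
  apply: (linear_optimality_strict Dm ed) => t.
  rewrite linear_constraint_mix//.
  have h1 : (1 - e) * c mu t <= 0 by rewrite mulr_ge0_le0// subr_ge0.
  have h2 : e * c mut t <= e * (- delta).
    by rewrite ler_pM2l//; apply: le_trans (linear_constraint_le _ _) (mut_slater t).
  lra.
apply/negP; rewrite -ltNge; apply: le_lt_trans (linear_penalised_mix e01 Dmu Dmut) _.
have h1 : e * (G mut - G mu) <= e * K.
  by rewrite ler_pM2l//; apply: le_trans (ler_norm _) _; rewrite lerDr.
have h2 : e * K <= a / 2.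
  apply: (@le_trans _ _ (a / (2 * K) * K)); first by rewrite ler_wpM2r ?(ltW K0)// ge_min lexx orbT.
  by rewrite (_ : a / (2 * K) * K = a / 2)//; field; rewrite gt_eqF.
by move: h1 h2 a0; rewrite /a; lra.
Qed.

(** Convexity in conical form: nonnegative weights s and u are kept unnormalised, and any point
    serves when both vanish. *)
Let combine mu mu' (s u : R) : D mu -> D mu' -> 0 <= s -> 0 <= u ->
  exists m, [/\ D m, forall t, (s + u) * c m t = s * c mu t + u * c mu' t &
    (s + u) * (G m - G mub) <= s * (G mu - G mub) + u * (G mu' - G mub)].
Proof.
move=> Dmu Dmu' s0 u0; have : 0 <= s + u by rewrite addr_ge0.
rewrite le_eqVlt => /predU1P[su|su].
  have -> : s = 0 by lra.
  have -> : u = 0 by lra.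
  by exists mu; split => // [t|]; rewrite !mul0r !addr0 !mul0r.
pose e := u / (s + u).
have e01 : 0 <= e <= 1.
  by rewrite divr_ge0 ?(ltW su)//= ler_pdivrMr// mul1r lerDr.
have seE : (s + u) * (1 - e) = s by rewrite /e; field; rewrite gt_eqF.
have ueE : (s + u) * e = u by rewrite /e; field; rewrite gt_eqF.
move: (e) e01 seE ueE => {}e e01 seE ueE.
have seu x y : (s + u) * ((1 - e) * x + e * y) = s * x + u * y.
  by rewrite mulrDr !mulrA seE ueE.
exists (mix e mu mu'); split.
- exact: penalised_dom_convex F_convex _ _ _ Dmu Dmu' e01.
- by move=> t; rewrite linear_constraint_mix// seu.
- by have := ler_wpM2l (ltW su) (linear_penalised_mix e01 Dmu Dmu'); rewrite seu; lra.
Qed.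

(* The factor s makes the infimum p of values positively homogeneous. *)
Let values (f : T -> R) : set R :=
  [set v | exists s mu, [/\ 0 <= s, D mu, forall t, s * c mu t <= f t &
    v = s * (G mu - G mub)]].

(** The multiple K / delta of mut pushes the constraints below - K <= f, so every bounded
    perturbation has a competitor. *)
Let values_mut (f : T -> R) (K : R) : (forall t, `|f t| <= K) ->
  values f (K / delta * (G mut - G mub)).
Proof.
move=> fK; have K0 : 0 <= K by exact: le_trans (fK point).
exists (K / delta), mut; split => //; first by rewrite divr_ge0// ltW.
move=> t; apply: (@le_trans _ _ (- K)); last first.
  by have := fK t; rewrite ler_norml => /andP[].
have h : c mut t <= - delta by apply: le_trans (linear_constraint_le _ _) (mut_slater t).
apply: le_trans (ler_wpM2l (divr_ge0 K0 (ltW delta_gt0)) h) _.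
by rewrite mulrN divfK// gt_eqF.
Qed.

(** Adding K / delta times mut to a competitor for f compensates f, and gives a multiple of a point
    feasible for the unperturbed linear problem; optimality of mub there bounds the value from
    below. *)
Let values_lb (f : T -> R) (K : R) : (forall t, `|f t| <= K) ->
  lbound (values f) (- (K / delta * (G mut - G mub))).
Proof.
move=> fK _ [s [mu [s0 Dmu sc ->]]].
have K0 : 0 <= K by exact: le_trans (fK point).
have Kd : 0 <= K / delta by rewrite divr_ge0// ltW.
have [m [Dm cm gm]] := combine Dmu Dmut s0 Kd.
have h : forall t, (s + K / delta) * c m t <= 0.
  move=> t; rewrite cm.
  have h : c mut t <= - delta by apply: le_trans (linear_constraint_le _ _) (mut_slater t).
  have := ler_wpM2l Kd h; rewrite mulrN divfK ?gt_eqF//.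
  by have := sc t; have := fK t; rewrite ler_norml => /andP[]; lra.
suff : 0 <= (s + K / delta) * (G m - G mub) by lra.
have : 0 <= s + K / delta by rewrite addr_ge0.
rewrite le_eqVlt => /predU1P[<-|sK]; first by rewrite mul0r.
rewrite mulr_ge0 ?(ltW sK)// subr_ge0; apply: linear_optimality => // t.
by have := h t; rewrite pmulr_rle0.
Qed.

Let p f := inf (values f).

Let values_inf (f : T -> R) : continuous f -> has_inf (values f).
Proof.
move=> cf; have [_ [K fK]] := compact_Cb T_compact cf.
by split; [eexists; exact: values_mut fK|eexists; exact: values_lb fK].
Qed.

Let p_le f v : continuous f -> values f v -> p f <= v.
Proof. by move=> cf; apply: ge_inf; exact: (values_inf cf).2. Qed.

Let p_sublinear : sublinear_on (fun f : T -> R => continuous f) p.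
Proof.
have pZ (a : R) (f : T -> R) : 0 < a -> continuous f -> p (fun t => a * f t) <= a * p f.
  move=> a0 cf.
  have caf : continuous (fun t => a * f t).
    by move=> t; apply: cvgM; [exact: cvg_cst|exact: cf].
  apply/ler_addgt0Pr => e e0; have ea : 0 < e / a by rewrite divr_gt0.
  have [_ [s [mu [s0 Dmu sc ->]]] lt] := inf_adherent ea (values_inf cf).
  apply: (@le_trans _ _ (a * s * (G mu - G mub))).
    apply: p_le => //; exists (a * s), mu; split => //; first by rewrite mulr_ge0// ltW.
    by move=> t; rewrite -mulrA ler_pM2l.
  have eaE : a * (e / a) = e by field; rewrite gt_eqF.
  by have := ler_wpM2l (ltW a0) (ltW lt); rewrite -/(p f); lra.
split=> [f g cf cg|a f a0 cf].
  have cfg : continuous (fun t => f t + g t).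
    by move=> t; apply: cvgD; [exact: cf|exact: cg].
  apply/ler_addgt0Pr => e e0; have e2 : 0 < e / 2 by rewrite divr_gt0.
  have [_ [s [mu [s0 Dmu sc ->]]] lt] := inf_adherent e2 (values_inf cf).
  have [_ [u [mu' [u0 Dmu' uc ->]]] lt'] := inf_adherent e2 (values_inf cg).
  have [m [Dm cm gm]] := combine Dmu Dmu' s0 u0.
  apply: (@le_trans _ _ ((s + u) * (G m - G mub))).
    apply: p_le => //; exists (s + u), m; split => //; first by rewrite addr_ge0.
    by move=> t; rewrite cm lerD.
  by move: lt lt'; rewrite -/(p f) -/(p g); lra.
apply/eqP; rewrite eq_le pZ//=.
have caf : continuous (fun t => a * f t).
  by move=> t; apply: cvgM; [exact: cvg_cst|exact: cf].
have := @pZ a^-1 (fun t => a * f t) _ caf; rewrite invr_gt0 => /(_ a0).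
rewrite (_ : (fun t => a^-1 * (a * f t)) = f); last first.
  by apply/funext => t; rewrite mulrA mulVf ?mul1r// gt_eqF.
by rewrite ler_pdivlMl.
Qed.

(** A linear l below the value p is nonpositive on f >= 0, because mub is then a competitor of value
    0; hence - l is a positive functional. The inequality follows by perturbing with f = c mu, for
    which mu itself competes. *)
Lemma multiplier_exists : exists lambda : Mplus T, forall mu : Pphi phi,
  D mu -> G mub <= G mu + \int[lambda]_t c mu t.
Proof.
have C_lin (a : R) (f g : T -> R) : continuous f -> continuous g ->
    continuous (fun t => a * f t + g t).
  move=> cf cg t; apply: cvgD; last exact: cg.
  by apply: cvgM; [exact: cvg_cst|exact: cf].
have C0 : continuous (fun _ : T => 0 : R) by move=> t; exact: cvg_cst.
have [l [l_lin l_le]] := hahn_banach C_lin p_sublinear C0.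
have [|f cf f0|lambda lE] := @riesz_compact R T T_compact (fun f => - l f).
- by move=> a f g cf cg; rewrite l_lin//; ring.
- rewrite oppr_ge0; apply: le_trans (l_le _ cf) _; apply: p_le => //.
  exists 1, mub; split => //; last by rewrite subrr mulr0.
  by move=> t; rewrite mul1r linear_constraint_mub (le_trans (Amub t)).
exists lambda => mu Dmu; rewrite lE; last exact: linear_constraint_continuous.
have := l_le _ (@linear_constraint_continuous mu).
have : p (c mu) <= G mu - G mub.
  apply: p_le; first exact: linear_constraint_continuous.
  by exists 1, mu; split => // [t|]; rewrite mul1r.
lra.
Qed.

Hypothesis bounded_density_dom : forall mu : Pphi phi, has_bounded_density mu nu -> D mu.
Hypothesis exp_moments_nu : forall a : R, 0 < a -> exists b : R, exp_moment_le nu a b.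

Theorem gibbs_multiplier_exists : exists lambda : Mplus T,
  gibbs_with_multiplier nu mub dF (fun t => Theta t mub) dTheta lambda.
Proof.
have [lambda lP] := multiplier_exists; exists lambda.
have cT : continuous (fun t => Theta t mub) := regular_constraint_continuous reg.
have iT := Mplus_integrable T_compact lambda cT.
(* Nonpositive because mub is admissible, nonnegative by the multiplier inequality at mub itself. *)
have slack : \int[lambda]_t Theta t mub = 0.
  apply/eqP; rewrite eq_le; apply/andP; split.
    have h : 0 <= \int[lambda]_t (-1 * Theta t mub).
      by apply: Rintegral_ge0 => t _; rewrite mulN1r oppr_ge0 Amub.
    by move: h; rewrite RintegralZl// mulN1r oppr_ge0.
  have := lP mub Dmub; rewrite (_ : c mub = fun t => Theta t mub); first by lra.
  by apply/funext => t; exact: linear_constraint_mub.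
split; last exact: (Rintegral_nonpos_eq0 T_compact cT Amub slack).
pose V := potential lambda.
have mV := potential_measurable lambda.
(* The added 1 makes the exponent positive, as [exp_moments_nu] requires. *)
pose c0 := B * (1 + fine (lambda setT)) + 1.
have c0B : B * (1 + fine (lambda setT)) <= c0 by rewrite lerDl.
have c00 : 0 < c0.
  by rewrite /c0 ltr_wpDl// mulr_ge0// addr_ge0// fine_ge0.
have [b nub] := exp_moments_nu c00.
have V_le x : `|V x| <= c0 * (1 + phi x).
  by apply: le_trans (potential_le lambda x) _; rewrite ler_wpM2r// oneDweight_ge0.
have expV_le (v : R) x : `|v| <= c0 * (1 + phi x) -> expR (- v) <= expR c0 * expR (c0 * phi x).
  move=> hv; rewrite -expRD ler_expR; move: hv; rewrite mulrDr mulr1.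
  by have := ler_norm (- v); rewrite normrN; lra.
have mexp (f : E -> R) : measurable_fun [set: borel E] f ->
    measurable_fun [set: borel E] (fun x => expR (- f x)).
  by move=> mf; apply: measurableT_comp => //; apply: measurableT_comp.
have iexp (f : E -> R) : measurable_fun [set: borel E] f ->
    (forall x, `|f x| <= c0 * (1 + phi x)) ->
    nu.-integrable [set: borel E] (EFin \o (fun x => expR (- f x))).
  move=> mf f_le; apply: (exp_order_integrable nub (mexp _ mf)) => x.
  by rewrite ger0_norm ?expR_ge0//; exact: expV_le.
(* exp(- V) may be unbounded: truncating V from below yields bounded densities,
   at which the optimality of lambda can be tested. *)
pose Vn (n : nat) x := Num.max (V x) (- n%:R).
have mVn n : measurable_fun [set: borel E] (Vn n) by apply: measurable_maxr.
have Vn_norm n x : `|Vn n x| <= `|V x|.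
  rewrite /Vn; have [h|h] := leP (V x) (- n%:R); last by [].
  by rewrite normrN ger0_norm//; have := ler_norm (- V x); rewrite normrN; lra.
have Vn_le n x : `|Vn n x| <= c0 * (1 + phi x) by exact: le_trans (Vn_norm n x) (V_le x).
pose Z := partition_function nu V; pose Zn n := partition_function nu (Vn n).
have Zpos (f : E -> R) : measurable_fun [set: borel E] f ->
    (forall x, `|f x| <= c0 * (1 + phi x)) -> 0 < partition_function nu f.
  move=> mf f_le; apply: lt_le_trans (partition_function_jensen _ _).
  - exact: expR_gt0.
  - exact: iexp.
  - exact: Pphi_integrable mf f_le.
have Z0 : 0 < Z by exact: Zpos.
have Zn_cvg : Zn n @[n --> \oo] --> Z.
  apply: (@Rintegral_cvg _ (borel E) R nu (fun n x => expR (- Vn n x)) _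
    (fun x => expR c0 * expR (c0 * phi x))) => //.
  - by move=> n; exact: mexp.
  - by have := integrableZl measurableT (expR c0) (exp_integrable nub).
  - by move=> n x; rewrite ger0_norm ?expR_ge0//; exact: expV_le.
  - move=> x; apply: cvg_near_cst; exists (Num.truncn `|V x|).+1 => // n /= hn.
    congr (expR (- _)); apply/max_idPl; rewrite lerNl.
    apply: le_trans (ler_norm _) _; rewrite normrN ltW//.
    by apply: lt_le_trans (truncnS_gt _) _; rewrite ler_nat.
(* The Gibbs measure m of Vn n has density at most exp(n) / Zn n, hence lies in the domain, and its
   entropy is - <m, Vn n> - ln (Zn n). Since V <= Vn n, the multiplier inequality at m leaves only -
   ln (Zn n). *)
have HZn n : H mub <= - ln (Zn n).
  have Zn0 : 0 < Zn n by exact: Zpos.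
  pose g x := (Zn n)^-1 * expR (- Vn n x).
  have mg : measurable_fun [set: borel E] g by apply: measurable_funM => //; exact: mexp.
  have gM x : 0 <= g x <= (Zn n)^-1 * expR n%:R.
    have Zi : 0 <= (Zn n)^-1 by rewrite invr_ge0 ltW.
    rewrite mulr_ge0 ?expR_ge0//= ler_wpM2l// ler_expR lerNl.
    by rewrite le_max lexx orbT.
  have g1 : \int[nu]_x g x = 1.
    by rewrite RintegralZl//; [rewrite mulVf// gt_eqF|exact: iexp].
  have [m dm] := Pphi_of_density mg gM g1.
  have Dm : D m.
    by apply: bounded_density_dom; apply: (has_density_bounded dm) => x;
      have /andP[_ h] := gM x; exact: h.
  have iVn : m.-integrable [set: borel E] (EFin \o Vn n).
    exact: Pphi_integrable (mVn n) (Vn_le n).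
  have Hm : H m = - (\int[m]_x Vn n x) - ln (Zn n).
    by rewrite (gibbs_value (mVn n) Zn0 dm iVn).
  have VVn : \int[m]_x V x <= \int[m]_x Vn n x.
    apply: le_Rintegral => //; first exact: potential_integrable.
    by move=> x _; rewrite le_max lexx.
  have := lP m Dm; rewrite linear_penalised_mub /G.
  have -> : \int[lambda]_t c m t = \int[lambda]_t (\int[m]_x dTheta t x).
    rewrite /c RintegralD//; first by rewrite slack add0r.
    by apply: Mplus_integrable => //; exact: dTheta_mean_continuous.
  have := Rintegral_potential lambda m; move: VVn; rewrite /V => h1 h2.
  by move: h1 Hm; rewrite h2; lra.
have HZ : H mub <= - ln Z.
  have : - ln (Zn n) @[n --> \oo] --> - ln Z.
    apply: cvgN; apply: (cvg_comp _ _ Zn_cvg); exact: continuous_ln.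
  by move=> /cvgr_to_ge; apply; apply: nearW.
have dmub : has_density mub nu (fun x => Z^-1 * expR (- V x)).
  apply: (gibbs_eq mV (iexp _ mV V_le) Z0 Dmub.1).
    exact: potential_integrable.
  by rewrite /V Rintegral_potential_mub addr0 -/V -/Z; lra.
exists Z => //; split; first exact: has_density_dominates dmub.
apply: filterS (has_density_RN dmub) => x.
by rewrite /density => ->; rewrite /V /potential opprD.
Qed.

End linearisation.

(** * Consequences of the Gibbs form with a multiplier *)

Section given_multiplier.
Context {R : realType} {E : pmetricType R} {phi : weight E} {T : pmetricType R}.
Hypothesis T_compact : compact [set: T].
Variables (nu mub : Pphi phi) (F : Pphi phi -> \bar R) (Theta : T -> Pphi phi -> R).
Variables (dF : E -> R) (dTheta : T -> E -> R).
Hypothesis F_Ny : forall mu, (-oo < F mu)%E.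
Hypothesis F_convex : convex_functional F.
Hypothesis Theta_convex : forall t, convex_functional (fun mu => (Theta t mu)%:E).
Hypothesis reg : regular_at nu F Theta mub dF dTheta.
Variable B : R.
Hypothesis B_ge0 : 0 <= B.
Hypothesis dF_le : forall x, `|dF x| <= B * (1 + phi x).
Hypothesis dTheta_le : forall t x, `|dTheta t x| <= B * (1 + phi x).
Variable lambda : Mplus T.
Hypothesis multiplier :
  gibbs_with_multiplier nu mub dF (fun t => Theta t mub) dTheta lambda.
Local Notation H mu := (fine (rel_entropy mu nu)).
Local Notation V := (potential dF dTheta lambda).
Local Notation Z := (partition_function nu V).
Local Notation mass := (fine (lambda setT)).

Let mV : measurable_fun [set: borel E] V.
Proof. exact: (potential_measurable T_compact reg). Qed.

Let iV (mu : Pphi phi) : mu.-integrable [set: borel E] (EFin \o V).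
Proof. exact: (potential_integrable T_compact reg dF_le dTheta_le). Qed.

(** The normalising constant of [gibbs_with_multiplier] is existential: since mub has mass 1 it must
    be the partition function, and exp(- V) is integrable as a multiple of a density. *)
Let gibbs_density_integrable :
  nu.-integrable [set: borel E] (EFin \o (fun x => expR (- V x))) /\
  has_density mub nu (fun x => Z^-1 * expR (- V x)).
Proof.
have [[W W0 [munu dW]] _] := multiplier.
have W_neq0 : W != 0 by rewrite gt_eqF.
pose e x := expR (- V x).
have me : measurable_fun [set: borel E] e.
  by apply: measurableT_comp => //; apply: measurableT_comp.
have dmub : has_density mub nu (fun x => W^-1 * e x).
  apply: RN_has_density => //.
  - by apply: measurable_funM.
  - by move=> x; rewrite mulr_ge0 ?expR_ge0// invr_ge0 ltW.
  - by apply: filterS dW => x; rewrite /density => ->; rewrite /e /potential opprD.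
have ie : nu.-integrable [set: borel E] (EFin \o e).
  have := integrableZl measurableT W (has_density_integrable dmub).
  by congr (_.-integrable _ _); apply/funext => x /=; rewrite -EFinM mulrA divff ?mul1r.
have WE : Z = W.
  have := has_density_mass dmub; rewrite RintegralZl// -/Z => h.
  by rewrite -[LHS](mulVKf W_neq0) h mulr1.
by split => //; rewrite WE.
Qed.

Lemma gibbs_exp_integrable :
  nu.-integrable [set: borel E] (EFin \o (fun x => expR (- V x))).
Proof. exact: gibbs_density_integrable.1. Qed.

Lemma gibbs_density : has_density mub nu (fun x => Z^-1 * expR (- V x)).
Proof. exact: gibbs_density_integrable.2. Qed.

Lemma gibbs_partition_gt0 : 0 < Z.
Proof.
apply: lt_le_trans (partition_function_jensen gibbs_exp_integrable (iV nu)).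
exact: expR_gt0.
Qed.

Lemma gibbs_entropy : H mub = - ln Z.
Proof.
rewrite (gibbs_value mV gibbs_partition_gt0 gibbs_density (iV mub)) /=.
by rewrite (Rintegral_potential_mub T_compact reg dF_le dTheta_le) oppr0 add0r.
Qed.

Lemma gibbs_slackness : \int[lambda]_t Theta t mub = 0.
Proof.
apply: (Rintegral_ae_eq0 T_compact (regular_constraint_continuous reg)).
exact: multiplier.2.
Qed.

Let gibbs_potential_ineq (mu : Pphi phi) : (rel_entropy mu nu < +oo)%E ->
  H mub <= H mu + \int[mu]_x dF x + \int[lambda]_t (\int[mu]_x dTheta t x).
Proof.
move=> Hmu.
have := gibbs_ineq mV gibbs_exp_integrable gibbs_partition_gt0 Hmu (iV mu).
rewrite (Rintegral_potential T_compact reg dF_le dTheta_le).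
by have := gibbs_entropy; lra.
Qed.

(* By convexity <mu, dTheta t> <= Theta t mu - Theta t mub, and the last term
   integrates to 0 by slackness. *)
Lemma gibbs_constraint_le (mu : Pphi phi) (d : R) : (forall t, Theta t mu <= d) ->
  \int[lambda]_t (\int[mu]_x dTheta t x) <= d * mass.
Proof.
move=> mud.
have cT := regular_constraint_continuous reg.
have cd : continuous (fun t => d - 1 * Theta t mub).
  move=> t; apply: cvgB; first exact: cvg_cst.
  by apply: cvgM; [exact: cvg_cst|exact: cT].
have iT := Mplus_integrable T_compact lambda cT.
have i1 : lambda.-integrable [set: borel T] (EFin \o (fun t => 1 * Theta t mub)).
  by have := integrableZl measurableT 1 iT.
have id : lambda.-integrable [set: borel T] (EFin \o (fun _ => d)).
  by apply: (Mplus_integrable T_compact) => t; exact: cvg_cst.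
apply: (@le_trans _ _ (\int[lambda]_t (d - 1 * Theta t mub))).
  apply: le_Rintegral => //.
  - apply: (Mplus_integrable T_compact).
    exact: (dTheta_mean_continuous reg dTheta_le).
  - exact: (Mplus_integrable T_compact).
  - move=> t _; have := constraint_derivative_le Theta_convex reg t mu.
    by have := mud t; lra.
by rewrite RintegralB// RintegralZl// gibbs_slackness mulr0 subr0 Rintegral_cst.
Qed.

Lemma gibbs_minimiser : penalised_dom nu F mub -> admissible Theta mub ->
  is_minimiser (penalised nu F) (penalised_dom nu F `&` admissible Theta) mub.
Proof.
move=> Dmub Amub; split => // mu [Dmu Amu].
rewrite !penalisedE// lee_fin.
have h1 := penalty_derivative_le F_Ny F_convex reg Dmu Dmub.
have h2 := gibbs_constraint_le Amu; rewrite mul0r in h2.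
by have := gibbs_potential_ineq Dmu.1; lra.
Qed.

Section uniform_bounds.
Variables (mut : Pphi phi) (delta M b : R).
Hypotheses (delta_gt0 : 0 < delta) (mut_slater : forall t, Theta t mut <= - delta).
Hypothesis mut_entropy : (rel_entropy mut nu <= M%:E)%E.
Hypothesis nu_exp : exp_moment_le nu 1 b.

(** M bounds the entropy of mut and B (1 + (M + ln b)) bounds <mut, dF>; together they dominate
    delta times the mass. *)
Definition mass_bound := (M + B * (1 + (M + ln b))) / delta.

Let exp_gt0 : 0 < \int[nu]_x expR (1 * phi x).
Proof.
apply: (@lt_le_trans _ _ 1) => //.
rewrite -[leLHS](Rintegral_probability_cst nu); apply: le_Rintegral => //.
- exact: finite_measure_integrable_cst.
- exact: exp_integrable nu_exp.
- by move=> x _; rewrite mul1r -expR0 ler_expR weight_ge0.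
Qed.

Let Hmut_lty : (rel_entropy mut nu < +oo)%E.
Proof. by apply: le_lt_trans mut_entropy _; exact: ltry. Qed.

Let Hmut : H mut <= M.
Proof.
by rewrite -lee_fin fineK// ge0_fin_numE// rel_entropy_ge0.
Qed.

(** Gibbs' inequality with potential - phi, whose partition function is at most b. *)
Lemma mean_weight_le : \int[mut]_x phi x <= M + ln b.
Proof.
have mphi : measurable_fun [set: borel E] (fun x => -1 * phi x).
  apply: measurable_funM => //.
  exact: continuous_borel_measurable (@weight_continuous _ _ phi).
have iN : mut.-integrable [set: borel E] (EFin \o (fun x => -1 * phi x)).
  by have := integrableZl measurableT (-1) (Pphi_weight_integrable mut).
have eE : (fun x : E => expR (- (-1 * phi x))) = (fun x => expR (1 * phi x)).
  by apply/funext => x; rewrite mulN1r opprK mul1r.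
have := @gibbs_ineq R E nu (fun x => -1 * phi x) mphi; rewrite /partition_function eE.
move=> /(_ (exp_integrable nu_exp) exp_gt0 mut Hmut_lty iN).
rewrite RintegralZl//; last exact: Pphi_weight_integrable.
have := exp_Rintegral_le nu_exp; rewrite -ler_ln ?posrE//; last first.
  exact: lt_le_trans exp_gt0 (exp_Rintegral_le nu_exp).
by move: Hmut; lra.
Qed.

Lemma mass_le : mass <= mass_bound.
Proof.
rewrite /mass_bound ler_pdivlMr//.
have h1 := gibbs_constraint_le mut_slater.
have h2 := gibbs_potential_ineq Hmut_lty.
have h3 : 0 <= H mub by rewrite fine_ge0// rel_entropy_ge0.
have h4 : \int[mut]_x dF x <= B * (1 + (M + ln b)).
  apply: (@le_trans _ _ (\int[mut]_x (B * (1 + phi x)))).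
    apply: le_Rintegral => //.
    - exact: (dF_integrable reg dF_le mut).
    - exact: Pphi_oneDweight_integrable.
    - by move=> x _; apply: le_trans (ler_norm _) (dF_le x).
  rewrite RintegralZl//; last first.
    have := Pphi_oneDweight_integrable mut 1.
    by congr (_.-integrable _ _); apply/funext => x /=; rewrite mul1r.
  rewrite RintegralD//; [|exact: finite_measure_integrable_cst|exact: Pphi_weight_integrable].
  by rewrite Rintegral_probability_cst ler_wpM2l// lerD2l mean_weight_le.
by move: Hmut; lra.
Qed.

End uniform_bounds.

(** The bound |V| <= c (1 + phi) controls exp(- V), and Jensen's inequality gives Z >= exp(- c b),
    as <nu, 1 + phi> <= <nu, exp(phi)> <= b. The resulting weight depends on the multiplier only
    through the bound C on its mass. *)
Lemma gibbs_domination (C b : R) (h : E -> R) : mass <= C -> exp_moment_le nu 1 b ->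
  measurable_fun [set: borel E] h -> (forall x, 0 <= h x) ->
  let c := B * (1 + C) in
  nu.-integrable [set: borel E] (EFin \o (fun x => h x * expR (c * (1 + b + phi x)))) ->
  \int[mub]_x h x <= \int[nu]_x (h x * expR (c * (1 + b + phi x))).
Proof.
move=> mC nub mh h0 c ih.
have V_le x : `|V x| <= c * (1 + phi x).
  apply: le_trans (potential_le T_compact reg dF_le dTheta_le lambda x) _.
  by rewrite ler_wpM2r ?oneDweight_ge0// ler_wpM2l// lerD2l.
have c0 : 0 <= c.
  by rewrite mulr_ge0// addr_ge0// (le_trans _ mC)// fine_ge0.
have Zb : expR (- (c * b)) <= Z.
  apply: le_trans (partition_function_jensen gibbs_exp_integrable (iV nu)).
  rewrite ler_expR lerN2.
  apply: (@le_trans _ _ (\int[nu]_x (c * expR (1 * phi x)))).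
    apply: le_Rintegral => //.
    - exact: iV.
    - by have := integrableZl measurableT c (exp_integrable nub).
    - move=> x _; apply: le_trans (ler_norm _) _; apply: le_trans (V_le x) _.
      by rewrite ler_wpM2l// mul1r oneD_weight_le_exp.
  rewrite RintegralZl//; last exact: exp_integrable nub.
  by rewrite ler_wpM2l// exp_Rintegral_le.
have g_le x : Z^-1 * expR (- V x) <= expR (c * (1 + b + phi x)).
  have -> : c * (1 + b + phi x) = c * b + c * (1 + phi x) by ring.
  rewrite expRD; apply: ler_pM => //.
  - by rewrite invr_ge0 ltW// gibbs_partition_gt0.
  - by rewrite -[expR (c * b)]invrK -expRN lef_pV2// ?posrE ?expR_gt0 ?gibbs_partition_gt0.
  - by rewrite ler_expR; apply: le_trans (V_le x); rewrite -normrN; exact: ler_norm.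
rewrite (Rintegral_density gibbs_density mh).
have mgd : measurable_fun [set: borel E] (fun x => h x * (Z^-1 * expR (- V x))).
  by apply: measurable_funM => //; have [] := gibbs_density.
apply: le_Rintegral => //.
- apply: (integrable_dominated _ ih) => // x.
  rewrite ger0_norm ?ler_wpM2l// mulr_ge0// mulr_ge0 ?expR_ge0//.
  by rewrite invr_ge0 ltW// gibbs_partition_gt0.
- by move=> x _; rewrite ler_wpM2l.
Qed.

End given_multiplier.

(** * Stability *)

Section uniform_integrals.
Context {R : realType} {T : pmetricType R}.
Hypothesis T_compact : compact [set: T].

Lemma Rintegral_uniform_le (lambda : Mplus T) (f g : T -> R) (e C : R) :
  continuous f -> continuous g -> 0 <= e -> fine (lambda setT) <= C ->
  (forall t, `|f t - g t| <= e) ->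
  `|\int[lambda]_t f t - \int[lambda]_t g t| <= C * e.
Proof.
move=> cf cg e0 mC fg.
have [intf intg] := (Mplus_integrable T_compact lambda cf, Mplus_integrable T_compact lambda cg).
rewrite -RintegralB//; apply: (@le_trans _ _ (\int[lambda]_t e)).
  apply: Rintegral_norm_le => //.
  - apply/measurable_EFinP; have /measurable_int := integrableB measurableT intf intg.
    by [].
  - by apply: (Mplus_integrable T_compact) => t; exact: cvg_cst.
by rewrite Rintegral_cst// mulrC ler_wpM2r.
Qed.

(** Weak convergence tolerates a moving integrand if the latter converges uniformly and the masses
    are bounded. *)
Lemma Rintegral_uniform_cvg (lambda_ : nat -> Mplus T) (lambda : Mplus T) (C : R)
    (f_ : nat -> T -> R) (f : T -> R) :
  (forall k, fine (lambda_ k setT) <= C) ->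
  (forall g, continuous g -> \int[lambda_ k]_t g t @[k --> \oo] --> \int[lambda]_t g t) ->
  (forall k, continuous (f_ k)) -> continuous f ->
  (forall e : R, 0 < e -> \forall k \near \oo, forall t, `|f_ k t - f t| <= e) ->
  \int[lambda_ k]_t f_ k t @[k --> \oo] --> \int[lambda]_t f t.
Proof.
move=> mC lc cf_ cf unif; apply/cvgrPdist_le => e e0.
have C0 : 0 <= C by exact: le_trans (fine_ge0 _) (mC 0%N).
pose d := e / (2 * (C + 1)).
have d0 : 0 < d by rewrite divr_gt0// mulr_gt0// ltr_wpDl.
have Cd : C * d <= e / 2.
  have -> : e / 2 = (C + 1) * d by rewrite /d; field; rewrite gt_eqF// ltr_wpDl.
  by rewrite ler_wpM2r ?(ltW d0)// lerDl.
have e2 : 0 < e / 2 by rewrite divr_gt0.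
have /cvgrPdist_le/(_ _ e2) h := lc f cf.
near=> k.
have h1 : `|\int[lambda]_t f t - \int[lambda_ k]_t f t| <= e / 2 by near: k.
have h2 : `|\int[lambda_ k]_t f_ k t - \int[lambda_ k]_t f t| <= C * d.
  apply: Rintegral_uniform_le => //; first exact: ltW.
  by near: k; exact: unif.
rewrite -[X in `|X|](subrKA (\int[lambda_ k]_t f t)); apply: le_trans (ler_normD _ _) _.
by rewrite [X in _ + X]distrC; lra.
Unshelve. all: by end_near. Qed.

End uniform_integrals.

Lemma equicontinuous_near (R : realType) (X : topologicalType) (I : Type) (f : I -> X -> R)
    (x : X) (e : R) : equicontinuous [set: I] f -> 0 < e ->
  \forall y \near x, forall i, `|f i x - f i y| <= e.
Proof.
move=> equi e0; have := equi x _ (entourage_ball R (PosNum e0)).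
by apply: filterS => y h i; apply/ltW; exact: h.
Qed.

(** * Passage to the limit in the Gibbs form *)

Section limit.
Context {R : realType} {E : pmetricType R} {phi : weight E} {T : pmetricType R}.
Hypothesis T_compact : compact [set: T].
Variables (nu : Pphi phi) (nu_ : nat -> Pphi phi).
Hypothesis nu_cvg : nu_ @ \oo --> nu.
Hypothesis exp_moments : forall a : R, 0 < a -> exists b : R,
  exp_moment_le nu a b /\ forall k, exp_moment_le (nu_ k) a b.
Variables (F_ : nat -> Pphi phi -> \bar R) (F : Pphi phi -> \bar R).
Variables (Theta_ : nat -> T -> Pphi phi -> R) (Theta : T -> Pphi phi -> R).
Variables (mub_ : nat -> Pphi phi) (mub : Pphi phi).
Variables (dF_ : nat -> E -> R) (dF : E -> R).
Variables (dTheta_ : nat -> T -> E -> R) (dTheta : T -> E -> R).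
Variables (lambda_ : nat -> Mplus T) (lambda : Mplus T).
Hypothesis reg_ : forall k,
  regular_at (nu_ k) (F_ k) (Theta_ k) (mub_ k) (dF_ k) (dTheta_ k).
Hypothesis reg : regular_at nu F Theta mub dF dTheta.
Hypothesis multiplier_ : forall k, gibbs_with_multiplier (nu_ k) (mub_ k) (dF_ k)
  (fun t => Theta_ k t (mub_ k)) (dTheta_ k) (lambda_ k).
Hypothesis admissible_ : forall k, admissible (Theta_ k) (mub_ k).
Variables (B C : R).
Hypothesis B_ge0 : 0 <= B.
Hypothesis dF_le : forall k x, `|dF_ k x| <= B * (1 + phi x).
Hypothesis dTheta_le : forall k t x, `|dTheta_ k t x| <= B * (1 + phi x).
Hypothesis mass_le : forall k, fine (lambda_ k setT) <= C.
Hypothesis mub_cvg : mub_ @ \oo --> mub.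
Hypothesis lambda_cvg : forall g, continuous g ->
  \int[lambda_ k]_t g t @[k --> \oo] --> \int[lambda]_t g t.
Hypothesis dF_cvg : forall x, (fun k => `| dF_ k x - dF x |) @ \oo --> 0.
Hypothesis constraint_cvg : forall x, (fun k => sup_over (fun t =>
  `| Theta_ k t (mub_ k) - Theta t mub | + `| dTheta_ k t x - dTheta t x |))
  @ \oo --> 0%E.
Hypothesis dF_equi : equicontinuous [set: nat] dF_.
Hypothesis dTheta_equi :
  equicontinuous [set: T * nat] (fun tk => dTheta_ tk.2 tk.1).

Let uniform_near x (e : R) : 0 < e -> \forall k \near \oo, forall t,
  `| Theta_ k t (mub_ k) - Theta t mub | <= e /\ `| dTheta_ k t x - dTheta t x | <= e.
Proof.
move=> e0.
have nb : nbhs 0%E [set y : \bar R | (y < e%:E)%E].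
  by apply: open_nbhs_nbhs; split; [exact: open_ereal_lt_ereal|rewrite /= lte_fin].
apply: (@filterS _ \oo _ _ _ _ (constraint_cvg x nb)) => k /= h t.
have : `| Theta_ k t (mub_ k) - Theta t mub | + `| dTheta_ k t x - dTheta t x | < e.
  by rewrite -lte_fin; apply: le_lt_trans h; apply: ereal_sup_ubound; exists t.
have := normr_ge0 (Theta_ k t (mub_ k) - Theta t mub).
by have := normr_ge0 (dTheta_ k t x - dTheta t x); split; lra.
Qed.

Let dF_lim x : dF_ ^~ x @ \oo --> dF x.
Proof.
apply/cvgrPdist_le => e e0; have /cvgrPdist_le/(_ e e0) := dF_cvg x.
by apply: filterS => k /=; rewrite sub0r normrN normr_id distrC.
Qed.

Let Theta_lim t : Theta_ k t (mub_ k) @[k --> \oo] --> Theta t mub.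
Proof.
(* The constraint values do not depend on the space variable, so any point of E will do. *)
apply/cvgrPdist_le => e e0; have := uniform_near point e0.
by apply: filterS => k /(_ t) [+ _]; rewrite distrC.
Qed.

Let dTheta_lim t x : dTheta_ k t x @[k --> \oo] --> dTheta t x.
Proof.
apply/cvgrPdist_le => e e0; have := uniform_near x e0.
by apply: filterS => k /(_ t) [_ +]; rewrite distrC.
Qed.

Lemma limit_admissible : admissible Theta mub.
Proof.
by move=> t; apply: (cvgr_to_le (@Theta_lim t)); apply: nearW => k; exact: admissible_.
Qed.

Lemma limit_dF_le x : `|dF x| <= B * (1 + phi x).
Proof. exact: equicontinuous_limit_le dF_lim dF_le x. Qed.

Lemma limit_dTheta_le t x : `|dTheta t x| <= B * (1 + phi x).
Proof. exact: (equicontinuous_limit_le (@dTheta_lim t) (fun k => dTheta_le k t) x). Qed.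

Let V_ k := potential (dF_ k) (dTheta_ k) (lambda_ k).
Let V := potential dF dTheta lambda.

Let C_ge0 : 0 <= C. Proof. by apply: le_trans (fine_ge0 _) (mass_le 0%N). Qed.

Let V_lim x : V_ ^~ x @ \oo --> V x.
Proof.
apply: cvgD; first exact: dF_lim.
apply: (Rintegral_uniform_cvg T_compact mass_le lambda_cvg).
- by move=> k; exact: (regular_derivative_continuous (reg_ k)).
- exact: (regular_derivative_continuous reg).
- by move=> e e0; have := uniform_near x e0; apply: filterS => k h t; exact: (h t).2.
Qed.

Let V_equi x (e : R) : 0 < e -> \forall y \near x, forall k, `|V_ k x - V_ k y| <= e.
Proof.
move=> e0; have e2 : 0 < e / 2 by rewrite divr_gt0.
pose d := e / (2 * (C + 1)).
have d0 : 0 < d by rewrite divr_gt0// mulr_gt0// ltr_wpDl.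
have Cd : C * d <= e / 2.
  have -> : e / 2 = (C + 1) * d by rewrite /d; field; rewrite gt_eqF// ltr_wpDl.
  by rewrite ler_wpM2r ?(ltW d0)// lerDl.
have h1 := equicontinuous_near x dF_equi e2.
have h2 := equicontinuous_near x dTheta_equi d0.
near=> y => k.
have h3 : `|dF_ k x - dF_ k y| <= e / 2 by move: k; near: y.
have h4 t : `|dTheta_ k t x - dTheta_ k t y| <= d.
  suff : forall i : T * nat, `|dTheta_ i.2 i.1 x - dTheta_ i.2 i.1 y| <= d by move/(_ (t, k)).
  by near: y.
have h5 := Rintegral_uniform_le T_compact
  (@regular_derivative_continuous _ _ _ _ _ _ _ _ _ _ (reg_ k) x)
  (@regular_derivative_continuous _ _ _ _ _ _ _ _ _ _ (reg_ k) y)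
  (ltW d0) (mass_le k) h4.
rewrite /V_ /potential opprD addrACA; apply: le_trans (ler_normD _ _) _.
by lra.
Unshelve. all: by end_near. Qed.

Let c := B * (1 + C) + 1.

Let c_gt0 : 0 < c. Proof. by rewrite ltr_wpDl// mulr_ge0// addr_ge0. Qed.

Let V_le k x : `|V_ k x| <= c * (1 + phi x).
Proof.
apply: le_trans (potential_le T_compact (reg_ k) (dF_le k) (dTheta_le k) (lambda_ k) x) _.
rewrite ler_wpM2r ?oneDweight_ge0//.
have : B * (1 + fine (lambda_ k setT)) <= B * (1 + C) by rewrite ler_wpM2l// lerD2l.
by rewrite /c; lra.
Qed.

Let Z := partition_function nu V.

Let mV : measurable_fun [set: borel E] V := potential_measurable T_compact reg lambda.

Let iV (mu : Pphi phi) : mu.-integrable [set: borel E] (EFin \o V).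
Proof. exact: (potential_integrable T_compact reg limit_dF_le limit_dTheta_le). Qed.

Let iexpV : nu.-integrable [set: borel E] (EFin \o (fun x => expR (- V x))).
Proof.
have [b [nub _]] := exp_moments c_gt0.
apply: (exp_order_integrable nub (A := expR c)).
  by apply: measurableT_comp => //; apply: measurableT_comp.
move=> x; rewrite ger0_norm ?expR_ge0// -expRD ler_expR.
have := equicontinuous_limit_le V_lim V_le x; rewrite mulrDr mulr1.
by have := ler_norm (- V x); rewrite normrN; lra.
Qed.

Let Z_gt0 : 0 < Z.
Proof. by apply: lt_le_trans (partition_function_jensen iexpV (iV nu)); exact: expR_gt0. Qed.

Let exp_lim (g : E -> R) : Cb g ->
  \int[nu_ k]_x (g x * expR (- V_ k x)) @[k --> \oo] --> \int[nu]_x (g x * expR (- V x)).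
Proof. exact: (cvg_equicontinuous_exp nu_cvg exp_moments c_gt0 V_equi V_lim V_le). Qed.

Let Cb_exp_integrable (m : Pphi phi) (W g : E -> R) : Cb g ->
  m.-integrable [set: borel E] (EFin \o (fun x => expR (- W x))) ->
  measurable_fun [set: borel E] W ->
  m.-integrable [set: borel E] (EFin \o (fun x => g x * expR (- W x))).
Proof.
move=> Cg iW mW; have [_ [M gM]] := Cg.
have iMW : m.-integrable [set: borel E] (EFin \o (fun x => M * expR (- W x))).
  by have := integrableZl measurableT M iW.
apply: (integrable_dominated _ iMW) => [|x].
  apply: measurable_funM; first exact: Cb_measurable.
  by apply: measurableT_comp => //; apply: measurableT_comp.
by rewrite normrM (ger0_norm (expR_ge0 _)) ler_wpM2r ?expR_ge0.
Qed.

(** mub and the Gibbs measure of V are compared on bounded continuous functions: both numerators and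
    partition functions converge, while the integrals against mub_ k converge to those against
    mub. *)
Let limit_density : has_density mub nu (fun x => Z^-1 * expR (- V x)).
Proof.
pose g x := Z^-1 * expR (- V x).
have mg : measurable_fun [set: borel E] g.
  by apply: measurable_funM => //; apply: measurableT_comp => //; apply: measurableT_comp.
have g0 x : 0 <= g x by rewrite mulr_ge0 ?expR_ge0// invr_ge0 ltW.
have ig : nu.-integrable [set: borel E] (EFin \o g).
  by have := integrableZl measurableT Z^-1 iexpV.
have g1 : (\int[nu]_x (g x)%:E = 1)%E.
  by rewrite -EFin_Rintegral// RintegralZl// -/Z mulVf// gt_eqF.
have dP := density_probability_has_density mg g0 g1.
split => // A mA; have [_ _ <-//] := dP.
apply: eq_measure_Cb => // h Ch _.
have Zk_lim : partition_function (nu_ k) (V_ k) @[k --> \oo] --> Z.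
  have := exp_lim (Cb_cst 1); rewrite /Z /partition_function.
  by under eq_cvg do under eq_Rintegral do rewrite mul1r; under eq_Rintegral do rewrite mul1r.
have hk k : \int[mub_ k]_x h x = (partition_function (nu_ k) (V_ k))^-1 *
    \int[nu_ k]_x (h x * expR (- V_ k x)).
  have mVk : measurable_fun [set: borel E] (V_ k).
    exact: (potential_measurable T_compact (reg_ k)).
  have iVk := gibbs_exp_integrable T_compact (reg_ k) (multiplier_ k).
  rewrite -RintegralZl//; last exact: Cb_exp_integrable.
  rewrite (Rintegral_density (gibbs_density T_compact (reg_ k) (multiplier_ k)));
    last exact: Cb_measurable.
  by apply: eq_Rintegral => x _; rewrite mulrCA.
rewrite (Rintegral_density dP); last exact: Cb_measurable.
have hg : \int[nu]_x (h x * g x) = Z^-1 * \int[nu]_x (h x * expR (- V x)).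
  rewrite -RintegralZl//; last exact: Cb_exp_integrable.
  by apply: eq_Rintegral => x _; rewrite mulrCA.
have L : (fun k => \int[mub_ k]_x h x) @ \oo --> Z^-1 * \int[nu]_x (h x * expR (- V x)).
  rewrite (funext hk).
  by apply: cvgM; [apply: cvgV => //; rewrite gt_eqF|exact: exp_lim].
rewrite hg; apply: (cvg_unique _ _ L) => //.
exact: (cvg_pphi_order1 mub_ mub).1 mub_cvg h (or_intror Ch).
Qed.

Theorem limit_multiplier :
  gibbs_with_multiplier nu mub dF (fun t => Theta t mub) dTheta lambda.
Proof.
split.
  exists Z => //; split; first exact: has_density_dominates limit_density.
  apply: filterS (has_density_RN limit_density) => x.
  by rewrite /density => ->; rewrite /V /potential opprD.
apply: (Rintegral_nonpos_eq0 T_compact); first exact: (regular_constraint_continuous reg).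
  exact: limit_admissible.
have : \int[lambda_ k]_t Theta_ k t (mub_ k) @[k --> \oo] --> \int[lambda]_t Theta t mub.
  apply: (Rintegral_uniform_cvg T_compact mass_le lambda_cvg).
  - by move=> k; exact: (regular_constraint_continuous (reg_ k)).
  - exact: (regular_constraint_continuous reg).
  - by move=> e e0; have := uniform_near point e0; apply: filterS => k h t; exact: (h t).1.
rewrite (_ : (fun k => \int[lambda_ k]_t Theta_ k t (mub_ k)) = cst 0); last first.
  by apply/funext => k; exact: (gibbs_slackness T_compact (reg_ k) (multiplier_ k)).
by move=> h; apply: (cvg_unique _ h (cvg_cst 0)).
Qed.

End limit.

(** * Uniform bounds and convergence of minimisers and multipliers *)

Section stability.
Context {R : realType} {E : pmetricType R} {phi : weight E} {T : pmetricType R}.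
Hypothesis E_separable : separable E.
Hypothesis T_compact : compact [set: T].
Variables (nu : Pphi phi) (nuk : nat -> Pphi phi).
Variables (F : Pphi phi -> \bar R) (Fk : nat -> Pphi phi -> \bar R).
Hypothesis F_Ny : forall mu, (-oo < F mu)%E.
Hypothesis F_convex : convex_functional F.
Variables (Psi : T -> Pphi phi -> R) (Psik : nat -> T -> Pphi phi -> R).
Hypothesis Psi_convex : forall t, convex_functional (fun mu => (Psi t mu)%:E).
Hypothesis Psik_convex : forall k t, convex_functional (fun mu => (Psik k t mu)%:E).
Hypothesis nu_cvg : nuk @ \oo --> nu.
Hypothesis exp_moments : forall a : R, 0 < a -> exists b : R,
  exp_moment_le nu a b /\ forall k, exp_moment_le (nuk k) a b.
Variables (mubk mut : nat -> Pphi phi) (dFk : nat -> E -> R) (dPsik : nat -> T -> E -> R).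
Hypothesis mubk_admissible : forall k, admissible (Psik k) (mubk k).
Variables (K : nat) (B M delta : R).
Hypothesis mut_entropy : forall k, (rel_entropy (mut k) (nuk k) <= M%:E)%E.
Hypothesis delta_gt0 : 0 < delta.
Hypothesis mut_slater : forall k, (K <= k)%N -> forall t, Psik k t (mut k) <= - delta.
Hypothesis regk : forall k, (K <= k)%N ->
  regular_at (nuk k) (Fk k) (Psik k) (mubk k) (dFk k) (dPsik k).
Hypothesis B_ge0 : 0 <= B.
Hypothesis dFk_le : forall k x, `|dFk k x| <= B * (1 + phi x).
Hypothesis dPsik_le : forall k t x, `|dPsik k t x| <= B * (1 + phi x).

Local Notation multiplierk k := (gibbs_with_multiplier (nuk k) (mubk k) (dFk k)
  (fun t => Psik k t (mubk k)) (dPsik k)).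

Lemma multipliers_bounded : exists C : R, forall k, (K <= k)%N ->
  forall lambda, multiplierk k lambda -> fine (lambda setT) <= C.
Proof.
have [b [_ nub]] := exp_moments ltr01.
exists (mass_bound B delta M b) => k Kk lambda mult.
exact: (mass_le T_compact (Psik_convex k) (regk Kk) B_ge0 (dFk_le k) (dPsik_le k) mult
  delta_gt0 (mut_slater Kk) (mut_entropy k) (nub k)).
Qed.

Lemma multipliers_precompact (lambdak : nat -> Mplus T) :
  (\forall k \near \oo, multiplierk k (lambdak k)) -> precompact (range lambdak).
Proof.
move=> [N _ mult]; have [C mC] := multipliers_bounded.
(* Nothing is known of the first finitely many terms, so their masses are added to the bound by
   hand. *)
pose C' := \big[Num.max/C]_(i < maxn K N) fine (lambdak i setT).
apply: (precompact_subset (B := mass_ball C')) => [_ [k _ <-]|].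
  rewrite mass_ballE; have [h|h] := ltnP k (maxn K N).
    exact: (le_bigmax_cond C (fun i : 'I_(maxn K N) => fine (lambdak i setT)) (j := Ordinal h)).
  apply: le_trans (bigmax_ge_id _ _ _ _); apply: (mC k).
    by apply: leq_trans h; exact: leq_maxl.
  by apply: mult => /=; apply: leq_trans h; exact: leq_maxr.
by rewrite precompact_closed; [exact: mass_ball_compact|exact: mass_ball_closed].
Qed.

Hypothesis multipliers_exist : forall k, (K <= k)%N -> exists lambda, multiplierk k lambda.

(** [gibbs_domination] bounds the mubk k by W nuk k with W independent of k, and [cvg_exp_order]
    replaces nuk k by nu asymptotically. The order c + 1 accounts for test functions growing like 1
    + phi <= exp(phi). *)
Lemma minimisers_extraction (l0 : nat -> nat) : {homo l0 : i j / (i < j)%N} ->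
  (forall k, (K <= l0 k)%N) ->
  exists2 l : nat -> nat, {homo l : i j / (i < j)%N} &
  exists mu : Pphi phi, mubk \o (l0 \o l) @ \oo --> mu.
Proof.
move=> l0_incr Kl0; have [C mC] := multipliers_bounded.
have [b [nub1 nukb1]] := exp_moments ltr01.
pose c := B * (1 + C).
have c0 : 0 <= c.
  have [lambda /(mC _ (leqnn K)) mass] := multipliers_exist (leqnn K).
  by rewrite mulr_ge0// addr_ge0// (le_trans _ mass)// fine_ge0.
pose W x := expR (c * (1 + b + phi x)).
have cW : continuous W.
  move=> x; apply: continuous_comp; last exact: continuous_expR.
  apply: cvgM; first exact: cvg_cst.
  by apply: cvgD; [exact: cvg_cst|exact: weight_continuous].
have mW := continuous_borel_measurable cW.
have W0 x : 0 <= W x by exact: expR_ge0.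
have hW_le (h : E -> R) A x : 0 <= h x <= A * (1 + phi x) ->
    0 <= h x * W x <= A * expR (c * (1 + b)) * expR ((c + 1) * phi x).
  move=> /andP[h0 hA]; rewrite mulr_ge0//=.
  have A0 : 0 <= A by have := le_trans h0 hA; rewrite pmulr_lge0// ltr_pwDl// weight_ge0.
  have -> : A * expR (c * (1 + b)) * expR ((c + 1) * phi x) = A * expR (phi x) * W x.
    rewrite /W -[LHS]mulrA -[RHS]mulrA -!expRD; congr (_ * expR _).
    ring.
  by rewrite ler_wpM2r//; apply: le_trans hA _; rewrite ler_wpM2l// oneD_weight_le_exp.
have c1 : 0 < c + 1 by rewrite ltr_wpDl.
have [b' [nub' nukb']] := exp_moments c1.
have ihW (m : Pphi phi) (h : E -> R) A : exp_moment_le m (c + 1) b' -> continuous h ->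
    (forall x, 0 <= h x <= A * (1 + phi x)) ->
    m.-integrable [set: borel E] (EFin \o (fun x => h x * W x)).
  move=> mb ch hA; apply: (exp_order_integrable mb (A := A * expR (c * (1 + b)))).
    by apply: measurable_funM => //; exact: continuous_borel_measurable.
  by move=> x; have /andP[h0 h1] := hW_le h A x (hA x); rewrite ger0_norm.
have c1phi : continuous (fun x : E => 1 + phi x).
  by move=> x; apply: cvgD; [exact: cvg_cst|exact: weight_continuous].
apply: (@Pphi_extraction R E phi E_separable (mubk \o l0) nu W mW W0).
  by apply: (ihW nu _ 1 nub' c1phi) => x; rewrite mul1r lexx oneDweight_ge0.
move=> h A ch hA e e0.
have lim : \int[nuk k]_x (h x * W x) @[k --> \oo] --> \int[nu]_x (h x * W x).
  apply: (cvg_exp_order nu_cvg exp_moments (A := A * expR (c * (1 + b))) _ _ c1).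
  - by move=> x; apply: cvgM; [exact: ch|exact: cW].
  - have /andP[h0 h1] := hW_le h A point (hA point).
    by have := le_trans h0 h1; rewrite pmulr_lge0// expR_gt0.
  - by move=> x; have /andP[h0 h1] := hW_le h A x (hA x); rewrite ger0_norm.
have /cvgrPdist_le/(_ e e0)
  := cvg_comp _ _ (increasing_cvg l0_incr) lim; apply: filterS => k /= hk.
have [lambda mult] := multipliers_exist (Kl0 k).
have := gibbs_domination T_compact (regk (Kl0 k)) B_ge0 (dFk_le _) (dPsik_le _) mult
  (mC _ (Kl0 k) _ mult) (nukb1 _) (continuous_borel_measurable ch)
  (fun x => (andP (hA x)).1).
move=> /(_ (ihW _ _ A (nukb' _) ch hA)) h1; apply: le_trans h1 _.
by move: hk; rewrite ler_norml -/c => /andP[h1 h2]; rewrite -/(W _); lra.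
Qed.

Variables (dF : Pphi phi -> E -> R) (dPsi : Pphi phi -> T -> E -> R).
Hypothesis limit_regular : forall (l : nat -> nat) (muinf : Pphi phi),
  {homo l : i j / (i < j)%N} -> (mubk \o l) @ \oo --> muinf ->
  [/\ penalised_dom nu F muinf,
      regular_at nu F Psi muinf (dF muinf) (dPsi muinf),
      forall x, (fun k => `| dFk (l k) x - dF muinf x |) @ \oo --> 0,
      forall x, (fun k => sup_over (fun t =>
          `| Psik (l k) t (mubk (l k)) - Psi t muinf |
          + `| dPsik (l k) t x - dPsi muinf t x |)) @ \oo --> 0%E
    & equicontinuous [set: nat] (fun k => dFk (l k)) /\
      equicontinuous [set: T * nat] (fun tk => dPsik (l tk.2) tk.1)].

Local Notation min_at mu :=
  (is_minimiser (penalised nu F) (penalised_dom nu F `&` admissible Psi) mu).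

Lemma multipliers_limit (l : nat -> nat) (muinf : Pphi phi)
    (lambdak : nat -> Mplus T) (lambda : Mplus T) :
  {homo l : i j / (i < j)%N} -> (forall k, (K <= l k)%N) ->
  (mubk \o l) @ \oo --> muinf ->
  (forall k, multiplierk (l k) (lambdak k)) ->
  (forall g, continuous g -> \int[lambdak k]_t g t @[k --> \oo] --> \int[lambda]_t g t) ->
  min_at muinf /\
  gibbs_with_multiplier nu muinf (dF muinf) (fun t => Psi t muinf) (dPsi muinf) lambda.
Proof.
move=> l_incr Kl mu_cvg mult lambda_cvg; have [C mC] := multipliers_bounded.
have [Dmu reg dF_cvg constraint_cvg [dF_equi dPsi_equi]] := limit_regular l_incr mu_cvg.
have nul_cvg : nuk \o l @ \oo --> nu by apply: cvg_comp nu_cvg; exact: increasing_cvg.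
have exp_moments_l (a : R) : 0 < a -> exists b : R,
    exp_moment_le nu a b /\ forall k, exp_moment_le ((nuk \o l) k) a b.
  by move=> /exp_moments[b [nub nukb]]; exists b; split => // k; exact: nukb.
have mult_inf := limit_multiplier T_compact nul_cvg exp_moments_l (fun k => regk (Kl k)) reg
  mult (fun k => mubk_admissible (l k)) B_ge0 (fun k => dFk_le (l k))
  (fun k => dPsik_le (l k)) (fun k => mC _ (Kl k) _ (mult k)) mu_cvg lambda_cvg
  dF_cvg constraint_cvg dF_equi dPsi_equi.
split=> //.
apply: (gibbs_minimiser T_compact F_Ny F_convex Psi_convex reg _ _ mult_inf Dmu).
- exact: (limit_dF_le (fun k => dFk_le (l k)) dF_cvg).
- exact: (limit_dTheta_le (Theta_ := fun k => Psik (l k)) (mub_ := mubk \o l)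
    (fun k => dPsik_le (l k)) constraint_cvg).
- exact: (limit_admissible (fun k => mubk_admissible (l k)) constraint_cvg).
Qed.

(** Multipliers chosen along the convergent minimisers have bounded mass, so a further subsequence
    of them converges too; the limit pair then certifies minimality. *)
Lemma minimisers_limit (l0 : nat -> nat) : {homo l0 : i j / (i < j)%N} ->
  (forall k, (K <= l0 k)%N) ->
  exists2 l : nat -> nat, {homo l : i j / (i < j)%N} &
  exists2 mu : Pphi phi, mubk \o (l0 \o l) @ \oo --> mu & min_at mu.
Proof.
move=> l0_incr Kl0; have [C mC] := multipliers_bounded.
have [l l_incr [mu mu_cvg]] := minimisers_extraction l0_incr Kl0.
have Kl k : (K <= l0 (l k))%N by exact: Kl0.
pose lambdak k := projT1 (cid (multipliers_exist (Kl k))).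
have mult k : multiplierk (l0 (l k)) (lambdak k) := projT2 (cid (multipliers_exist (Kl k))).
have ball k : mass_ball C (lambdak k) by rewrite mass_ballE; exact: mC (mult k).
have [lambda [_ lambda_cluster]] : mass_ball C `&` cluster (lambdak @ \oo) !=set0.
  by apply: (mass_ball_compact T_compact); exact: (@filterE _ \oo _ _ ball).
have [x_ x_dense] := separable_dense_sequence (compact_separable T_compact).
have [l' l'_incr lambda_cvg] := Mplus_cluster_extraction T_compact x_dense
  (@filterE _ \oo _ _ ball) lambda_cluster.
have ll'_incr : {homo l \o l' : i j / (i < j)%N} by move=> i j ij; exact/l_incr/l'_incr.
have mu_cvg' : mubk \o (l0 \o (l \o l')) @ \oo --> mu.
  exact: (cvg_comp _ _ (increasing_cvg l'_incr) mu_cvg).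
exists (l \o l') => //; exists mu => //.
have incr : {homo l0 \o (l \o l') : i j / (i < j)%N} by move=> i j ij; exact/l0_incr/ll'_incr.
exact: (multipliers_limit incr (fun k => Kl (l' k)) mu_cvg' (fun k => mult (l' k)) lambda_cvg).1.
Qed.

Theorem minimisers_cvg : exists mub : Pphi phi, [/\ min_at mub,
  forall mu, min_at mu -> measure_eq mu mub, mubk @ \oo --> mub &
  forall (lambdak : nat -> Mplus T) (lambda : Mplus T),
    (\forall k \near \oo, multiplierk k (lambdak k)) -> cluster (lambdak @ \oo) lambda ->
    gibbs_with_multiplier nu mub (dF mub) (fun t => Psi t mub) (dPsi mub) lambda].
Proof.
have shift_incr n : {homo addn n : i j / (i < j)%N} by move=> i j ij; rewrite ltn_add2l.
have [_ _ [mub _ mub_min]] := minimisers_limit (shift_incr K) (leq_addr^~ K).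
have uniq mu : min_at mu -> measure_eq mu mub.
  by move=> mu_min; exact: (minimiser_measure_eq F_Ny F_convex Psi_convex mu_min mub_min).
have mubk_cvg : mubk @ \oo --> mub.
  (* The subsequence argument is run on one test function at a time. Uniqueness up to [measure_eq]
     is enough, as only integrals are compared. *)
  apply/cvg_pphi_order1 => h hh; apply: contrapT => ncvg.
  have [e e0 far] : exists2 e : R, 0 < e & forall m, exists2 k, (m <= k)%N &
      e < `|\int[mub]_x h x - \int[mubk k]_x h x|.
    apply: contrapT => nfar; apply: ncvg; apply/cvgrPdist_le => e e0.
    apply: contrapT => nnear; apply: nfar; exists e => // m.
    apply: contrapT => nk; apply: nnear; exists m => // k /= mk.
    by rewrite leNgt; apply/negP => lt; apply: nk; exists k.
  have [|l0 l0_incr l0P] := @increasing_choice (fun n k => (K <= k)%N /\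
      e < `|\int[mub]_x h x - \int[mubk k]_x h x|).
    move=> n m; have [k mk lt] := far (maxn m K); exists k.
      by apply: leq_trans mk; exact: leq_maxl.
    by split => //; apply: leq_trans mk; exact: leq_maxr.
  have [l _ [mu mu_cvg mu_min]] := minimisers_limit l0_incr (fun k => (l0P k).1).
  have muE : \int[mu]_x h x = \int[mub]_x h x.
    congr fine; apply: eq_measure_integral => A mA _; exact: uniq.
  have := (cvg_pphi_order1 _ _).1 mu_cvg h hh; rewrite muE => /cvgrPdist_le/(_ e e0)[N _ hN].
  by have := hN N (leqnn N); rewrite /= leNgt (l0P (l N)).2.
exists mub; split => // lambdak lambda [N _ mult] cl.
have [C mC] := multipliers_bounded.
have [x_ x_dense] := separable_dense_sequence (compact_separable T_compact).
have [|l l_incr lambda_cvg] := Mplus_cluster_extraction (C := C) T_compact x_dense _ cl.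
  exists (maxn K N) => // k /=; rewrite geq_max => /andP[Kk Nk].
  by rewrite mass_ballE; apply: mC Kk _ (mult k Nk).
(* The regularity and multiplier hypotheses hold only from rank max(K, N) on; shifting moves the
   whole subsequence beyond it. *)
pose s := addn (maxn K N).
have ls_incr : {homo l \o s : i j / (i < j)%N} by move=> i j ij; exact/l_incr/shift_incr.
have ls_ge k : (maxn K N <= (l \o s) k)%N.
  by apply: leq_trans (increasing_ge l_incr _); exact: leq_addr.
have s_cvg := increasing_cvg (shift_incr (maxn K N)).
apply: (multipliers_limit (lambdak := lambdak \o (l \o s)) ls_incr _ _ _ _).2.
- by move=> k; apply: leq_trans (ls_ge k); exact: leq_maxl.
- by apply: cvg_comp mubk_cvg; exact: increasing_cvg.
- by move=> k; apply: mult => /=; apply: leq_trans (ls_ge k); exact: leq_maxr.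
- by move=> g cg; exact: (cvg_comp _ _ s_cvg (lambda_cvg g cg)).
Qed.

End stability.

Lemma lt_pinfty_bound (R : realType) (x : \bar R) :
  (x < +oo)%E -> exists M : R, (x <= M%:E)%E.
Proof. by case: x => [r||]// _; [exists r|exists 0; exact: leNye]. Qed.

Lemma lt0_bound (R : realType) (x : \bar R) :
  (x < 0)%E -> exists2 d : R, 0 < d & (x <= (- d)%:E)%E.
Proof.
case: x => [r||]//; last by move=> _; exists 1 => //; exact: leNye.
by rewrite lte_fin => r0; exists (- r); rewrite ?oppr_gt0// opprK.
Qed.

Lemma le_sup_over (R : realType) (X : Type) (g : X -> R) (x : X) : ((g x)%:E <= sup_over g)%E.
Proof. by apply: ereal_sup_ubound; exists x. Qed.

Lemma sup_exp_moments (R : realType) (E : pmetricType R) (phi : weight E)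
    (nu : Pphi phi) (nuk : nat -> Pphi phi) :
  (forall alpha : R, 0 < alpha ->
    (ereal_sup (range (fun k => \int[nu]_x (expR (alpha * phi x))%:E
                                + \int[nuk k]_x (expR (alpha * phi x))%:E)) < +oo)%E) ->
  forall a : R, 0 < a -> exists b : R,
    exp_moment_le nu a b /\ forall k, exp_moment_le (nuk k) a b.
Proof.
move=> fin_sup a a0; have [b hb] := lt_pinfty_bound (fin_sup a a0).
have ge0 (m : Pphi phi) : (0 <= \int[m]_x (expR (a * phi x))%:E)%E.
  by apply: integral_ge0 => x _; rewrite lee_fin expR_ge0.
have sum_le k : (\int[nu]_x (expR (a * phi x))%:E
    + \int[nuk k]_x (expR (a * phi x))%:E <= b%:E)%E.
  by apply: le_trans hb; apply: ereal_sup_ubound; exists k.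
exists b; split=> [|k]; first by apply: le_trans (sum_le 0%N); rewrite leeDl.
by apply: le_trans (sum_le k); rewrite leeDr.
Qed.

(* Sequences are indexed from 0: the index k here is the index k + 1 of a
   sequence indexed by k >= 1. *)
Theorem theorem2p22 (R : realType)
  (E : completeMetricType R) (E_separable : separable E)
  (T : pmetricType R) (T_compact : compact [set: T])
  (phi : weight E)
  (nu : Pphi phi) (nuk : nat -> Pphi phi)
  (F : Pphi phi -> \bar R) (Fk : nat -> Pphi phi -> \bar R)
  (F_Ny : forall mu, (-oo < F mu)%E) (Fk_Ny : forall k mu, (-oo < Fk k mu)%E)
  (Psi : T -> Pphi phi -> R) (Psik : nat -> T -> Pphi phi -> R)
  (* dF mu x stands for (delta F / delta mu)(mu, x); it is a derivative of F
     at mu, in the sense of is_derivative_at, only where the hypotheses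
     regular_at below say so. Likewise for dFk, dPsi and dPsik. *)
  (dF : Pphi phi -> E -> R) (dFk : nat -> Pphi phi -> E -> R)
  (dPsi : T -> Pphi phi -> E -> R) (dPsik : nat -> T -> Pphi phi -> E -> R) :
  let I := penalised nu F in
  let DI := penalised_dom nu F in
  let Ik k := penalised (nuk k) (Fk k) in
  let DIk k := penalised_dom (nuk k) (Fk k) in
  let supPsi mu := sup_over (fun t => Psi t mu) in
  let supPsik k mu := sup_over (fun t => Psik k t mu) in
  forall
  (S1 : [/\ lower_semicontinuous I,
      forall k, lower_semicontinuous (Ik k),
      forall t, lower_semicontinuous (fun mu => (Psi t mu)%:E),
      forall k t, lower_semicontinuous (fun mu => (Psik k t mu)%:E)
    & forall k (a : R), compact [set mu | (Ik k mu <= a%:E)%E]])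
  (S2 : [/\ convex_functional F,
      forall k, convex_functional (Fk k),
      forall t, convex_functional (fun mu => (Psi t mu)%:E)
    & forall k t, convex_functional (fun mu => (Psik k t mu)%:E)])
  (S3 : forall k (mu : Pphi phi), has_bounded_density mu (nuk k) -> DIk k mu)
  (S4 : nuk @ \oo --> nu /\
    forall alpha : R, 0 < alpha ->
      (ereal_sup (range (fun k => \int[nu]_x (expR (alpha * phi x))%:E
                                  + \int[nuk k]_x (expR (alpha * phi x))%:E))
       < +oo)%E)
  (S5 : forall mu, cvgn (supPsik ^~ mu) /\ (limn (supPsik ^~ mu) <= supPsi mu)%E)
  (S6 : forall (mul : nat -> Pphi phi) (mu : Pphi phi), mul @ \oo --> mu ->
    (fun l => ereal_sup (range (fun k =>
      `| supPsik k (mul l) - supPsik k mu |))%E) @ \oo --> 0%E /\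
    (fun l => `| supPsi (mul l) - supPsi mu |%E) @ \oo --> 0%E)
  (S7 : exists2 mu, DI mu & (supPsi mu < 0)%E),
  let minimiserk k := is_minimiser (Ik k) (DIk k `&` admissible (Psik k)) in
  let slater (mut : nat -> Pphi phi) k0 :=
    [/\ forall k, DIk k (mut k),
        (ereal_sup (range (fun k => rel_entropy (mut k) (nuk k))) < +oo)%E
      & (ereal_sup [set supPsik k (mut k) | k in [set k | (k0 <= k)%N]] < 0)%E]
  in
  [/\ forall k, DIk k `&` admissible (Psik k) !=set0 ->
        exists2 mu, minimiserk k mu &
          forall mu', minimiserk k mu' -> measure_eq mu' mu,
      exists mut k0, slater mut k0
    & forall (mubk : nat -> Pphi phi) (mut : nat -> Pphi phi) (k0 : nat)
      (mubk_minimiser : forall k, minimiserk k (mubk k))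
      (mut_slater : slater mut k0)
      (R1 : \forall k \near \oo, regular_at (nuk k) (Fk k) (Psik k) (mubk k)
              (dFk k (mubk k)) (fun t => dPsik k t (mubk k)))
      (R2 : forall k, (k0 <= k)%N -> forall mu : Pphi phi,
        has_bounded_density mu (mubk k) \/ has_bounded_density mu (mut k) ->
        DIk k mu)
      (R3 : exists2 D : R, 0 <= D & forall x,
        (ereal_sup (range (fun k => `| dFk k (mubk k) x |%:E
            + sup_over (fun t => `| dPsik k t (mubk k) x |%R)))
         <= (D * (1 + phi x))%:E)%E),
      let multiplierk k := gibbs_with_multiplier (nuk k) (mubk k)
        (dFk k (mubk k)) (fun t => Psik k t (mubk k))
        (fun t => dPsik k t (mubk k)) in
      [/\ \forall k \near \oo, exists lambda, multiplierk k lambda,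
          forall lambdak : nat -> Mplus T,
            (\forall k \near \oo, multiplierk k (lambdak k)) ->
            precompact (range lambdak)
        & forall (R4 : forall (l : nat -> nat) (muinf : Pphi phi),
            {homo l : i j / (i < j)%N} -> (mubk \o l) @ \oo --> muinf ->
            [/\ DI muinf,
                regular_at nu F Psi muinf (dF muinf) (fun t => dPsi t muinf),
                forall x, (fun k => `| dFk (l k) (mubk (l k)) x - dF muinf x |)
                  @ \oo --> 0,
                forall x, (fun k => sup_over (fun t =>
                    `| Psik (l k) t (mubk (l k)) - Psi t muinf |
                    + `| dPsik (l k) t (mubk (l k)) x - dPsi t muinf x |))
                  @ \oo --> 0%E
              & equicontinuous [set: nat] (fun k => dFk (l k) (mubk (l k))) /\
                equicontinuous [set: T * nat]
                  (fun tk => dPsik (l tk.2) tk.1 (mubk (l tk.2)))]),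
          exists mub : Pphi phi,
          [/\ is_minimiser I (DI `&` admissible Psi) mub,
              forall mu, is_minimiser I (DI `&` admissible Psi) mu ->
                measure_eq mu mub,
              mubk @ \oo --> mub
            & forall (lambdak : nat -> Mplus T) (lambda : Mplus T),
                (\forall k \near \oo, multiplierk k (lambdak k)) ->
                cluster (lambdak @ \oo) lambda ->
                gibbs_with_multiplier nu mub (dF mub) (fun t => Psi t mub)
                  (fun t => dPsi t mub) lambda]]].
Proof.
move=> I DI Ik DIk supPsi supPsik [_ Ik_lsc _ Psik_lsc Ik_compact].
move=> [F_convex Fk_convex Psi_convex Psik_convex] S3 [nu_cvg S4] S5 S6.
move=> [mu0 Dmu0 mu0_slater] minimiserk slater.
have exp_moments := sup_exp_moments S4.
split.
- move=> k ne.
  have [mu mu_min] := minimiser_exists (Fk_Ny k) (Ik_lsc k) (Ik_compact k) (Psik_lsc k) ne.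
  exists mu => // mu' mu'_min.
  exact: (minimiser_measure_eq (Fk_Ny k) (Fk_convex k) (Psik_convex k) mu'_min mu_min).
(* Finite entropy of the strictly feasible point gives its absolute continuity, the starting point
   of the approximation; bounded densities then enter the domains through S3. *)
- have [mut [k0 [M [d [mut_bd mut_entropy d_gt0 mut_slater]]]]] :=
    slater_sequence E_separable nu_cvg exp_moments S5 (fun mul mu h => (S6 mul mu h).1)
      (rel_entropy_dominates Dmu0.1) mu0_slater.
  exists mut, k0; split.
  + by move=> k; exact: S3.
  + by apply: le_lt_trans (ltry M); apply: ge_ereal_sup => _ [k _ <-]; exact: mut_entropy.
  + apply: (@le_lt_trans _ _ (- d)%:E); last by rewrite lte_fin oppr_lt0.
    by apply: ge_ereal_sup => _ [k k0k <-]; exact: mut_slater.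
move=> mubk mut k0 mubk_min [Dmut ent_fin slat] [K _ R1] R2 [B B0 R3] multiplierk.
have [M ent_sup] := lt_pinfty_bound ent_fin.
have [d d_gt0 slat_sup] := lt0_bound slat.
have mut_entropy k : (rel_entropy (mut k) (nuk k) <= M%:E)%E.
  by apply: le_trans ent_sup; apply: ereal_sup_ubound; exists k.
have bound k x : (`|dFk k (mubk k) x|%:E
    + sup_over (fun t => `|dPsik k t (mubk k) x|%R) <= (B * (1 + phi x))%:E)%E.
  by apply: le_trans (R3 x); apply: ereal_sup_ubound; exists k.
have dFk_le k x : `|dFk k (mubk k) x| <= B * (1 + phi x).
  rewrite -lee_fin; apply: le_trans (bound k x); rewrite leeDl//.
  by apply: le_trans (le_sup_over (fun t => `|dPsik k t (mubk k) x|) point); rewrite lee_fin.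
have dPsik_le k t x : `|dPsik k t (mubk k) x| <= B * (1 + phi x).
  rewrite -lee_fin; apply: le_trans (bound k x).
  by apply: le_trans (le_sup_over (fun t => `|dPsik k t (mubk k) x|) t) _; rewrite leeDr.
have regk k : (maxn K k0 <= k)%N -> regular_at (nuk k) (Fk k) (Psik k) (mubk k)
    (dFk k (mubk k)) (fun t => dPsik k t (mubk k)).
  by rewrite geq_max => /andP[Kk _]; exact: R1.
have mut_slater k : (maxn K k0 <= k)%N -> forall t, Psik k t (mut k) <= - d.
  rewrite geq_max => /andP[_ k0k] t; rewrite -lee_fin; apply: le_trans slat_sup.
  apply: le_trans (le_sup_over (fun t => Psik k t (mut k)) t) _.
  by apply: ereal_sup_ubound; exists k.
(* The rank max(K, k0) is where both regularity at mubk k and strict feasibility of mut k are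
   available. *)
have multipliers_exist k : (maxn K k0 <= k)%N -> exists lambda, multiplierk k lambda.
  move=> Kk; apply: (gibbs_multiplier_exists T_compact (Fk_Ny k) (Fk_convex k) (Psik_convex k)
    (regk k Kk) B0 (dFk_le k) (dPsik_le k) (mubk_min k) (Dmut k) d_gt0 (mut_slater k Kk) (S3 k)).
  by move=> a /exp_moments[b [_ nukb]]; exists b.
have mubk_admissible k : admissible (Psik k) (mubk k) := (mubk_min k).1.2.
split.
- by exists (maxn K k0).
- move=> lambdak.
  exact: (multipliers_precompact T_compact Psik_convex exp_moments mut_entropy d_gt0
    mut_slater regk B0 dFk_le dPsik_le).
- move=> R4.
  exact: (minimisers_cvg E_separable T_compact F_Ny F_convex Psi_convex Psik_convex nu_cvg
    exp_moments mubk_admissible mut_entropy d_gt0 mut_slater regk B0 dFk_le dPsik_le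
    multipliers_exist (dPsi := fun mu t => dPsi t mu) R4).
Qed.
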